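(* Let $\mathfrak g$ be a finite-dimensional complex Lie algebra, $H=U(\mathfrak g)$, and let $R$ be a simple unital associative $H$-pseudoalgebra. Assume that the maximal unital current subalgebra of $R$ having the same pseudoidentity as $R$ is finite (finitely generated) as an $H$-module and simple. Then $R$ is isomorphic to one of the following: (1) $\mathrm{Cur}\,\mathrm{End}_n(\mathbb C)$, $n\ge 0$; (2) $\mathrm{Cur}_{H'}^{H}\,\mathrm{Cend}_n$, where $H'$ is a Hopf subalgebra of $H$ and $\mathrm{Cend}_n$ is taken over $H'$, $n>0$; (3) $\mathrm{Cur}_{H'}^{H}\,\mathrm{Cend}_n^{\phi}$, where $H'=U(\mathfrak h)$ is a Hopf subalgebra of $H$ ($\mathfrak h\subset\mathfrak g$ a Lie subalgebra), $\phi\in H^2(\mathfrak h,\mathbb C)$, and $\mathrm{Cend}_n^\phi$ is taken over $H'$, $n>0$.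
   Context: Ground field $\mathbb C$; $H=U(\mathfrak g)$ has its standard Hopf structure $(\Delta,\varepsilon,S)$, Sweedler notation $\Delta(h)=h_{(1)}\otimes h_{(2)}$. Pseudoalgebras. An associative $H$-pseudoalgebra is a left $H$-module $R$ with a linear map $R\otimes R\to (H\otimes H)\otimes_H R$, $a\otimes b\mapsto a*b$ (where $H$ acts on $H\otimes H$ from the right via $\Delta$), such that $(fa)*(gb)=((f\otimes g)\otimes_H 1)(a*b)$ for $f,g\in H$, and $(a*b)*c=a*(b*c)$ in $H^{\otimes 3}\otimes_H R$. Here, if $d*c=\sum_i\beta_i\otimes_H c_i$, then $(\gamma\otimes_H d)*c=\sum_i(\gamma\otimes 1)(\Delta\otimes\mathrm{id})(\beta_i)\otimes_H c_i$, and if $a*d=\sum_i\beta_i\otimes_H c_i$, then $a*(\gamma\otimes_H d)=\sum_i(1\otimes\gamma)(\mathrm{id}\otimes\Delta)(\beta_i)\otimes_H c_i$, for $\gamma\in H\otimes H$. Dual algebra and $x$-products. $X=H^*=\mathrm{Hom}_{\mathbb C}(H,\mathbb C)$ is a commutative algebra with $\langle xy,h\rangle=\langle x,h_{(1)}\rangle\langle y,h_{(2)}\rangle$ and unit $1=\varepsilon$; it has a coproduct $\Delta:X\to X\hat\otimes X=(H\otimes H)^*$, $\langle x,fg\rangle=\langle x_{(1)},f\rangle\langle x_{(2)},g\rangle$, and antipode $\langle S(x),h\rangle=\langle x,S(h)\rangle$. Writing $a*b=\sum_i(f_i\otimes 1)\otimes_H e_i$, one puts $a_xb=\sum_i\langle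 S(x),f_i\rangle e_i$ for $x\in X$; so $a*b=\sum_i(S(h_i)\otimes1)\otimes_H(a_{x_i}b)$ for dual bases $\{h_i\}$, $\{x_i\}$ of $H$, $X$. An ideal of $R$ is an $H$-submodule $I$ with $I_xR\subset I$, $R_xI\subset I$ for all $x\in X$; $R$ is simple if its only ideals are $0$ and $R$. Current extensions. For a Hopf subalgebra $H'\subset H$ and an $H'$-pseudoalgebra $R'$, $\mathrm{Cur}_{H'}^HR'=H\otimes_{H'}R'$ with pseudoproduct extending that of $R'$ by $H$-bilinearity: if $a*b=\sum_i(f_i\otimes g_i)\otimes_{H'}c_i$ then $(f\otimes_{H'}a)*(g\otimes_{H'}b)=\sum_i(ff_i\otimes gg_i)\otimes_H(1\otimes_{H'}c_i)$. For an ordinary associative algebra $B$, $\mathrm{Cur}\,B=H\otimes B$ with $(f\otimes a)*(g\otimes b)=(f\otimes g)\otimes_H(1\otimes ab)$; such pseudoalgebras are called current. Unital. $\mathrm{Cur}\,\mathbb C=He$ with $e*e=(1\otimes1)\otimes_He$. $R$ is unital if there is an embedding of pseudoalgebras $\mathrm{Cur}\,\mathbb C\to R$ with $e_1r=r$ for all $r\in R$ (equivalently, $R$ as a left $\mathrm{Cur}\,\mathbb C$-module has no nonzero component on which $e$ acts by zero); the image of $e$, also denoted $e$, is the pseudoidentity of $R$. A unital current subalgebra with the same pseudoidentity is a subalgebra of the form $\mathrm{Cur}\,B$, $B$ a unital associative algebra, with $e=1\otimes1_B$. Differential pseudoalgebras. An $X^{cop}$-algebra is an associative algebra $A$ that is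 a left $X$-module with $x(ab)=(x_{(2)}a)(x_{(1)}b)$ and such that the annihilator in $X$ of each $a\in A$ has finite codimension. $\mathrm{Diff}\,A=H\otimes A$ with pseudoproduct determined by $H$-bilinearity and $(1\otimes a)_x(1\otimes b)=1\otimes(a\,x(b))$. $\mathrm{Cend}_n$ and $\mathrm{Cend}_n^\phi$ (over $U(\mathfrak h)$; here $H=U(\mathfrak h)$, $X=U(\mathfrak h)^*$). $\mathrm{Cend}_n=H\otimes H\otimes\mathrm{End}_n(\mathbb C)$ with $H$ acting on the first factor and $$(f\otimes a\otimes P)*(g\otimes b\otimes Q)=(f\otimes ga_{(1)})\otimes_H(1\otimes ba_{(2)}\otimes PQ).$$ For a 2-cocycle $\phi$ on $\mathfrak h$ let $\widehat{\mathfrak h^{op}}=\mathfrak h\oplus\mathbb C\mathtt c$ be the central extension $0\to\mathbb C\mathtt c\to\widehat{\mathfrak h^{op}}\to\mathfrak h^{op}\to0$ defined by $\phi$ (where $\mathfrak h^{op}$ is $\mathfrak h$ with the opposite bracket) and $U_\phi=U(\widehat{\mathfrak h^{op}})/(1-\mathtt c)$. There is an algebra homomorphism $\rho:U_\phi\to U_\phi\otimes U(\mathfrak h)^{op}$ with $\rho(\partial)=\partial\otimes1+1\otimes\partial$ for $\partial\in\mathfrak h$; writing $\rho(u)=u_{(0)}\otimes u_{(1)}$, $X$ acts on $U_\phi$ by $x(u)=u_{(0)}\langle x,u_{(1)}\rangle$, making it an $X^{cop}$-algebra (if $\{t_i\}\subset X$ is the part of the dual basis dual to a basis $\{\partial_i\}$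 of $\mathfrak h$, then $t_i(\partial_j)=\delta_{ij}$). Then $\mathrm{Cend}_n^\phi=\mathrm{Diff}(\mathrm{End}_n(\mathbb C)\otimes U_\phi)$ with $X$ acting on the second factor; up to isomorphism it depends only on the class of $\phi$, and for trivial $\phi$ it is $\mathrm{Cend}_n$. *)

(* Defs.v *)
From HB Require Import structures.
From mathcomp Require Import all_boot all_order all_algebra.
From mathcomp Require Import boolp classical_sets reals complex.

Set Implicit Arguments.
Unset Strict Implicit.
Unset Printing Implicit Defensive.

Import GRing.Theory.
Local Open Scope ring_scope.
Local Open Scope quotient_scope.

Reserved Notation "x ** y" (at level 40, left associativity).
Reserved Notation "x \ox y" (at level 45, left associativity).
Reserved Notation "t \oxH r" (at level 47, no associativity).

(* The library's [algType] requires 1 != 0, which excludes End_0 and would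
   make the construction of U_phi and of tensor products depend on
   non-degeneracy theorems; the zero algebra is allowed here. *)
HB.mixin Record Lmodule_isPzAlgebra (K : fieldType) A of GRing.Lmodule K A := {
  amul : A -> A -> A;
  aone : A;
  amulA : associative amul;
  amul1a : left_id aone amul;
  amula1 : right_id aone amul;
  amul_linl : forall y : A, linear (amul^~ y);
  amul_linr : forall x : A, linear (amul x)
}.

#[short(type="pzAlgType")]
HB.structure Definition PzAlgebra (K : fieldType) :=
  {A of GRing.Lmodule K A & Lmodule_isPzAlgebra K A}.

Notation "x ** y" := (amul x y) : ring_scope.
Arguments aone {K s}.

Section Linear.
Variable K : fieldType.
Implicit Types U V W : lmodType K.

Lemma linD U V (f : U -> V) : linear f -> forall x y, f (x + y) = f x + f y.
Proof. by move=> lf x y; rewrite -[x]scale1r lf !scale1r. Qed.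

Lemma lin0 U V (f : U -> V) : linear f -> f 0 = 0.
Proof.
by move=> lf; apply: (addrI (f 0)); rewrite -(linD lf) !addr0.
Qed.

Lemma linZ U V (f : U -> V) : linear f -> forall k x, f (k *: x) = k *: f x.
Proof. by move=> lf k x; rewrite -[k *: x]addr0 lf (lin0 lf) !addr0. Qed.

Lemma linN U V (f : U -> V) : linear f -> forall x, f (- x) = - f x.
Proof. by move=> lf x; rewrite -!scaleN1r (linZ lf). Qed.

Lemma linP U V (f : U -> V) : (forall x y, f (x + y) = f x + f y) ->
  (forall k x, f (k *: x) = k *: f x) -> linear f.
Proof. by move=> fD fZ k x y; rewrite fD fZ. Qed.

Lemma lin_id U : linear (fun x : U => x).
Proof. by []. Qed.

Lemma lin_comp U V W (f : U -> V) (g : V -> W) :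
  linear f -> linear g -> linear (fun x => g (f x)).
Proof. by move=> lf lg k x y; rewrite lf lg. Qed.

Lemma lin_add U V (f g : U -> V) :
  linear f -> linear g -> linear (fun x => f x + g x).
Proof. by move=> lf lg k x y; rewrite lf lg scalerDr addrACA. Qed.

Lemma lin_opp U V (f : U -> V) : linear f -> linear (fun x => - f x).
Proof. by move=> lf k x y; rewrite lf opprD scalerN. Qed.

Lemma lin_scale U V k (f : U -> V) : linear f -> linear (fun x => k *: f x).
Proof.
by move=> lf c x y; rewrite lf scalerDr !scalerA mulrC.
Qed.

Lemma lin_scalel U V (v : V) (f : U -> K^o) :
  linear f -> linear (fun x => (f x : K) *: v).
Proof. by move=> lf c x y; rewrite lf scalerDl scalerA. Qed.

End Linear.

Section AlgTheory.
Variables (K : fieldType) (A : pzAlgType K).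
Implicit Types x y z : A.

Lemma amulDl x y z : (x + y) ** z = x ** z + y ** z.
Proof. exact: (linD (amul_linl z)). Qed.
Lemma amulDr x y z : x ** (y + z) = x ** y + x ** z.
Proof. exact: (linD (amul_linr x)). Qed.
Lemma amulZl k x z : (k *: x) ** z = k *: (x ** z).
Proof. exact: (linZ (amul_linl z)). Qed.
Lemma amulZr k x z : x ** (k *: z) = k *: (x ** z).
Proof. exact: (linZ (amul_linr x)). Qed.
Lemma amul0l x : 0 ** x = 0. Proof. exact: (lin0 (amul_linl x)). Qed.
Lemma amul0r x : x ** 0 = 0. Proof. exact: (lin0 (amul_linr x)). Qed.
Lemma amulNl x y : (- x) ** y = - (x ** y).
Proof. exact: (linN (amul_linl y)). Qed.
Lemma amulNr x y : x ** (- y) = - (x ** y).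
Proof. exact: (linN (amul_linr x)). Qed.

End AlgTheory.

Definition alg_hom (K : fieldType) (A B : pzAlgType K) (f : A -> B) :=
  [/\ linear f, f aone = aone & forall x y, f (x ** y) = f x ** f y].

Section RegularAlgebra.
Variable K : fieldType.
Fact reg_mulA : associative (fun x y : K^o => x * y).
Proof. exact: mulrA. Qed.
Fact reg_mul1 : left_id 1 (fun x y : K^o => x * y).
Proof. exact: mul1r. Qed.
Fact reg_mulr1 : right_id 1 (fun x y : K^o => x * y).
Proof. exact: mulr1. Qed.
Fact reg_linl (y : K^o) : linear (fun x : K^o => x * y : K^o).
Proof. by move=> k u v; rewrite mulrDl /GRing.scale /= mulrA. Qed.
Fact reg_linr (x : K^o) : linear (fun y : K^o => x * y : K^o).
Proof. by move=> k u v; rewrite mulrDr /GRing.scale /= mulrCA. Qed.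
HB.instance Definition _ := Lmodule_isPzAlgebra.Build K K^o
  reg_mulA reg_mul1 reg_mulr1 reg_linl reg_linr.
End RegularAlgebra.

Section MatrixAlgebra.
Variables (K : fieldType) (n : nat).
Local Notation M := 'M[K]_n.
Fact mx_mulA : associative (fun x y : M => x *m y).
Proof. exact: mulmxA. Qed.
Fact mx_mul1 : left_id 1%:M (fun x y : M => x *m y).
Proof. exact: mul1mx. Qed.
Fact mx_mulr1 : right_id 1%:M (fun x y : M => x *m y).
Proof. exact: mulmx1. Qed.
Fact mx_linl (y : M) : linear (fun x : M => x *m y).
Proof. by move=> k u v; rewrite mulmxDl scalemxAl. Qed.
Fact mx_linr (x : M) : linear (fun y : M => x *m y).
Proof. by move=> k u v; rewrite mulmxDr scalemxAr. Qed.
HB.instance Definition _ := Lmodule_isPzAlgebra.Build K M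
  mx_mulA mx_mul1 mx_mulr1 mx_linl mx_linr.
End MatrixAlgebra.

Definition opalg (K : fieldType) (A : pzAlgType K) : Type := A.

Section OppositeAlgebra.
Variables (K : fieldType) (A : pzAlgType K).
HB.instance Definition _ := GRing.Lmodule.on (opalg A).
Definition toop (x : A) : opalg A := x.
Definition unop (x : opalg A) : A := x.
Definition opmul (x y : opalg A) : opalg A := toop (unop y ** unop x).
Fact opmulA : associative opmul.
Proof. by move=> x y z; rewrite /opmul /toop /unop amulA. Qed.
Fact opmul1 : left_id (toop aone) opmul.
Proof. by move=> x; rewrite /opmul /toop /unop amula1. Qed.
Fact opmulr1 : right_id (toop aone) opmul.
Proof. by move=> x; rewrite /opmul /toop /unop amul1a. Qed.
Fact op_linl (y : opalg A) : linear (opmul^~ y).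
Proof. exact: (amul_linr (unop y)). Qed.
Fact op_linr (x : opalg A) : linear (opmul x).
Proof. exact: (amul_linl (unop x)). Qed.
HB.instance Definition _ := Lmodule_isPzAlgebra.Build K (opalg A)
  opmulA opmul1 opmulr1 op_linl op_linr.
Lemma opmulE (x y : opalg A) : unop (x ** y) = unop y ** unop x.
Proof. by []. Qed.
Lemma unop_lin : linear unop. Proof. by []. Qed.
Lemma toop_lin : linear toop. Proof. by []. Qed.
End OppositeAlgebra.

Section PropQuotient.
Variables (T : Type) (E : T -> T -> Prop).
Hypotheses (Er : forall x, E x x) (Es : forall x y, E x y -> E y x).
Hypothesis (Et : forall x y z, E x y -> E y z -> E x z).

Definition prel : rel {classic T} := fun x y => `[< E x y >].
Fact prel_refl : reflexive prel.
Proof. by move=> x; apply/asboolP. Qed.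
Fact prel_sym : symmetric prel.
Proof. by move=> x y; apply/asboolP/asboolP; apply: Es. Qed.
Fact prel_trans : transitive prel.
Proof. by move=> y x z /asboolP xy /asboolP yz; apply/asboolP; apply: Et yz. Qed.
Definition peq := EquivRel prel prel_refl prel_sym prel_trans.
Definition pquot := {eq_quot peq}.
HB.instance Definition _ := Choice.on pquot.
Definition pcl (x : T) : pquot := \pi_({eq_quot peq}) (x : {classic T}).
Definition prep (x : pquot) : T := repr (x : {eq_quot peq}).
Lemma prepK x : pcl (prep x) = x.
Proof. exact: reprK. Qed.
Lemma pclP x y : pcl x = pcl y <-> E x y.
Proof.
split; first by move/eqmodP/asboolP.
by move=> e; apply/eqmodP/asboolP.
Qed.
End PropQuotient.

(* [btens ra la] is the tensor product of the K-vector spaces M and N modulo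
   the relations (m.i) (x) n = m (x) (i.n) for i : I, where m.i = ra i m and
   i.n = la i n: the free vector space on symbols m (x) n (presented by formal
   terms) modulo the bilinearity and balancing relations. For I a K-algebra
   acting on M from the right and on N from the left this is M (x)_I N. *)
Section BalancedTensor.
Variables (K : fieldType) (M N : lmodType K) (I : Type).
Variables (ra : I -> M -> M) (la : I -> N -> N).

Inductive tterm : Type :=
| TPure of M & N | TZero | TOpp of tterm | TAdd of tterm & tterm
| TScale of K & tterm.

Inductive tcong : tterm -> tterm -> Prop :=
| tc_refl x : tcong x x
| tc_sym x y : tcong x y -> tcong y x
| tc_trans x y z : tcong x y -> tcong y z -> tcong x z
| tc_opp x y : tcong x y -> tcong (TOpp x) (TOpp y)
| tc_add x y x' y' : tcong x y -> tcong x' y' -> tcong (TAdd x x') (TAdd y y')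
| tc_scale k x y : tcong x y -> tcong (TScale k x) (TScale k y)
| tc_addA x y z : tcong (TAdd x (TAdd y z)) (TAdd (TAdd x y) z)
| tc_addC x y : tcong (TAdd x y) (TAdd y x)
| tc_add0 x : tcong (TAdd TZero x) x
| tc_addN x : tcong (TAdd (TOpp x) x) TZero
| tc_scaleA a b x : tcong (TScale a (TScale b x)) (TScale (a * b) x)
| tc_scale1 x : tcong (TScale 1 x) x
| tc_scaleDr a x y :
    tcong (TScale a (TAdd x y)) (TAdd (TScale a x) (TScale a y))
| tc_scaleDl x a b : tcong (TScale (a + b) x) (TAdd (TScale a x) (TScale b x))
| tc_linl k m m' n :
    tcong (TPure (k *: m + m') n) (TAdd (TScale k (TPure m n)) (TPure m' n))
| tc_linr k m n n' :
    tcong (TPure m (k *: n + n')) (TAdd (TScale k (TPure m n)) (TPure m n'))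
| tc_bal i m n : tcong (TPure (ra i m) n) (TPure m (la i n)).

Definition btens := pquot tc_refl tc_sym tc_trans.
HB.instance Definition _ := Choice.on btens.
Let cl (x : tterm) : btens := pcl tc_refl tc_sym tc_trans x.
Let rp (x : btens) : tterm := @prep _ _ tc_refl tc_sym tc_trans x.

Let bzero : btens := cl TZero.
Let bopp (x : btens) : btens := cl (TOpp (rp x)).
Let badd (x y : btens) : btens := cl (TAdd (rp x) (rp y)).
Let bscale k (x : btens) : btens := cl (TScale k (rp x)).

Let rpC x : tcong (rp (cl x)) x.
Proof. by apply/(pclP tc_refl tc_sym tc_trans); rewrite prepK. Qed.
Let boppE x : bopp (cl x) = cl (TOpp x).
Proof. by apply/pclP/tc_opp/rpC. Qed.
Let baddE x y : badd (cl x) (cl y) = cl (TAdd x y).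
Proof. by apply/pclP/tc_add; apply/rpC. Qed.
Let bscaleE k x : bscale k (cl x) = cl (TScale k x).
Proof. by apply/pclP/tc_scale/rpC. Qed.
Let clW (P : btens -> Prop) : (forall x, P (cl x)) -> forall x, P x.
Proof. by move=> h x; rewrite -[x](@prepK _ _ tc_refl tc_sym tc_trans). Qed.

Fact baddA : associative badd.
Proof.
by elim/clW=> x; elim/clW=> y; elim/clW=> z; rewrite !baddE; apply/pclP/tc_addA.
Qed.
Fact baddC : commutative badd.
Proof. by elim/clW=> x; elim/clW=> y; rewrite !baddE; apply/pclP/tc_addC. Qed.
Fact badd0 : left_id bzero badd.
Proof. by elim/clW=> x; rewrite baddE; apply/pclP/tc_add0. Qed.
Fact baddN : left_inverse bzero bopp badd.
Proof. by elim/clW=> x; rewrite boppE baddE; apply/pclP/tc_addN. Qed.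
HB.instance Definition _ :=
  GRing.isZmodule.Build btens baddA baddC badd0 baddN.
Fact bscaleA a b v : bscale a (bscale b v) = bscale (a * b) v.
Proof. by elim/clW: v => x; rewrite !bscaleE; apply/pclP/tc_scaleA. Qed.
Fact bscale1 : left_id 1 bscale.
Proof. by elim/clW=> x; rewrite !bscaleE; apply/pclP/tc_scale1. Qed.
Fact bscaleDr : right_distributive bscale +%R.
Proof.
move=> a; elim/clW=> x; elim/clW=> y.
by rewrite -[LHS]/(bscale a (badd _ _)) -[RHS]/(badd _ _)
  !(bscaleE, baddE); apply/pclP/tc_scaleDr.
Qed.
Fact bscaleDl v : {morph bscale^~ v : a b / a + b}.
Proof.
move=> a b; elim/clW: v => x /=.
by rewrite -[RHS]/(badd _ _) !(bscaleE, baddE); apply/pclP/tc_scaleDl.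
Qed.
HB.instance Definition _ :=
  GRing.Zmodule_isLmodule.Build K btens bscaleA bscale1 bscaleDr bscaleDl.

Definition bpure (m : M) (n : N) : btens := cl (TPure m n).

Let addcl x y : cl x + cl y = cl (TAdd x y). Proof. exact: baddE. Qed.
Let scalecl k x : k *: cl x = cl (TScale k x). Proof. exact: bscaleE. Qed.
Let oppcl x : - cl x = cl (TOpp x). Proof. exact: boppE. Qed.

Lemma bpure_linl n : linear (bpure^~ n).
Proof.
by move=> k m m'; rewrite /bpure scalecl addcl; apply/pclP/tc_linl.
Qed.
Lemma bpure_linr m : linear (bpure m).
Proof.
by move=> k n n'; rewrite /bpure scalecl addcl; apply/pclP/tc_linr.
Qed.
Lemma bpure_bal i m n : bpure (ra i m) n = bpure m (la i n).
Proof. exact/pclP/tc_bal. Qed.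

Lemma btens_ind (P : btens -> Prop) : (forall m n, P (bpure m n)) -> P 0 ->
  (forall x y, P x -> P y -> P (x + y)) ->
  forall t, P t.
Proof.
move=> Pp P0 PD; elim/clW.
suff H t : forall k, P (k *: cl t) by move=> t; rewrite -(scale1r (cl t)).
elim: t => [m n|| t IH| t IHt u IHu| a t IH] k.
- by rewrite -(linZ (bpure_linl n)).
- by rewrite -[cl TZero]/(0 : btens) scaler0.
- by rewrite -oppcl scalerN -scaleNr.
- by rewrite -addcl scalerDr; apply: PD.
- by rewrite -scalecl scalerA.
Qed.

Section Lift.
Variable Q : lmodType K.
Implicit Type f : M -> N -> Q.

Fixpoint teval f (t : tterm) : Q :=
  match t with
  | TPure m n => f m n
  | TZero => 0
  | TOpp x => - teval f x
  | TAdd x y => teval f x + teval f y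
  | TScale k x => k *: teval f x
  end.

(* The linear map sending m (x) n to f m n; meaningful when f is bilinear and
   balanced, see [tliftE]. *)
Definition tlift f (t : btens) : Q := teval f (rp t).

Definition balanced f :=
  [/\ forall n, linear (f^~ n), forall m, linear (f m)
    & forall i m n, f (ra i m) n = f m (la i n)].

Lemma teval_cong f x y : balanced f -> tcong x y -> teval f x = teval f y.
Proof.
case=> fl fr fb; elim=> {x y} //=.
- by move=> x y z _ -> _ ->.
- by move=> x y _ ->.
- by move=> x y x' y' _ -> _ ->.
- by move=> k x y _ ->.
- by move=> x y z; rewrite addrA.
- by move=> x y; rewrite addrC.
- by move=> x; rewrite add0r.
- by move=> x; rewrite addNr.
- by move=> a b x; rewrite scalerA.
- by move=> x; rewrite scale1r.
- by move=> a x y; rewrite scalerDr.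
- by move=> x a b; rewrite scalerDl.
- by move=> k m m' n; rewrite fl.
- by move=> k m n n'; rewrite fr.
Qed.

Lemma tlift_cl f x : balanced f -> tlift f (cl x) = teval f x.
Proof. by move=> bf; apply: teval_cong => //; apply: rpC. Qed.

Lemma tliftE f m n : balanced f -> tlift f (bpure m n) = f m n.
Proof. by move=> bf; rewrite tlift_cl. Qed.

Lemma tlift_lin f : balanced f -> linear (tlift f).
Proof.
move=> bf k; elim/clW=> x; elim/clW=> y.
by rewrite scalecl addcl !tlift_cl.
Qed.

Lemma btens_ext (f g : btens -> Q) : linear f -> linear g ->
  (forall m n, f (bpure m n) = g (bpure m n)) -> forall t, f t = g t.
Proof.
move=> lf lg fg; elim/btens_ind => //; first by rewrite (lin0 lf) (lin0 lg).
by move=> x y fx fy; rewrite (linD lf) (linD lg) fx fy.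
Qed.

Lemma tlift_ext f g t : (forall m n, f m n = g m n) -> tlift f t = tlift g t.
Proof.
move=> fg; rewrite /tlift; elim: (rp t) => //= [x ->|x -> y ->|k x ->] //.
Qed.

Lemma tlift_par (P : lmodType K) (f : P -> M -> N -> Q) t :
  (forall m n, linear (fun p => f p m n)) -> linear (fun p => tlift (f p) t).
Proof.
move=> lf; rewrite /tlift; elim: (rp t) => //= [|x IH|x IHx y IHy|k x IH].
- by move=> k x y; rewrite scaler0 addr0.
- exact: lin_opp.
- exact: lin_add.
- exact: lin_scale.
Qed.
End Lift.

End BalancedTensor.

Definition tens (K : fieldType) (M N : lmodType K) : Type :=
  @btens K M N void (fun _ m => m) (fun _ n => n).
HB.instance Definition _ (K : fieldType) (M N : lmodType K) :=
  GRing.Lmodule.on (tens M N).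
Definition tpure (K : fieldType) (M N : lmodType K) (m : M) (n : N) : tens M N :=
  bpure _ _ m n.
Notation "m \ox n" := (tpure m n) : ring_scope.

Section Tensor.
Variable K : fieldType.

Section Maps.
Variables M N : lmodType K.
Lemma tpure_linl (n : N) : linear (fun m : M => m \ox n).
Proof. exact: bpure_linl. Qed.
Lemma tpure_linr (m : M) : linear (fun n : N => m \ox n).
Proof. exact: bpure_linr. Qed.
Lemma tens_ind (P : tens M N -> Prop) : (forall m n, P (m \ox n)) -> P 0 ->
  (forall x y, P x -> P y -> P (x + y)) -> forall t, P t.
Proof. exact: btens_ind. Qed.

Definition bilin (Q : lmodType K) (f : M -> N -> Q) :=
  (forall n, linear (f^~ n)) /\ (forall m, linear (f m)).
Definition tenslift (Q : lmodType K) (f : M -> N -> Q) (t : tens M N) : Q :=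
  tlift f t.
Lemma bilin_bal (Q : lmodType K) (f : M -> N -> Q) :
  bilin f -> balanced (fun (_ : void) m => m) (fun _ n => n) f.
Proof. by case=> fl fr; split. Qed.
Lemma tensliftE (Q : lmodType K) (f : M -> N -> Q) m n :
  bilin f -> tenslift f (m \ox n) = f m n.
Proof. by move/bilin_bal => bf; apply: tliftE. Qed.
Lemma tenslift_lin (Q : lmodType K) (f : M -> N -> Q) :
  bilin f -> linear (tenslift f).
Proof. by move/bilin_bal => bf; apply: tlift_lin. Qed.
Lemma tenslift_par (P Q : lmodType K) (f : P -> M -> N -> Q) t :
  (forall m n, linear (fun p => f p m n)) -> linear (fun p => tenslift (f p) t).
Proof. exact: tlift_par. Qed.
Lemma tens_ext (Q : lmodType K) (f g : tens M N -> Q) : linear f -> linear g ->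
  (forall m n, f (m \ox n) = g (m \ox n)) -> forall t, f t = g t.
Proof. exact: btens_ext. Qed.
End Maps.

Definition tmap (M N M' N' : lmodType K) (f : M -> M') (g : N -> N') :
  tens M N -> tens M' N' := tenslift (fun m n => f m \ox g n).

Section TMap.
Variables (M N M' N' : lmodType K) (f : M -> M') (g : N -> N').
Hypotheses (lf : linear f) (lg : linear g).
Lemma tmap_bilin : bilin (fun m n => f m \ox g n).
Proof.
split=> [n|m]; first exact: (lin_comp lf (tpure_linl (g n))).
exact: (lin_comp lg (tpure_linr (f m))).
Qed.
Lemma tmapE m n : tmap f g (m \ox n) = f m \ox g n.
Proof. exact: tensliftE tmap_bilin. Qed.
Lemma tmap_lin : linear (tmap f g).
Proof. exact: tenslift_lin tmap_bilin. Qed.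
End TMap.

Definition tassoc (L M N : lmodType K) :
    tens L (tens M N) -> tens (tens L M) N :=
  tenslift (fun l t => tenslift (fun m n => (l \ox m) \ox n) t).

Section TAssoc.
Variables L M N : lmodType K.
Let bi1 (l : L) : bilin (fun (m : M) (n : N) => (l \ox m) \ox n).
Proof.
split=> [n|m]; last exact: tpure_linr.
exact: (lin_comp (tpure_linr l) (tpure_linl n)).
Qed.
Let bi2 : bilin (fun (l : L) (t : tens M N) =>
  tenslift (fun m n => (l \ox m) \ox n) t).
Proof.
split=> [t|l]; last exact: tenslift_lin.
by apply: tenslift_par => m n; apply: (lin_comp (tpure_linl m) (tpure_linl n)).
Qed.
Lemma tassocE (l : L) (m : M) (n : N) :
  tassoc (l \ox (m \ox n)) = (l \ox m) \ox n.
Proof. by rewrite /tassoc !tensliftE. Qed.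
Lemma tassoc_lin : linear (@tassoc L M N).
Proof. exact: tenslift_lin. Qed.
End TAssoc.

Section TensorAlgebra.
Variables A B : pzAlgType K.
Local Notation T := (tens A B).

Definition tmul (t u : T) : T :=
  tenslift (fun a b => tenslift (fun a' b' => (a ** a') \ox (b ** b')) u) t.

Let bi1 a b : bilin (fun (a' : A) (b' : B) => (a ** a') \ox (b ** b')).
Proof.
split=> [n|m].
- exact: (lin_comp (amul_linr a) (tpure_linl _)).
- exact: (lin_comp (amul_linr b) (tpure_linr _)).
Qed.
Let bi2 u : bilin (fun (a : A) (b : B) =>
  tenslift (fun a' b' => (a ** a') \ox (b ** b')) u).
Proof.
split=> [n|m]; apply: tenslift_par => a' b'.
- exact: (lin_comp (amul_linl a') (tpure_linl _)).
- exact: (lin_comp (amul_linl b') (tpure_linr _)).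
Qed.
Fact tmul_linl u : linear (tmul^~ u).
Proof. exact: tenslift_lin. Qed.
Fact tmul_linr t : linear (tmul t).
Proof. by apply: tenslift_par => a b; apply: tenslift_lin. Qed.
Fact tmulE0 a b a' b' : tmul (a \ox b) (a' \ox b') = (a ** a') \ox (b ** b').
Proof. by rewrite /tmul !tensliftE. Qed.
Fact tmulA : associative tmul.
Proof.
move=> t u v; move: t; apply: tens_ext => [||a b].
- exact: tmul_linl.
- exact: (lin_comp (tmul_linl u) (tmul_linl v)).
move: u; apply: tens_ext => [||a' b'].
- exact: (lin_comp (tmul_linl v) (tmul_linr _)).
- exact: (lin_comp (tmul_linr _) (tmul_linl v)).
move: v; apply: tens_ext => [||a'' b''].
- exact: (lin_comp (tmul_linr _) (tmul_linr _)).
- exact: tmul_linr.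
by rewrite !tmulE0 !amulA.
Qed.
Fact tmul1 : left_id (aone \ox aone) tmul.
Proof.
apply: tens_ext => [||a b]; [exact: tmul_linr|exact: lin_id|].
by rewrite tmulE0 !amul1a.
Qed.
Fact tmulr1 : right_id (aone \ox aone) tmul.
Proof.
apply: tens_ext => [||a b]; [exact: tmul_linl|exact: lin_id|].
by rewrite tmulE0 !amula1.
Qed.
HB.instance Definition _ := Lmodule_isPzAlgebra.Build K T
  tmulA tmul1 tmulr1 tmul_linl tmul_linr.
Lemma tmulE a b a' b' :
  (a \ox b : T) ** (a' \ox b') = (a ** a') \ox (b ** b').
Proof. exact: tmulE0. Qed.
Lemma toneE : (aone : T) = aone \ox aone. Proof. by []. Qed.
End TensorAlgebra.

Lemma tmap_hom (A B A' B' : pzAlgType K) (f : A -> A') (g : B -> B') :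
  alg_hom f -> alg_hom g -> alg_hom (tmap f g).
Proof.
move=> [lf f1 fM] [lg g1 gM]; have lt := tmap_lin lf lg; split=> //.
  by rewrite toneE tmapE // f1 g1.
move=> t u; move: t; apply: tens_ext => [||a b].
- exact: (lin_comp (amul_linl u) lt).
- exact: (lin_comp lt (amul_linl _)).
move: u; apply: tens_ext => [||a' b'].
- exact: (lin_comp (amul_linr _) lt).
- exact: (lin_comp lt (amul_linr _)).
by rewrite !(tmulE, tmapE) // fM gM.
Qed.

Lemma tassoc_hom (A B C : pzAlgType K) : alg_hom (@tassoc A B C).
Proof.
have lt := @tassoc_lin A B C; split=> //; first by rewrite !toneE tassocE.
move=> t u; move: t; apply: tens_ext => [||a t].
- exact: (lin_comp (amul_linl u) lt).
- exact: (lin_comp lt (amul_linl _)).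
move: t; apply: tens_ext => [||b c].
- exact: (lin_comp (tpure_linr a) (lin_comp (amul_linl u) lt)).
- exact: (lin_comp (tpure_linr a) (lin_comp lt (amul_linl _))).
move: u; apply: tens_ext => [||a' t].
- exact: (lin_comp (amul_linr _) lt).
- exact: (lin_comp lt (amul_linr _)).
move: t; apply: tens_ext => [||b' c'].
- exact: (lin_comp (tpure_linr a') (lin_comp (amul_linr _) lt)).
- exact: (lin_comp (tpure_linr a') (lin_comp lt (amul_linr _))).
by rewrite !(tmulE, tassocE).
Qed.

Lemma hom_comp (A B C : pzAlgType K) (f : A -> B) (g : B -> C) :
  alg_hom f -> alg_hom g -> alg_hom (fun x => g (f x)).
Proof.
move=> [lf f1 fM] [lg g1 gM]; split; first exact: (lin_comp lf lg).
  by rewrite f1.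
by move=> x y; rewrite fM gM.
Qed.

Lemma hom_id (A : pzAlgType K) : alg_hom (fun x : A => x).
Proof. by split. Qed.

End Tensor.

(* [palg rel] is the associative unital algebra generated by the vector space
   V (linearly) subject to the relations s = t for rel s t, i.e. the quotient
   of the tensor algebra T(V), presented by formal terms, by the two-sided
   ideal generated by these s - t. *)
Inductive aterm (K : fieldType) (V : lmodType K) : Type :=
| AGen of V | AZero | AOne | AOpp of aterm V | AAdd of aterm V & aterm V
| AScale of K & aterm V | AMul of aterm V & aterm V.
Arguments AZero {K V}.
Arguments AOne {K V}.

Section PresentedAlgebra.
Variables (K : fieldType) (V : lmodType K) (rel : aterm V -> aterm V -> Prop).

Inductive acong : aterm V -> aterm V -> Prop :=
| ac_refl x : acong x x
| ac_sym x y : acong x y -> acong y x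
| ac_trans x y z : acong x y -> acong y z -> acong x z
| ac_opp x y : acong x y -> acong (AOpp x) (AOpp y)
| ac_add x y x' y' : acong x y -> acong x' y' -> acong (AAdd x x') (AAdd y y')
| ac_scale k x y : acong x y -> acong (AScale k x) (AScale k y)
| ac_mul x y x' y' : acong x y -> acong x' y' -> acong (AMul x x') (AMul y y')
| ac_addA x y z : acong (AAdd x (AAdd y z)) (AAdd (AAdd x y) z)
| ac_addC x y : acong (AAdd x y) (AAdd y x)
| ac_add0 x : acong (AAdd AZero x) x
| ac_addN x : acong (AAdd (AOpp x) x) AZero
| ac_scaleA a b x : acong (AScale a (AScale b x)) (AScale (a * b) x)
| ac_scale1 x : acong (AScale 1 x) x
| ac_scaleDr a x y :
    acong (AScale a (AAdd x y)) (AAdd (AScale a x) (AScale a y))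
| ac_scaleDl x a b : acong (AScale (a + b) x) (AAdd (AScale a x) (AScale b x))
| ac_mulA x y z : acong (AMul x (AMul y z)) (AMul (AMul x y) z)
| ac_mul1a x : acong (AMul AOne x) x
| ac_mula1 x : acong (AMul x AOne) x
| ac_mulDl k x y z :
    acong (AMul (AAdd (AScale k x) y) z) (AAdd (AScale k (AMul x z)) (AMul y z))
| ac_mulDr k x y z :
    acong (AMul x (AAdd (AScale k y) z)) (AAdd (AScale k (AMul x y)) (AMul x z))
| ac_gen k v w :
    acong (AGen (k *: v + w)) (AAdd (AScale k (AGen v)) (AGen w))
| ac_rel x y : rel x y -> acong x y.

Definition palg := pquot ac_refl ac_sym ac_trans.
HB.instance Definition _ := Choice.on palg.
Let cl (x : aterm V) : palg := pcl ac_refl ac_sym ac_trans x.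
Let rp (x : palg) : aterm V := @prep _ _ ac_refl ac_sym ac_trans x.

Let pzero : palg := cl AZero.
Let pone : palg := cl AOne.
Let popp (x : palg) : palg := cl (AOpp (rp x)).
Let padd (x y : palg) : palg := cl (AAdd (rp x) (rp y)).
Let pscale k (x : palg) : palg := cl (AScale k (rp x)).
Let pmul (x y : palg) : palg := cl (AMul (rp x) (rp y)).

Let rpC x : acong (rp (cl x)) x.
Proof. by apply/(pclP ac_refl ac_sym ac_trans); rewrite prepK. Qed.
Let poppE x : popp (cl x) = cl (AOpp x).
Proof. by apply/pclP/ac_opp/rpC. Qed.
Let paddE x y : padd (cl x) (cl y) = cl (AAdd x y).
Proof. by apply/pclP/ac_add; apply/rpC. Qed.
Let pscaleE k x : pscale k (cl x) = cl (AScale k x).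
Proof. by apply/pclP/ac_scale/rpC. Qed.
Let pmulE x y : pmul (cl x) (cl y) = cl (AMul x y).
Proof. by apply/pclP/ac_mul; apply/rpC. Qed.
Let clW (P : palg -> Prop) : (forall x, P (cl x)) -> forall x, P x.
Proof. by move=> h x; rewrite -[x](@prepK _ _ ac_refl ac_sym ac_trans). Qed.

Fact paddA : associative padd.
Proof.
by elim/clW=> x; elim/clW=> y; elim/clW=> z; rewrite !paddE; apply/pclP/ac_addA.
Qed.
Fact paddC : commutative padd.
Proof. by elim/clW=> x; elim/clW=> y; rewrite !paddE; apply/pclP/ac_addC. Qed.
Fact padd0 : left_id pzero padd.
Proof. by elim/clW=> x; rewrite paddE; apply/pclP/ac_add0. Qed.
Fact paddN : left_inverse pzero popp padd.
Proof. by elim/clW=> x; rewrite poppE paddE; apply/pclP/ac_addN. Qed.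
HB.instance Definition _ :=
  GRing.isZmodule.Build palg paddA paddC padd0 paddN.
Let addcl x y : cl x + cl y = cl (AAdd x y). Proof. exact: paddE. Qed.
Fact pscaleA a b v : pscale a (pscale b v) = pscale (a * b) v.
Proof. by elim/clW: v => x; rewrite !pscaleE; apply/pclP/ac_scaleA. Qed.
Fact pscale1 : left_id 1 pscale.
Proof. by elim/clW=> x; rewrite !pscaleE; apply/pclP/ac_scale1. Qed.
Fact pscaleDr : right_distributive pscale +%R.
Proof.
move=> a; elim/clW=> x; elim/clW=> y.
by rewrite !(pscaleE, addcl); apply/pclP/ac_scaleDr.
Qed.
Fact pscaleDl v : {morph pscale^~ v : a b / a + b}.
Proof.
by move=> a b; elim/clW: v => x /=; rewrite !(pscaleE, addcl);
  apply/pclP/ac_scaleDl.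
Qed.
HB.instance Definition _ :=
  GRing.Zmodule_isLmodule.Build K palg pscaleA pscale1 pscaleDr pscaleDl.
Let scalecl k x : k *: cl x = cl (AScale k x). Proof. exact: pscaleE. Qed.
Let oppcl x : - cl x = cl (AOpp x). Proof. exact: poppE. Qed.
Fact pgmulA : associative pmul.
Proof.
by elim/clW=> x; elim/clW=> y; elim/clW=> z; rewrite !pmulE; apply/pclP/ac_mulA.
Qed.
Fact pgmul1a : left_id pone pmul.
Proof. by elim/clW=> x; rewrite !pmulE; apply/pclP/ac_mul1a. Qed.
Fact pgmula1 : right_id pone pmul.
Proof. by elim/clW=> x; rewrite !pmulE; apply/pclP/ac_mula1. Qed.
Fact pgmul_linl y : linear (pmul^~ y).
Proof.
move=> k; elim/clW=> x; elim/clW=> x'; elim/clW: y => y.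
by rewrite scalecl addcl !pmulE scalecl addcl; apply/pclP/ac_mulDl.
Qed.
Fact pgmul_linr x : linear (pmul x).
Proof.
move=> k; elim/clW=> y; elim/clW=> y'; elim/clW: x => x.
by rewrite scalecl addcl !pmulE scalecl addcl; apply/pclP/ac_mulDr.
Qed.
HB.instance Definition _ := Lmodule_isPzAlgebra.Build K palg
  pgmulA pgmul1a pgmula1 pgmul_linl pgmul_linr.
Let mulcl x y : cl x ** cl y = cl (AMul x y). Proof. exact: pmulE. Qed.

Definition pgen (v : V) : palg := cl (AGen v).
Lemma pgen_lin : linear pgen.
Proof. by move=> k v w; rewrite scalecl addcl; apply/pclP/ac_gen. Qed.

Lemma palg_ind (P : palg -> Prop) : (forall v, P (pgen v)) -> P aone -> P 0 ->
  (forall x y, P x -> P y -> P (x + y)) ->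
  (forall k x, P x -> P (k *: x)) ->
  (forall x y, P x -> P y -> P (x ** y)) -> forall x, P x.
Proof.
move=> Pg P1 P0 PD PZ PM; elim/clW; elim=> //.
- by move=> x Px; rewrite -oppcl -scaleN1r; apply: PZ.
- by move=> x Px y Py; rewrite -addcl; apply: PD.
- by move=> k x Px; rewrite -scalecl; apply: PZ.
- by move=> x Px y Py; rewrite -mulcl; apply: PM.
Qed.

Section Lift.
Variable A : pzAlgType K.

Fixpoint aeval (f : V -> A) (t : aterm V) : A :=
  match t with
  | AGen v => f v
  | AZero => 0
  | AOne => aone
  | AOpp x => - aeval f x
  | AAdd x y => aeval f x + aeval f y
  | AScale k x => k *: aeval f x
  | AMul x y => aeval f x ** aeval f y
  end.

(* The algebra homomorphism extending f; meaningful when f is linear and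
   respects the relations, see [plift_hom]. *)
Definition plift (f : V -> A) (x : palg) : A := aeval f (rp x).

Variable f : V -> A.
Hypotheses (lf : linear f)
  (rf : forall s t, rel s t -> aeval f s = aeval f t).

Lemma aeval_cong x y : acong x y -> aeval f x = aeval f y.
Proof.
elim=> {x y} //=.
- by move=> x y z _ -> _ ->.
- by move=> x y _ ->.
- by move=> x y x' y' _ -> _ ->.
- by move=> k x y _ ->.
- by move=> x y x' y' _ -> _ ->.
- by move=> x y z; rewrite addrA.
- by move=> x y; rewrite addrC.
- by move=> x; rewrite add0r.
- by move=> x; rewrite addNr.
- by move=> a b x; rewrite scalerA.
- by move=> x; rewrite scale1r.
- by move=> a x y; rewrite scalerDr.
- by move=> x a b; rewrite scalerDl.
- by move=> x y z; rewrite amulA.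
- by move=> x; rewrite amul1a.
- by move=> x; rewrite amula1.
- by move=> k x y z; rewrite amul_linl.
- by move=> k x y z; rewrite amul_linr.
Qed.
Let plift_cl x : plift f (cl x) = aeval f x.
Proof. by apply: aeval_cong; apply: rpC. Qed.

Lemma plift_gen v : plift f (pgen v) = f v.
Proof. exact: plift_cl. Qed.

Lemma plift_hom : alg_hom (plift f).
Proof.
split; last 1 first.
- by elim/clW=> x; elim/clW=> y; rewrite mulcl !plift_cl.
- by move=> k; elim/clW=> x; elim/clW=> y; rewrite scalecl addcl !plift_cl.
- exact: plift_cl.
Qed.
End Lift.

Lemma palg_ext (A : pzAlgType K) (f g : palg -> A) : alg_hom f -> alg_hom g ->
  (forall v, f (pgen v) = g (pgen v)) -> forall x, f x = g x.
Proof.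
move=> [lf f1 fM] [lg g1 gM] fg; elim/palg_ind => //.
- by rewrite f1 g1.
- by rewrite (lin0 lf) (lin0 lg).
- by move=> x y fx fy; rewrite (linD lf) (linD lg) fx fy.
- by move=> k x fx; rewrite (linZ lf) (linZ lg) fx.
- by move=> x y fx fy; rewrite fM gM fx fy.
Qed.

Lemma palg_rel s t : rel s t -> aeval pgen s = aeval pgen t.
Proof.
have ev u : aeval pgen u = cl u.
  elim: u => //= [x ->|x -> y ->|k x ->|x -> y ->].
  - exact: oppcl.
  - exact: addcl.
  - exact: scalecl.
  - exact: mulcl.
by move=> st; rewrite !ev; apply/pclP/ac_rel.
Qed.

End PresentedAlgebra.

Structure lieAlg (K : fieldType) := LieAlg {
  lie_sort :> vectType K;
  lie_br : lie_sort -> lie_sort -> lie_sort;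
  lie_linl : forall y, linear (lie_br^~ y);
  lie_linr : forall x, linear (lie_br x);
  lie_alt : forall x, lie_br x x = 0;
  lie_jacobi : forall x y z,
    lie_br x (lie_br y z) + lie_br y (lie_br z x) + lie_br z (lie_br x y) = 0
}.

Section LieTheory.
Variable K : fieldType.
Implicit Types g : lieAlg K.

Lemma lie_anti g (x y : g) : lie_br x y = - lie_br y x.
Proof.
apply/eqP; rewrite -addr_eq0; apply/eqP.
have := lie_alt (x + y).
rewrite (linD (lie_linr (x + y))) !(linD (lie_linl _)) !lie_alt add0r addr0.
by rewrite addrC.
Qed.

Definition lie_hom g g' (f : g -> g') :=
  linear f /\ forall x y, f (lie_br x y) = lie_br (f x) (f y).

Section Opposite.
Variable g : lieAlg K.
Let br (x y : g) := lie_br y x.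
Fact lieop_jacobi x y z : br x (br y z) + br y (br z x) + br z (br x y) = 0.
Proof.
rewrite /br !(lie_anti (lie_br _ _)) -!opprD.
by rewrite -[RHS]oppr0 -(lie_jacobi x z y) addrAC.
Qed.
Definition lie_op : lieAlg K :=
  LieAlg (@lie_linr K g) (@lie_linl K g) (@lie_alt K g) lieop_jacobi.
End Opposite.

Section Subalgebra.
Variables (g : lieAlg K) (h : {vspace g}).
Definition lie_closed := forall x y, x \in h -> y \in h -> lie_br x y \in h.
Hypothesis hc : lie_closed.
Definition sub_br (x y : subvs_of h) : subvs_of h :=
  vsproj h (lie_br (vsval x) (vsval y)).
Fact sub_brE x y : vsval (sub_br x y) = lie_br (vsval x) (vsval y).
Proof. by rewrite /sub_br vsprojK //; apply: hc; apply: subvsP. Qed.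
Fact sub_vlin : linear (vsval : subvs_of h -> g).
Proof. exact: linearP. Qed.
Fact sub_linl y : linear (sub_br^~ y).
Proof.
by move=> k u v; apply: subvs_inj; rewrite sub_vlin !sub_brE sub_vlin lie_linl.
Qed.
Fact sub_linr x : linear (sub_br x).
Proof.
by move=> k u v; apply: subvs_inj; rewrite sub_vlin !sub_brE sub_vlin lie_linr.
Qed.
Fact sub_alt x : sub_br x x = 0.
Proof. by apply: subvs_inj; rewrite sub_brE lie_alt (lin0 sub_vlin). Qed.
Fact sub_jacobi x y z :
  sub_br x (sub_br y z) + sub_br y (sub_br z x) + sub_br z (sub_br x y) = 0.
Proof.
by apply: subvs_inj; rewrite !(linD sub_vlin) !sub_brE lie_jacobi (lin0 sub_vlin).
Qed.
Definition lie_sub : lieAlg K := LieAlg sub_linl sub_linr sub_alt sub_jacobi.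
Lemma lie_sub_hom : lie_hom (vsval : lie_sub -> g).
Proof. by split; [exact: sub_vlin | exact: sub_brE]. Qed.
End Subalgebra.

(* 2-cocycles with values in the trivial module K, and the associated central
   extension g + K c with c = (0, 1). *)
Definition cocycle2 g (phi : g -> g -> K^o) :=
  [/\ bilin phi, forall x, phi x x = 0
    & forall x y z, phi x (lie_br y z) + phi y (lie_br z x) +
                    phi z (lie_br x y) = 0].

Lemma cocycle2_op g (phi : g -> g -> K^o) :
  cocycle2 phi -> cocycle2 (phi : lie_op g -> lie_op g -> K^o).
Proof.
move=> [[pl pr] pa pc]; split=> // x y z.
rewrite -[LHS]/(phi x (@lie_br _ g z y) + phi y (@lie_br _ g x z) +
  phi z (@lie_br _ g y x)).
rewrite (@lie_anti g z y) (@lie_anti g x z) (@lie_anti g y x) !(linN (pr _)).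
rewrite -!opprD.
by rewrite pc oppr0.
Qed.

Section CentralExtension.
Variables (g : lieAlg K) (phi : g -> g -> K^o) (phiC : cocycle2 phi).
Local Notation E := (g * K^o)%type.
Definition cext_br (u v : E) : E := (lie_br u.1 v.1, phi u.1 v.1).
Fact cext_linl v : linear (cext_br^~ v).
Proof.
case: phiC => [[pl pr] _ _] k x y.
by congr pair; rewrite /= ?lie_linl // pl.
Qed.
Fact cext_linr u : linear (cext_br u).
Proof.
case: phiC => [[pl pr] _ _] k x y.
by congr pair; rewrite /= ?lie_linr // pr.
Qed.
Fact cext_alt u : cext_br u u = 0.
Proof. by case: phiC => _ pa _; rewrite /cext_br lie_alt pa. Qed.
Fact cext_jacobi x y z :
  cext_br x (cext_br y z) + cext_br y (cext_br z x) + cext_br z (cext_br x y)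
    = 0.
Proof.
by case: phiC => _ _ pc; congr pair; rewrite /= ?lie_jacobi ?pc.
Qed.
Definition cext : lieAlg K := LieAlg cext_linl cext_linr cext_alt cext_jacobi.
End CentralExtension.

Inductive lie_rel g : aterm g -> aterm g -> Prop :=
| LieRel (x y : g) : lie_rel
    (AMul (AGen x) (AGen y)) (AAdd (AMul (AGen y) (AGen x)) (AGen (lie_br x y))).

Definition Ualg g : pzAlgType K := palg (@lie_rel g).
Definition Ugen g (x : g) : Ualg g := pgen _ x.

Definition Ulift g (A : pzAlgType K) (f : g -> A) : Ualg g -> A := plift f.

Lemma Ulift_hom g (A : pzAlgType K) (f : g -> A) : linear f ->
  (forall x y, f x ** f y = f y ** f x + f (lie_br x y)) -> alg_hom (Ulift f).
Proof. by move=> lf fb; apply: plift_hom => // s t [x y] /=. Qed.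

Lemma Ulift_gen g (A : pzAlgType K) (f : g -> A) x : linear f ->
  (forall x y, f x ** f y = f y ** f x + f (lie_br x y)) ->
  Ulift f (Ugen x) = f x.
Proof. by move=> lf fb; apply: plift_gen => // s t [u v] /=. Qed.

Lemma UgenM g (x y : g) :
  Ugen x ** Ugen y = Ugen y ** Ugen x + Ugen (lie_br x y).
Proof. exact: (palg_rel (LieRel x y)). Qed.

(* U_phi = U(extension of g^op by phi) / (1 - c). *)
Section TwistedEnveloping.
Variables (g : lieAlg K) (phi : g -> g -> K^o) (phiC : cocycle2 phi).
Definition hat_op : lieAlg K := cext (cocycle2_op phiC).
Definition Uphi_rel (s t : aterm hat_op) : Prop :=
  lie_rel s t \/ (s = AGen ((0, 1) : hat_op) /\ t = AOne).
Definition Uphi : pzAlgType K := palg Uphi_rel.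
Definition Uphi_gen (x : g) : Uphi := pgen _ ((x, 0) : hat_op).
End TwistedEnveloping.

End LieTheory.

Structure hopf (K : fieldType) := Hopf {
  hopf_sort :> pzAlgType K;
  hD : hopf_sort -> tens hopf_sort hopf_sort;
  heps : hopf_sort -> K^o;
  hS : hopf_sort -> hopf_sort;
  hD_hom : alg_hom hD;
  heps_hom : alg_hom heps;
  hS_lin : linear hS;
  hD_assoc : forall h, tmap hD id (hD h) = tassoc (tmap id hD (hD h));
  heps_l : forall h, tenslift (fun a b => (heps a : K) *: b) (hD h) = h;
  heps_r : forall h, tenslift (fun a b => (heps b : K) *: a) (hD h) = h;
  hS_l : forall h,
    tenslift (fun a b => hS a ** b) (hD h) = (heps h : K) *: aone;
  hS_r : forall h,
    tenslift (fun a b => a ** hS b) (hD h) = (heps h : K) *: aone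
}.

Structure hopf_hom (K : fieldType) (H' H : hopf K) := HopfHom {
  hopf_fun :> H' -> H;
  hopf_fun_hom : alg_hom hopf_fun;
  hopf_funD : forall h, hD (hopf_fun h) = tmap hopf_fun hopf_fun (hD h);
  hopf_fun_eps : forall h, heps (hopf_fun h) = heps h;
  hopf_funS : forall h, hS (hopf_fun h) = hopf_fun (hS h)
}.

Section EnvelopingHopf.
Variables (K : fieldType) (g : lieAlg K).
Local Notation U := (Ualg g).

Lemma Ugen_lin : linear (@Ugen K g).
Proof. exact: pgen_lin. Qed.

Lemma U_ext (A : pzAlgType K) (f f' : U -> A) : alg_hom f -> alg_hom f' ->
  (forall x : g, f (Ugen x) = f' (Ugen x)) -> forall u, f u = f' u.
Proof. exact: palg_ext. Qed.

Let dgen (x : g) : tens U U := Ugen x \ox aone + aone \ox Ugen x.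
Let dgen_lin : linear dgen.
Proof.
apply: lin_add; first exact: (lin_comp Ugen_lin (tpure_linl _)).
exact: (lin_comp Ugen_lin (tpure_linr _)).
Qed.
Let dgenM x y : dgen x ** dgen y = dgen y ** dgen x + dgen (lie_br x y).
Proof.
have mDl (a b c : tens U U) : (a + b) ** c = a ** c + b ** c by exact: amulDl.
have mDr (a b c : tens U U) : c ** (a + b) = c ** a + c ** b by exact: amulDr.
rewrite /dgen !mDl !mDr !tmulE !amul1a !amula1 (UgenM x y).
rewrite (linD (tpure_linl _)) (linD (tpure_linr _)).
by rewrite [LHS](AC (3*(1*2)) ((1*4)*(3*5)*(2*6))).
Qed.
Definition U_D : U -> tens U U := Ulift dgen.
Lemma U_D_hom : alg_hom U_D.
Proof. exact: (Ulift_hom dgen_lin dgenM). Qed.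
Lemma U_D_gen x : U_D (Ugen x) = Ugen x \ox aone + aone \ox Ugen x.
Proof. exact: (Ulift_gen _ dgen_lin dgenM). Qed.

Let egen (x : g) : K^o := 0.
Let egen_lin : linear egen.
Proof. by move=> k x y; rewrite /egen scaler0 addr0. Qed.
Let egenM x y : egen x ** egen y = egen y ** egen x + egen (lie_br x y).
Proof. by rewrite addr0. Qed.
Definition U_eps : U -> K^o := Ulift egen.
Lemma U_eps_hom : alg_hom U_eps.
Proof. exact: (Ulift_hom egen_lin egenM). Qed.
Lemma U_eps_gen x : U_eps (Ugen x) = 0.
Proof. exact: (Ulift_gen _ egen_lin egenM). Qed.

Let sgen (x : g) : opalg U := toop (- Ugen x).
Let sgen_lin : linear sgen.
Proof. exact: (lin_opp Ugen_lin). Qed.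
Let sgenM x y : sgen x ** sgen y = sgen y ** sgen x + sgen (lie_br x y).
Proof.
rewrite -[LHS]/((- Ugen y) ** (- Ugen x)).
rewrite -[RHS]/((- Ugen x) ** (- Ugen y) + - Ugen (lie_br x y)).
by rewrite !(amulNl, amulNr) !opprK (UgenM x y) addrK.
Qed.
Definition U_S (u : U) : U := unop (Ulift sgen u).
Let sgen_hom : alg_hom (Ulift sgen).
Proof. exact: (Ulift_hom sgen_lin sgenM). Qed.
Lemma U_S_lin : linear U_S. Proof. by case: sgen_hom. Qed.
Lemma U_S1 : U_S aone = aone. Proof. by case: sgen_hom. Qed.
Lemma U_SM x y : U_S (x ** y) = U_S y ** U_S x.
Proof. by case: sgen_hom => _ _ sM; rewrite /U_S sM. Qed.
Lemma U_S_gen x : U_S (Ugen x) = - Ugen x.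
Proof. by rewrite /U_S (Ulift_gen _ sgen_lin sgenM). Qed.

Lemma U_SK u : U_S (U_S u) = u.
Proof.
elim/palg_ind: u => [v||||k x Sx|x y Sx Sy].
- by rewrite !U_S_gen (linN U_S_lin) U_S_gen opprK.
- by rewrite !U_S1.
- by rewrite !(lin0 U_S_lin).
- by move=> x y Sx Sy; rewrite !(linD U_S_lin) Sx Sy.
- by rewrite !(linZ U_S_lin) Sx.
- by rewrite !U_SM Sx Sy.
Qed.

Fact U_assoc h : tmap U_D id (U_D h) = tassoc (tmap id U_D (U_D h)).
Proof.
have [Dl D1 _] := U_D_hom; have il := @lin_id K U.
move: h; apply: U_ext => [||x].
- exact: hom_comp U_D_hom (tmap_hom U_D_hom (hom_id _)).
- have h2 := hom_comp (tmap_hom (hom_id U) U_D_hom) (@tassoc_hom K U U U).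
  exact: hom_comp U_D_hom h2.
rewrite U_D_gen !(linD (tmap_lin _ _)) // !tmapE // D1 toneE U_D_gen.
rewrite (linD (@tassoc_lin K U U U)) (linD (tpure_linl _)).
by rewrite (linD (tpure_linr _)) (linD (@tassoc_lin K U U U)) !tassocE addrA.
Qed.

Let eps_lin : linear U_eps. Proof. by case: U_eps_hom. Qed.
Let eps1 : U_eps aone = 1. Proof. by case: U_eps_hom. Qed.
Let epsM x y : U_eps (x ** y) = (U_eps x : K) * U_eps y.
Proof. by case: U_eps_hom. Qed.

Let el_bi : bilin (fun a b : U => (U_eps a : K) *: b).
Proof.
split=> [b|a]; first exact: lin_scalel.
exact: (lin_scale _ (@lin_id _ _)).
Qed.
Let er_bi : bilin (fun a b : U => (U_eps b : K) *: a).
Proof. by case: el_bi. Qed.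
Let el_hom : alg_hom (tenslift (fun a b : U => (U_eps a : K) *: b)).
Proof.
have lt := tenslift_lin el_bi; split=> //.
  by rewrite tensliftE // eps1 scale1r.
move=> t u; move: t; apply: tens_ext => [||a b].
- exact: (lin_comp (amul_linl u) lt).
- exact: (lin_comp lt (amul_linl _)).
move: u; apply: tens_ext => [||a' b'].
- exact: (lin_comp (amul_linr _) lt).
- exact: (lin_comp lt (amul_linr _)).
by rewrite tmulE !tensliftE // epsM amulZl amulZr scalerA.
Qed.
Let er_hom : alg_hom (tenslift (fun a b : U => (U_eps b : K) *: a)).
Proof.
have lt := tenslift_lin er_bi; split=> //.
  by rewrite tensliftE // eps1 scale1r.
move=> t u; move: t; apply: tens_ext => [||a b].
- exact: (lin_comp (amul_linl u) lt).
- exact: (lin_comp lt (amul_linl _)).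
move: u; apply: tens_ext => [||a' b'].
- exact: (lin_comp (amul_linr _) lt).
- exact: (lin_comp lt (amul_linr _)).
by rewrite tmulE !tensliftE // epsM amulZl amulZr scalerA.
Qed.
Fact U_eps_l h : tenslift (fun a b => (U_eps a : K) *: b) (U_D h) = h.
Proof.
move: h; apply: U_ext => [||x]; first exact: hom_comp U_D_hom el_hom.
  exact: hom_id.
rewrite U_D_gen (linD (tenslift_lin el_bi)) !tensliftE // eps1 U_eps_gen.
by rewrite scale0r scale1r add0r.
Qed.
Fact U_eps_r h : tenslift (fun a b => (U_eps b : K) *: a) (U_D h) = h.
Proof.
move: h; apply: U_ext => [||x]; first exact: hom_comp U_D_hom er_hom.
  exact: hom_id.
rewrite U_D_gen (linD (tenslift_lin er_bi)) !tensliftE // eps1 U_eps_gen.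
by rewrite scale0r scale1r addr0.
Qed.

Let sl := tenslift (fun a b : U => U_S a ** b).
Let sr := tenslift (fun a b : U => a ** U_S b).
Let sl_bi : bilin (fun a b : U => U_S a ** b).
Proof.
split=> [b|a]; last exact: amul_linr.
exact: (lin_comp U_S_lin (amul_linl b)).
Qed.
Let sr_bi : bilin (fun a b : U => a ** U_S b).
Proof.
split=> [b|a]; first exact: amul_linl.
exact: (lin_comp U_S_lin (amul_linr a)).
Qed.
Let lsl : linear sl. Proof. exact: tenslift_lin sl_bi. Qed.
Let lsr : linear sr. Proof. exact: tenslift_lin sr_bi. Qed.
Let slM k t u : sl t = k *: aone -> sl (t ** u) = k *: sl u.
Proof.
pose F z := tenslift (fun a b : U => (U_S a ** z) ** b).
have Fbi z : bilin (fun a b : U => (U_S a ** z) ** b).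
  split=> [b|a]; last exact: amul_linr.
  exact: (lin_comp U_S_lin (lin_comp (amul_linl z) (amul_linl b))).
have lF w : linear (fun z => F z w).
  apply: tenslift_par => a b.
  exact: (lin_comp (amul_linr _) (amul_linl b)).
have -> : sl (t ** u) = F (sl t) u.
  move: t; apply: tens_ext => [||a b].
  - exact: (lin_comp (amul_linl u) lsl).
  - exact: (lin_comp lsl (lF u)).
  move: u; apply: tens_ext => [||a' b'].
  - exact: (lin_comp (amul_linr _) lsl).
  - exact: tenslift_lin.
  by rewrite /F /sl tmulE !tensliftE // U_SM !amulA.
move=> ->; rewrite /F /sl; move: u; apply: tens_ext => [||a b].
- exact: tenslift_lin.
- exact: (lin_scale _ (tenslift_lin sl_bi)).
by rewrite !tensliftE // amulZr amula1 amulZl.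
Qed.
Let srM k t u : sr u = k *: aone -> sr (t ** u) = k *: sr t.
Proof.
pose F z := tenslift (fun a b : U => (a ** z) ** U_S b).
have Fbi z : bilin (fun a b : U => (a ** z) ** U_S b).
  split=> [b|a]; last exact: (lin_comp U_S_lin (amul_linr _)).
  exact: (lin_comp (amul_linl z) (amul_linl _)).
have lF w : linear (fun z => F z w).
  apply: tenslift_par => a b.
  exact: (lin_comp (amul_linr _) (amul_linl _)).
have -> : sr (t ** u) = F (sr u) t.
  move: t; apply: tens_ext => [||a b].
  - exact: (lin_comp (amul_linl u) lsr).
  - exact: tenslift_lin.
  move: u; apply: tens_ext => [||a' b'].
  - exact: (lin_comp (amul_linr _) lsr).
  - exact: (lin_comp lsr (lF _)).
  by rewrite /F /sr tmulE !tensliftE // U_SM !amulA.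
move=> ->; rewrite /F /sr; move: t; apply: tens_ext => [||a b].
- exact: tenslift_lin.
- exact: (lin_scale _ (tenslift_lin sr_bi)).
by rewrite !tensliftE // amulZr amula1 amulZl.
Qed.
Fact U_S_l h : tenslift (fun a b => U_S a ** b) (U_D h) = (U_eps h : K) *: aone.
Proof.
have [Dl D1 DM] := U_D_hom; rewrite -/(sl _).
elim/palg_ind: h => [x|||x y IHx IHy|k x IH|x y IHx IHy].
- rewrite U_eps_gen U_D_gen (linD lsl) /sl !tensliftE // U_S_gen U_S1.
  by rewrite amul1a amula1 addNr scale0r.
- by rewrite D1 eps1 scale1r /sl tensliftE // U_S1 amul1a.
- by rewrite (lin0 Dl) (lin0 lsl) (lin0 eps_lin) scale0r.
- by rewrite (linD Dl) (linD lsl) IHx IHy (linD eps_lin) scalerDl.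
- by rewrite (linZ Dl) (linZ lsl) IH (linZ eps_lin) scalerA.
- by rewrite DM (slM _ IHx) IHy epsM scalerA.
Qed.
Fact U_S_r h : tenslift (fun a b => a ** U_S b) (U_D h) = (U_eps h : K) *: aone.
Proof.
have [Dl D1 DM] := U_D_hom; rewrite -/(sr _).
elim/palg_ind: h => [x|||x y IHx IHy|k x IH|x y IHx IHy].
- rewrite U_eps_gen U_D_gen (linD lsr) /sr !tensliftE // U_S_gen U_S1.
  by rewrite amul1a amula1 addrN scale0r.
- by rewrite D1 eps1 scale1r /sr tensliftE // U_S1 amul1a.
- by rewrite (lin0 Dl) (lin0 lsr) (lin0 eps_lin) scale0r.
- by rewrite (linD Dl) (linD lsr) IHx IHy (linD eps_lin) scalerDl.
- by rewrite (linZ Dl) (linZ lsr) IH (linZ eps_lin) scalerA.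
- by rewrite DM (srM _ IHy) IHx epsM scalerA mulrC.
Qed.

Definition UH : hopf K := Hopf U_D_hom U_eps_hom U_S_lin U_assoc
  U_eps_l U_eps_r U_S_l U_S_r.

End EnvelopingHopf.

Section EnvelopingFunctor.
Variables (K : fieldType) (g' g : lieAlg K) (f : g' -> g) (hf : lie_hom f).
Let fgen (x : g') : UH g := Ugen (f x).
Let fgen_lin : linear fgen.
Proof. by case: hf => lf _; apply: (lin_comp lf (@Ugen_lin K g)). Qed.
Let fgenM x y : fgen x ** fgen y = fgen y ** fgen x + fgen (lie_br x y).
Proof. by case: hf => _ fb; rewrite /fgen fb; apply: UgenM. Qed.
Definition Umap_fun : UH g' -> UH g := Ulift fgen.
Fact Umap_hom : alg_hom Umap_fun.
Proof. exact: (Ulift_hom fgen_lin fgenM). Qed.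
Lemma Umap_gen x : Umap_fun (Ugen x) = Ugen (f x).
Proof. exact: (Ulift_gen _ fgen_lin fgenM). Qed.
Fact UmapD h : hD (Umap_fun h) = tmap Umap_fun Umap_fun (hD h).
Proof.
have [lm m1 _] := Umap_hom.
move: h; apply: U_ext => [||x].
- exact: hom_comp Umap_hom (hD_hom _).
- exact: hom_comp (hD_hom _) (tmap_hom Umap_hom Umap_hom).
rewrite Umap_gen; rewrite /= !U_D_gen (linD (tmap_lin lm lm)) !tmapE //.
by rewrite m1 Umap_gen.
Qed.
Fact Umap_eps h : heps (Umap_fun h) = heps h.
Proof.
move: h; apply: U_ext => [||x]; first exact: hom_comp Umap_hom (heps_hom (UH g)).
  exact: (heps_hom (UH g')).
by rewrite Umap_gen /= !U_eps_gen.
Qed.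
Fact UmapS h : hS (Umap_fun h) = Umap_fun (hS h).
Proof.
have [lm m1 mM] := Umap_hom.
elim/palg_ind: h => [x|||x y IHx IHy|k x IH|x y IHx IHy].
- rewrite -[pgen _ x]/(Ugen x) Umap_gen /= !U_S_gen.
  by rewrite (linN lm) Umap_gen.
- by rewrite m1 /= !U_S1 m1.
- by rewrite (lin0 lm) !(lin0 (@hS_lin _ _)) (lin0 lm).
- by rewrite (linD lm) !(linD (@hS_lin _ _)) (linD lm) IHx IHy.
- by rewrite (linZ lm) !(linZ (@hS_lin _ _)) (linZ lm) IH.
- rewrite mM /= !U_SM mM; move: IHx IHy => /= -> ->; by [].
Qed.
Definition Umap : hopf_hom (UH g') (UH g) :=
  HopfHom Umap_hom UmapD Umap_eps UmapS.
End EnvelopingFunctor.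

(* rho : U_phi -> U_phi (x) U(g)^op. A generator (x, a) of the extension has
   image x + a in U_phi, so the first summand below is x (x) 1 + a 1 (x) 1. *)
Section Rho.
Variables (K : fieldType) (g : lieAlg K) (phi : g -> g -> K^o).
Variable phiC : cocycle2 phi.
Local Notation A := (Uphi phiC).
Local Notation T := (tens (Uphi phiC) (opalg (UH g))).
Let ggen (u : hat_op phiC) : A := pgen _ u.
Let ggenM u v : ggen u ** ggen v = ggen v ** ggen u + ggen (lie_br u v).
Proof.
have /palg_rel // : Uphi_rel
  (AMul (AGen u) (AGen v)) (AAdd (AMul (AGen v) (AGen u)) (AGen (lie_br u v))).
by left.
Qed.
Let ggenc : ggen (0, 1) = aone.
Proof.
have /palg_rel // : Uphi_rel (AGen ((0, 1) : hat_op phiC)) AOne by right.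
Qed.
Let ogen (x : g) : opalg (UH g) := toop (Ugen x : UH g).
Let ogen_lin : linear ogen. Proof. exact: Ugen_lin. Qed.
Let ogenM x y : ogen x ** ogen y = ogen y ** ogen x + ogen (lie_br y x).
Proof. exact: (UgenM y x). Qed.
Let rgen (u : hat_op phiC) : T := ggen u \ox aone + aone \ox ogen u.1.
Let rgen_lin : linear rgen.
Proof.
apply: lin_add; first exact: (lin_comp (@pgen_lin _ _ _) (tpure_linl _)).
have l1 : linear (fun u : hat_op phiC => u.1 : g) by [].
exact: (lin_comp (lin_comp l1 ogen_lin) (tpure_linr _)).
Qed.
Let rgenM u v : rgen u ** rgen v = rgen v ** rgen u + rgen (lie_br u v).
Proof.
have mDl (a b c : T) : (a + b) ** c = a ** c + b ** c by exact: amulDl.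
have mDr (a b c : T) : c ** (a + b) = c ** a + c ** b by exact: amulDr.
rewrite /rgen !mDl !mDr !tmulE !amul1a !amula1 (ggenM u v) (ogenM u.1 v.1).
rewrite (linD (tpure_linl _)) (linD (tpure_linr _)).
by rewrite [LHS](AC (3*(1*2)) ((1*4)*(3*5)*(2*6))).
Qed.
Let rrel s t : Uphi_rel s t -> aeval rgen s = aeval rgen t.
Proof.
case=> [[u v]|[-> ->]]; first exact: rgenM.
by rewrite /= /rgen ggenc /= (lin0 ogen_lin) (lin0 (tpure_linr _)) addr0.
Qed.
Definition rho : A -> T := plift rgen.
Lemma rho_hom : alg_hom rho.
Proof. exact: (plift_hom rgen_lin rrel). Qed.
Lemma rho_gen x :
  rho (Uphi_gen phiC x) = Uphi_gen phiC x \ox aone + aone \ox toop (Ugen x : UH g).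
Proof. exact: (plift_gen rgen_lin rrel). Qed.
End Rho.

Structure hmodule (K : fieldType) (H : pzAlgType K) := HModule {
  hm_sort :> lmodType K;
  hact : H -> hm_sort -> hm_sort;
  hact_linl : forall m, linear (hact^~ m);
  hact_linr : forall h, linear (hact h);
  hact1 : forall m, hact aone m = m;
  hactM : forall f h m, hact (f ** h) m = hact f (hact h m)
}.

Section HHTensor.
Variables (K : fieldType) (H : hopf K).
Implicit Types M N : hmodule H.

(* (H (x) H) (x)_H M and H^{(x)3} (x)_H M, H acting from the right on H (x) H
   by Delta and on (H (x) H) (x) H by the iterated coproduct. *)
Definition HHt M : lmodType K :=
  @btens K (tens H H) M H (fun h t => t ** hD h) (@hact _ _ M).
Definition hpure M (t : tens H H) (m : M) : HHt M := bpure _ _ t m.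
Local Notation "t \oxH m" := (hpure t m) : ring_scope.

Definition hD3 (h : H) : tens (tens H H) H := tmap (@hD K H) id (hD h).
Definition HHHt M : lmodType K :=
  @btens K (tens (tens H H) H) M H (fun h t => t ** hD3 h) (@hact _ _ M).
Definition hpure3 M (t : tens (tens H H) H) (m : M) : HHHt M := bpure _ _ t m.

Section Lift.
Variables (M : hmodule H) (Q : lmodType K).
Definition HHbal (f : tens H H -> M -> Q) :=
  [/\ forall m, linear (f^~ m), forall t, linear (f t)
    & forall h t m, f (t ** hD h) m = f t (hact h m)].
Definition HHlift (f : tens H H -> M -> Q) (u : HHt M) : Q := tlift f u.
Lemma HHliftE f t m : HHbal f -> HHlift f (t \oxH m) = f t m.
Proof. exact: tliftE. Qed.
Lemma HHlift_lin f : HHbal f -> linear (HHlift f).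
Proof. exact: tlift_lin. Qed.
Lemma HHlift_par (P : lmodType K) (f : P -> tens H H -> M -> Q) u :
  (forall t m, linear (fun p => f p t m)) -> linear (fun p => HHlift (f p) u).
Proof. exact: tlift_par. Qed.
Lemma HHt_ext (f f' : HHt M -> Q) : linear f -> linear f' ->
  (forall t m, f (t \oxH m) = f' (t \oxH m)) -> forall u, f u = f' u.
Proof. exact: btens_ext. Qed.
End Lift.

Lemma hpure_linl M (m : M) : linear (fun t => t \oxH m).
Proof. exact: bpure_linl. Qed.
Lemma hpure_linr M t : linear (fun m : M => t \oxH m).
Proof. exact: bpure_linr. Qed.
Lemma hpure_bal M h t (m : M) : (t ** hD h) \oxH m = t \oxH (hact h m).
Proof. exact: bpure_bal. Qed.
Lemma hpure3_linl M (m : M) : linear (fun t => hpure3 t m).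
Proof. exact: bpure_linl. Qed.
Lemma hpure3_linr M t : linear (fun m : M => hpure3 t m).
Proof. exact: bpure_linr. Qed.
Lemma hpure3_bal M h t (m : M) : hpure3 (t ** hD3 h) m = hpure3 t (hact h m).
Proof. exact: bpure_bal. Qed.

Definition hhact M (c : tens H H) : HHt M -> HHt M :=
  HHlift (fun t m => (c ** t) \oxH m).
Lemma hhact_bal M c : HHbal (fun t (m : M) => (c ** t) \oxH m).
Proof.
split=> [m|t|h t m]; first exact: (lin_comp (amul_linr c) (hpure_linl m)).
  exact: hpure_linr.
by rewrite amulA hpure_bal.
Qed.
Lemma hhactE M c t (m : M) : hhact c (t \oxH m) = (c ** t) \oxH m.
Proof. exact: HHliftE (hhact_bal _ _). Qed.
Lemma hhact_linr M c : linear (@hhact M c).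
Proof. exact: HHlift_lin (hhact_bal _ _). Qed.
Lemma hhact_linl M u : linear (fun c => @hhact M c u).
Proof.
apply: HHlift_par => t m; exact: (lin_comp (amul_linl t) (hpure_linl m)).
Qed.
Lemma hhactM M c c' u : @hhact M (c ** c') u = hhact c (hhact c' u).
Proof.
move: u; apply: HHt_ext => [||t m]; first exact: hhact_linr.
  exact: (lin_comp (@hhact_linr M c') (@hhact_linr M c)).
by rewrite !hhactE amulA.
Qed.
Lemma hhact1 M u : @hhact M aone u = u.
Proof.
move: u; apply: HHt_ext => [||t m]; first exact: hhact_linr.
  exact: lin_id.
by rewrite hhactE amul1a.
Qed.

(* For f H-linear, the map id (x)_H f. *)
Definition HHmap M N (f : M -> N) : HHt M -> HHt N :=
  HHlift (fun t m => t \oxH (f m)).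
Definition hm_hom M N (f : M -> N) :=
  linear f /\ forall h m, f (hact h m) = hact h (f m).
Lemma HHmap_bal M N (f : M -> N) : hm_hom f -> HHbal (fun t m => t \oxH (f m)).
Proof.
move=> [lf fH]; split=> [m|t|h t m]; first exact: hpure_linl.
  exact: (lin_comp lf (hpure_linr t)).
by rewrite hpure_bal fH.
Qed.
Lemma HHmapE M N (f : M -> N) t m :
  hm_hom f -> HHmap f (t \oxH m) = t \oxH (f m).
Proof. by move=> /HHmap_bal fb; apply: HHliftE. Qed.

End HHTensor.
Notation "t \oxH m" := (hpure t m) : ring_scope.

(* A left H-module with an H-bilinear pseudoproduct, associativity not
   included; (f a) * (g b) = ((f (x) g) (x)_H 1)(a * b). *)
Structure pseudo (K : fieldType) (H : hopf K) := Pseudo {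
  ps_mod :> hmodule H;
  pmul : ps_mod -> ps_mod -> HHt ps_mod;
  pmul_linl : forall b, linear (pmul^~ b);
  pmul_linr : forall a, linear (pmul a);
  pmulH : forall f h a b,
    pmul (hact f a) (hact h b) = hhact (f \ox h) (pmul a b)
}.

Section Pseudo.
Variables (K : fieldType) (H : hopf K).
Implicit Types R : pseudo H.

Lemma pmulHl R h (a b : R) : pmul (hact h a) b = hhact (h \ox aone) (pmul a b).
Proof. by rewrite -pmulH hact1. Qed.
Lemma pmulHr R h (a b : R) : pmul a (hact h b) = hhact (aone \ox h) (pmul a b).
Proof. by rewrite -pmulH hact1. Qed.

(* (c (x)_H d) * e and a * (c (x)_H d), for c : H (x) H. *)
Definition pmul_ext_l R (u : HHt R) (e : R) : HHHt R :=
  HHlift (fun c d =>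
    HHlift (fun t m => hpure3 ((c \ox aone) ** tmap (@hD K H) id t) m)
      (pmul d e)) u.
Definition pmul_ext_r R (a : R) (u : HHt R) : HHHt R :=
  HHlift (fun c d =>
    HHlift (fun t m =>
        hpure3 (tassoc (aone \ox c) ** tassoc (tmap id (@hD K H) t)) m)
      (pmul a d)) u.

Definition passoc R := forall a b c : R,
  pmul_ext_l (pmul a b) c = pmul_ext_r a (pmul b c).

Let DL := tmap_hom (@hD_hom K H) (hom_id H).
Let DR0 := tmap_hom (hom_id H) (@hD_hom K H).
Let DR := hom_comp DR0 (@tassoc_hom K H H H).

Let bal_l R c : HHbal (fun t (m : R) =>
  hpure3 ((c \ox aone) ** tmap (@hD K H) id t) m).
Proof.
have [Dl _ DM] := DL; split=> [m|t|h t m].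
- exact: (lin_comp Dl (lin_comp (amul_linr (c \ox aone)) (hpure3_linl m))).
- exact: hpure3_linr.
- by rewrite DM amulA hpure3_bal.
Qed.
Let bal_r R c : HHbal (fun t (m : R) =>
  hpure3 (tassoc (aone \ox c) ** tassoc (tmap id (@hD K H) t)) m).
Proof.
have [Dl _ DM] := DR; split=> [m|t|h t m].
- exact: (lin_comp Dl (lin_comp (amul_linr _) (hpure3_linl m))).
- exact: hpure3_linr.
- by rewrite DM amulA -hD_assoc hpure3_bal.
Qed.

Lemma pmul_ext_lE R c (d e : R) : pmul_ext_l (c \oxH d) e =
  HHlift (fun t m => hpure3 ((c \ox aone) ** tmap (@hD K H) id t) m) (pmul d e).
Proof.
have [Dl D1 DM] := DL; have [hDl hD1 _] := @hD_hom K H.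
rewrite /pmul_ext_l HHliftE //; split=> [m|t|h t m].
- apply: HHlift_par => t n.
  exact: (lin_comp (tpure_linl aone)
    (lin_comp (amul_linl (tmap (@hD K H) id t)) (hpure3_linl n))).
- exact: (lin_comp (pmul_linl e) (HHlift_lin (bal_l _ t))).
rewrite pmulHl; set w := pmul m e; move: w; apply: HHt_ext => [||s n].
- exact: HHlift_lin (bal_l _ _).
- exact: (lin_comp (hhact_linr _) (HHlift_lin (bal_l _ _))).
rewrite hhactE !HHliftE //; congr hpure3.
by rewrite DM tmapE // amulA tmulE amul1a.
Qed.

Lemma pmul_ext_rE R c (a d : R) : pmul_ext_r a (c \oxH d) =
  HHlift (fun t m =>
    hpure3 (tassoc (aone \ox c) ** tassoc (tmap id (@hD K H) t)) m) (pmul a d).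
Proof.
have [Dl D1 DM] := DR; have [hDl hD1 _] := @hD_hom K H.
have [al a1 aM] := @tassoc_hom K H H H.
rewrite /pmul_ext_r HHliftE //; split=> [m|t|h t m].
- apply: HHlift_par => t n.
  exact: (lin_comp (lin_comp (tpure_linr aone) al)
    (lin_comp (amul_linl (tassoc (tmap id (@hD K H) t))) (hpure3_linl n))).
- exact: (lin_comp (pmul_linr a) (HHlift_lin (bal_r _ t))).
rewrite pmulHr; set w := pmul a m; move: w; apply: HHt_ext => [||s n].
- exact: HHlift_lin (bal_r _ _).
- exact: (lin_comp (hhact_linr _) (HHlift_lin (bal_r _ _))).
rewrite hhactE !HHliftE //; congr hpure3.
by rewrite DM tmapE // amulA -(aM (aone \ox t)) tmulE amul1a.
Qed.

Definition pseudo_hom R R' (f : R -> R') :=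
  hm_hom f /\ forall a b, pmul (f a) (f b) = HHmap f (pmul a b).

Definition pseudo_iso R R' := exists f : R -> R', pseudo_hom f /\ bijective f.

(* y = a_x b for x in X = H^*: if a * b = sum_i (f_i (x) 1) (x)_H e_i then
   a_x b = sum_i <S(x), f_i> e_i. *)
Definition xprod R (x : H -> K^o) (a b y : R) : Prop :=
  exists2 t : tens H R,
    pmul a b = tenslift (fun f e => (f \ox aone) \oxH e) t
  & y = tenslift (fun f e => (x (hS f) : K) *: e) t.

Local Open Scope classical_set_scope.

Definition hsubmodule R (I : set R) :=
  [/\ I 0, forall a b, I a -> I b -> I (a + b) & forall h a, I a -> I (hact h a)].

Definition ideal_in R (S I : set R) :=
  [/\ hsubmodule I, I `<=` S
    & forall x : H -> K^o, linear x -> forall a b y, I a -> S b ->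
        (xprod x a b y -> I y) /\ (xprod x b a y -> I y)].

Definition simple_in R (S : set R) :=
  forall I, ideal_in S I -> I = [set 0] \/ I = S.

Definition simple_pseudo R := simple_in (R := R) setT.

Definition finite_in R (S : set R) := exists s : seq R,
  (forall a, a \in s -> S a) /\
  forall a, S a -> exists c : 'I_(size s) -> H,
    a = \sum_(i < size s) hact (c i) s`_i.

End Pseudo.

Section FreePseudo.
Variables (K : fieldType) (H : hopf K) (A : lmodType K).

Definition free_act (h : H) : tens H A -> tens H A := tmap (amul h) id.
Fact free_actE h f a : free_act h (f \ox a) = (h ** f) \ox a.
Proof. by rewrite /free_act tmapE //; apply: amul_linr. Qed.
Fact free_act_linr h : linear (free_act h).
Proof. by apply: tmap_lin => //; apply: amul_linr. Qed.
Fact free_act_linl m : linear (free_act^~ m).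
Proof.
apply: tenslift_par => f a; exact: (lin_comp (amul_linl f) (tpure_linl a)).
Qed.
Fact free_act1 m : free_act aone m = m.
Proof.
move: m; apply: tens_ext => [||f a]; first exact: free_act_linr.
  exact: lin_id.
by rewrite free_actE amul1a.
Qed.
Fact free_actM f h m : free_act (f ** h) m = free_act f (free_act h m).
Proof.
move: m; apply: tens_ext => [||f' a]; first exact: free_act_linr.
  exact: (lin_comp (free_act_linr h) (free_act_linr f)).
by rewrite !free_actE amulA.
Qed.
Definition free_hmodule : hmodule H :=
  HModule free_act_linl free_act_linr free_act1 free_actM.
Local Notation F := free_hmodule.

Lemma free_pure_lin (t : tens H H) :
  linear (fun a => t \oxH (aone \ox a : F)).
Proof. exact: (lin_comp (tpure_linr aone) (@hpure_linr K H F t)). Qed.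

Variables (c : A -> A -> HHt F) (cb : bilin c).
Definition free_pmul (u v : F) : HHt F :=
  tenslift (fun f a => tenslift (fun g b => hhact (f \ox g) (c a b)) v) u.
Let bi1 f a : bilin (fun g b => hhact (f \ox g) (c a b)).
Proof.
split=> [b|g]; last exact: (lin_comp (cb.2 a) (hhact_linr _)).
exact: (lin_comp (tpure_linr f) (hhact_linl _)).
Qed.
Let bi2 v : bilin (fun f a => tenslift (fun g b => hhact (f \ox g) (c a b)) v).
Proof.
split=> [a|f]; apply: tenslift_par => g b.
  exact: (lin_comp (tpure_linl g) (hhact_linl _)).
exact: (lin_comp (cb.1 b) (hhact_linr _)).
Qed.
Lemma free_pmulE f a g b :
  free_pmul (f \ox a) (g \ox b) = hhact (f \ox g) (c a b).
Proof. by rewrite /free_pmul !tensliftE. Qed.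
Fact free_pmul_linl v : linear (free_pmul^~ v).
Proof. exact: tenslift_lin. Qed.
Fact free_pmul_linr u : linear (free_pmul u).
Proof. by apply: tenslift_par => f a; apply: tenslift_lin. Qed.
Fact free_pmulH f h a b :
  free_pmul (hact f a) (hact h b) = hhact (f \ox h) (free_pmul a b).
Proof.
move: a; apply: tens_ext => [||f' a].
- exact: (lin_comp (hact_linr f) (free_pmul_linl _)).
- exact: (lin_comp (free_pmul_linl b) (hhact_linr _)).
move: b; apply: tens_ext => [||h' b].
- exact: (lin_comp (hact_linr h) (free_pmul_linr _)).
- exact: (lin_comp (free_pmul_linr _) (hhact_linr _)).
by rewrite /= !free_actE !free_pmulE -hhactM tmulE.
Qed.
Definition free_pseudo : pseudo H :=
  Pseudo free_pmul_linl free_pmul_linr free_pmulH.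
End FreePseudo.

(* Cur B = H (x) B, (f (x) a) * (g (x) b) = (f (x) g) (x)_H (1 (x) ab). *)
Section CurOrdinary.
Variables (K : fieldType) (H : hopf K) (B : pzAlgType K).
Let c (a b : B) : HHt (free_hmodule H B) :=
  (aone \ox aone) \oxH (aone \ox (a ** b) : free_hmodule H B).
Fact CurAlg_bilin : bilin c.
Proof.
split=> [b|a].
- exact: (lin_comp (amul_linl b) (free_pure_lin _)).
- exact: (lin_comp (amul_linr a) (free_pure_lin _)).
Qed.
Definition CurAlg : pseudo H := free_pseudo CurAlg_bilin.
Lemma CurAlgE (f g : H) (a b : B) :
  pmul (f \ox a : CurAlg) (g \ox b : CurAlg) =
    (f \ox g) \oxH (aone \ox (a ** b) : CurAlg).
Proof.
rewrite /= free_pmulE; last exact: CurAlg_bilin.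
by rewrite hhactE tmulE !amula1.
Qed.
End CurOrdinary.

(* Cend_n = H (x) H (x) End_n,
   (f (x) a (x) P) * (g (x) b (x) Q) =
      (f (x) g a_(1)) (x)_H (1 (x) b a_(2) (x) P Q). *)
Section Cend.
Variables (K : fieldType) (H : hopf K) (n : nat).
Local Notation A := (tens H 'M[K]_n).
Local Notation T := (HHt (free_hmodule H A)).
Let c0 (b : H) (P Q : 'M[K]_n) (a1 a2 : H) : T :=
  (aone \ox a1) \oxH
    (aone \ox ((b ** a2) \ox (P ** Q)) : free_hmodule H A).
Let c (u v : A) : T :=
  tenslift (fun a P => tenslift (fun b Q => tenslift (c0 b P Q) (hD a)) v) u.
Let bi0 b P Q : bilin (c0 b P Q).
Proof.
split=> [a2|a1]; first exact: (lin_comp (tpure_linr _) (@hpure_linl K H (free_hmodule H A) _)).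
exact: (lin_comp (amul_linr b) (lin_comp (tpure_linl _)
  (free_pure_lin _))).
Qed.
Let bi1 a P : bilin (fun b Q => tenslift (c0 b P Q) (hD a)).
Proof.
split=> [Q|b]; apply: tenslift_par => a1 a2.
- exact: (lin_comp (amul_linl a2) (lin_comp (tpure_linl _)
    (free_pure_lin _))).
- exact: (lin_comp (amul_linr P) (lin_comp (tpure_linr _) (free_pure_lin _))).
Qed.
Let bi2 v :
  bilin (fun a P => tenslift (fun b Q => tenslift (c0 b P Q) (hD a)) v).
Proof.
have [Dl _ _] := @hD_hom K H; split=> [P|a]; apply: tenslift_par => b Q.
- exact: (lin_comp Dl (tenslift_lin (bi0 b P Q))).
- apply: tenslift_par => a1 a2.
  exact: (lin_comp (amul_linl Q) (lin_comp (tpure_linr _) (free_pure_lin _))).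
Qed.
Fact Cend_bilin : bilin c.
Proof.
split=> [v|u]; first exact: tenslift_lin.
by apply: tenslift_par => a P; apply: tenslift_lin.
Qed.
Definition Cend : pseudo H := free_pseudo Cend_bilin.
Lemma CendE (f g a b : H) (P Q : 'M[K]_n) :
  pmul (f \ox (a \ox P) : Cend) (g \ox (b \ox Q) : Cend) =
    tenslift (fun a1 a2 =>
      (f \ox (g ** a1)) \oxH (aone \ox ((b ** a2) \ox (P ** Q)) : Cend)) (hD a).
Proof.
rewrite /= free_pmulE; last exact: Cend_bilin.
rewrite /c !tensliftE //; move: (hD a); apply: tens_ext => [||a1 a2].
- exact: (lin_comp (tenslift_lin (bi0 b P Q)) (hhact_linr _)).
- apply: tenslift_lin; split=> [a2|a1].
    exact: (lin_comp (amul_linr g) (lin_comp (tpure_linr _) (@hpure_linl K H (free_hmodule H A) _))).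
  exact: (lin_comp (amul_linr b) (lin_comp (tpure_linl _)
    (free_pure_lin _))).
rewrite tensliftE // /c0 hhactE tmulE amula1 tensliftE //.
split=> [x2|x1].
  exact: (lin_comp (amul_linr g) (lin_comp (tpure_linr _) (@hpure_linl K H (free_hmodule H A) _))).
exact: (lin_comp (amul_linr b) (lin_comp (tpure_linl _)
  (free_pure_lin _))).
Qed.
End Cend.

(* Diff A, the locally finite action of X = H^* on A being given by a linear
   map A -> A (x) H, a |-> a_(0) (x) a_(1), via x(a) = a_(0) <x, a_(1)>.
   Since x(b) = <x, S^2(b_(1))> b_(0) when S^2 = id, the pseudoproduct with
   (1 (x) a)_x (1 (x) b) = 1 (x) a x(b) is
   (1 (x) a) * (1 (x) b) = (S(b_(1)) (x) 1) (x)_H (1 (x) a b_(0)),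
   see [DiffP]. *)
Section Diff.
Variables (K : fieldType) (H : hopf K) (A : pzAlgType K).
Variables (co : A -> tens A H) (co_lin : linear co).
Local Notation T := (HHt (free_hmodule H A)).

Definition xact (x : H -> K^o) (a : A) : A :=
  tenslift (fun a0 a1 => (x a1 : K) *: a0) (co a).

Let c0 (a b0 : A) (b1 : H) : T :=
  (hS b1 \ox aone) \oxH (aone \ox (a ** b0) : free_hmodule H A).
Let c (a b : A) : T := tenslift (c0 a) (co b).
Let bi0 a : bilin (c0 a).
Proof.
split=> [b1|b0].
  exact: (lin_comp (amul_linr a) (free_pure_lin _)).
exact: (lin_comp (@hS_lin K H) (lin_comp (tpure_linl _) (@hpure_linl K H (free_hmodule H A) _))).
Qed.
Fact Diff_bilin : bilin c.
Proof.
split=> [b|a]; last exact: (lin_comp co_lin (tenslift_lin (bi0 a))).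
apply: tenslift_par => b0 b1.
exact: (lin_comp (amul_linl b0) (free_pure_lin _)).
Qed.
Definition Diff : pseudo H := free_pseudo Diff_bilin.

Lemma DiffP (x : H -> K^o) (a b : A) :
  (forall h : H, hS (hS h) = h) -> linear x ->
  xprod x (aone \ox a : Diff) (aone \ox b : Diff) (aone \ox (a ** xact x b)).
Proof.
move=> SK lx.
have bs : bilin (fun (b0 : A) (b1 : H) => hS b1 \ox (aone \ox (a ** b0) : Diff)).
  split=> [b1|b0].
    exact: (lin_comp (amul_linr a) (lin_comp (tpure_linr _) (tpure_linr _))).
  exact: (lin_comp (@hS_lin K H) (tpure_linl _)).
have b1 : bilin (fun (f : H) (e : Diff) => (f \ox aone) \oxH e).
  split=> [e|f]; last exact: hpure_linr.
  exact: (lin_comp (tpure_linl aone) (hpure_linl e)).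
have b2 : bilin (fun (f : H) (e : Diff) => (x (hS f) : K) *: e).
  split=> [e|f]; last exact: (lin_scale _ (@lin_id _ _)).
  exact: (lin_scalel e (lin_comp (@hS_lin K H) lx)).
have b3 : bilin (fun (a0 : A) (a1 : H) => (x a1 : K) *: a0).
  split=> [a1|a0]; last exact: lin_scalel.
  exact: (lin_scale _ (@lin_id _ _)).
exists (tenslift
  (fun (b0 : A) (b1 : H) => hS b1 \ox (aone \ox (a ** b0) : Diff)) (co b)).
- rewrite /= free_pmulE; last exact: Diff_bilin.
  rewrite -toneE hhact1 /c; move: (co b); apply: tens_ext => [||b0 b1'].
  + exact: tenslift_lin.
  + exact: (lin_comp (tenslift_lin bs) (tenslift_lin b1)).
  by rewrite !tensliftE.
- rewrite /xact; move: (co b); apply: tens_ext => [||b0 b1'].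
  + exact: (lin_comp (tenslift_lin b3)
      (lin_comp (amul_linr a) (tpure_linr _))).
  + exact: (lin_comp (tenslift_lin bs) (tenslift_lin b2)).
  by rewrite !tensliftE // SK amulZr (linZ (tpure_linr _)).
Qed.
End Diff.

(* Cend_n^phi = Diff(End_n (x) U_phi) over U(g), X acting on U_phi through
   rho. *)
Section CendPhi.
Variables (K : fieldType) (g : lieAlg K) (phi : g -> g -> K^o).
Variables (phiC : cocycle2 phi) (n : nat).
Local Notation E := (tens 'M[K]_n (Uphi phiC)).

Definition Uphi_co (u : Uphi phiC) : tens (Uphi phiC) (UH g) :=
  tmap id (@unop K (UH g)) (rho u).
Lemma Uphi_co_lin : linear Uphi_co.
Proof.
have [rl _ _] := rho_hom phiC.
exact: (lin_comp rl (tmap_lin (@lin_id _ _) (@unop_lin _ _))).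
Qed.
Definition EndUphi_co (u : E) : tens E (UH g) := tassoc (tmap id Uphi_co u).
Lemma EndUphi_co_lin : linear EndUphi_co.
Proof.
exact: (lin_comp (tmap_lin (@lin_id _ _) Uphi_co_lin) (@tassoc_lin _ _ _ _)).
Qed.
Definition CendPhi : pseudo (UH g) := Diff EndUphi_co_lin.

Lemma xact_EndUphi (x : UH g -> K^o) (P : 'M[K]_n) (u : Uphi phiC) :
  linear x -> xact EndUphi_co x (P \ox u) = P \ox xact Uphi_co x u.
Proof.
move=> lx.
have b3 (V : lmodType K) :
    bilin (fun (a0 : V) (a1 : UH g) => (x a1 : K) *: a0).
  split=> [a1|a0]; last exact: lin_scalel.
  exact: (lin_scale _ (@lin_id _ _)).
rewrite /xact /EndUphi_co tmapE //; last exact: Uphi_co_lin.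
move: (Uphi_co u); apply: tens_ext => [||v h].
- exact: (lin_comp (tpure_linr _)
    (lin_comp (@tassoc_lin _ _ _ _) (tenslift_lin (b3 _)))).
- exact: (lin_comp (tenslift_lin (b3 _)) (tpure_linr _)).
by rewrite tassocE !tensliftE // (linZ (tpure_linr _)).
Qed.

Lemma xact_Uphi_gen (x : UH g -> K^o) (y : g) : linear x ->
  xact Uphi_co x (Uphi_gen phiC y) =
    (x aone : K) *: Uphi_gen phiC y + (x (Ugen y) : K) *: aone.
Proof.
move=> lx.
have b3 : bilin (fun (a0 : Uphi phiC) (a1 : UH g) => (x a1 : K) *: a0).
  split=> [a1|a0]; last exact: lin_scalel.
  exact: (lin_scale _ (@lin_id _ _)).
rewrite /xact /Uphi_co rho_gen.
rewrite (linD (tmap_lin (@lin_id _ _) (@unop_lin _ _))).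
rewrite (linD (tenslift_lin b3)) !tmapE //; try exact: unop_lin.
by rewrite !tensliftE.
Qed.

Lemma CendPhiP (x : UH g -> K^o) (a b : E) : linear x ->
  xprod x (aone \ox a : CendPhi) (aone \ox b : CendPhi)
    (aone \ox (a ** xact EndUphi_co x b)).
Proof. by apply: DiffP => h; apply: U_SK. Qed.
End CendPhi.

(* Cur_{H'}^H R = H (x)_{H'} R along a Hopf algebra map j : H' -> H. *)
Section Cur.
Variables (K : fieldType) (H' H : hopf K) (j : hopf_hom H' H) (R : pseudo H').

Definition cur_sort : lmodType K :=
  @btens K H R H' (fun h f => f ** j h) (@hact _ _ R).
Definition cpure (f : H) (a : R) : cur_sort := bpure _ _ f a.
Definition cbal (Q : lmodType K) (f : H -> R -> Q) :=
  [/\ forall m, linear (f^~ m), forall t, linear (f t)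
    & forall h t m, f (t ** j h) m = f t (hact h m)].
Definition curlift (Q : lmodType K) (f : H -> R -> Q) (u : cur_sort) : Q :=
  tlift f u.
Lemma curliftE (Q : lmodType K) (f : H -> R -> Q) t m :
  cbal f -> curlift f (cpure t m) = f t m.
Proof. exact: tliftE. Qed.
Lemma curlift_lin (Q : lmodType K) (f : H -> R -> Q) :
  cbal f -> linear (curlift f).
Proof. exact: tlift_lin. Qed.
Lemma curlift_par (P Q : lmodType K) (f : P -> H -> R -> Q) u :
  (forall t m, linear (fun p => f p t m)) -> linear (fun p => curlift (f p) u).
Proof. exact: tlift_par. Qed.
Lemma cur_ext (Q : lmodType K) (f f' : cur_sort -> Q) : linear f -> linear f' ->
  (forall t m, f (cpure t m) = f' (cpure t m)) -> forall u, f u = f' u.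
Proof. exact: btens_ext. Qed.
Lemma cpure_linl a : linear (fun f => cpure f a).
Proof. exact: bpure_linl. Qed.
Lemma cpure_linr f : linear (cpure f).
Proof. exact: bpure_linr. Qed.
Lemma cpure_bal h f a : cpure (f ** j h) a = cpure f (hact h a).
Proof. exact: bpure_bal. Qed.

Definition cur_act (h : H) : cur_sort -> cur_sort :=
  curlift (fun f a => cpure (h ** f) a).
Let act_bal h : cbal (fun f a => cpure (h ** f) a).
Proof.
split=> [m|t|k t m]; first exact: (lin_comp (amul_linr h) (cpure_linl m)).
  exact: cpure_linr.
by rewrite amulA cpure_bal.
Qed.
Lemma cur_actE h f a : cur_act h (cpure f a) = cpure (h ** f) a.
Proof. exact: curliftE. Qed.
Fact cur_act_linr h : linear (cur_act h).
Proof. exact: curlift_lin. Qed.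
Fact cur_act_linl m : linear (cur_act^~ m).
Proof.
apply: curlift_par => f a; exact: (lin_comp (amul_linl f) (cpure_linl a)).
Qed.
Fact cur_act1 m : cur_act aone m = m.
Proof.
move: m; apply: cur_ext => [||f a]; first exact: cur_act_linr.
  exact: lin_id.
by rewrite cur_actE amul1a.
Qed.
Fact cur_actM f h m : cur_act (f ** h) m = cur_act f (cur_act h m).
Proof.
move: m; apply: cur_ext => [||f' a]; first exact: cur_act_linr.
  exact: (lin_comp (cur_act_linr h) (cur_act_linr f)).
by rewrite !cur_actE amulA.
Qed.
Definition cur_hmodule : hmodule H :=
  HModule cur_act_linl cur_act_linr cur_act1 cur_actM.
Local Notation C := cur_hmodule.

(* The map (H' (x) H') (x)_{H'} R -> (H (x) H) (x)_H (H (x)_{H'} R). *)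
Definition cur_incl : HHt R -> HHt C :=
  HHlift (fun t a => tmap j j t \oxH (cpure aone a : C)).
Let jj := tmap_hom (hopf_fun_hom j) (hopf_fun_hom j).
Let incl_bal : HHbal (fun t a => tmap j j t \oxH (cpure aone a : C)).
Proof.
have [jl j1 jM] := jj; split=> [m|t|h t m].
- exact: (lin_comp jl (@hpure_linl K H C _)).
- exact: (lin_comp (cpure_linr _) (@hpure_linr K H C _)).
rewrite jM -hopf_funD hpure_bal; congr hpure.
by rewrite -cpure_bal amul1a /= cur_actE amula1.
Qed.
Lemma cur_inclE t a : cur_incl (t \oxH a) = tmap j j t \oxH (cpure aone a : C).
Proof. exact: HHliftE. Qed.
Lemma cur_incl_lin : linear cur_incl.
Proof. exact: HHlift_lin. Qed.
Lemma cur_incl_act t u : cur_incl (hhact t u) = hhact (tmap j j t) (cur_incl u).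
Proof.
have [_ _ jM] := jj; move: u; apply: HHt_ext => [||s a].
- exact: (lin_comp (hhact_linr t) cur_incl_lin).
- exact: (lin_comp cur_incl_lin (hhact_linr _)).
by rewrite hhactE !cur_inclE hhactE jM.
Qed.

(* (f (x) a) * (g (x) b) = sum_i (f f_i (x) g g_i) (x)_H (1 (x) c_i) if
   a * b = sum_i (f_i (x) g_i) (x)_{H'} c_i. *)
Definition cur_pmul (u v : C) : HHt C :=
  curlift (fun f a =>
    curlift (fun g b => hhact (f \ox g) (cur_incl (pmul a b))) v) u.
Let jl : linear j. Proof. by case: (hopf_fun_hom j). Qed.
Let j1 : j aone = aone. Proof. by case: (hopf_fun_hom j). Qed.
Let bal1 f a : cbal (fun g b => hhact (f \ox g) (cur_incl (pmul a b))).
Proof.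
split=> [b|g|h g b].
- exact: (lin_comp (tpure_linr f) (hhact_linl _)).
- exact: (lin_comp (lin_comp (pmul_linr a) cur_incl_lin) (hhact_linr _)).
by rewrite pmulHr cur_incl_act -hhactM tmapE // j1 tmulE amula1.
Qed.
Let bal2 v : cbal (fun f a =>
  curlift (fun g b => hhact (f \ox g) (cur_incl (pmul a b))) v).
Proof.
split=> [a|f|h f a].
- apply: curlift_par => g b.
  exact: (lin_comp (tpure_linl g) (hhact_linl _)).
- apply: curlift_par => g b.
  exact: (lin_comp (lin_comp (pmul_linl b) cur_incl_lin) (hhact_linr _)).
move: v; apply: cur_ext => [||g b]; try exact: curlift_lin.
rewrite !curliftE // pmulHl cur_incl_act -hhactM tmapE // j1 tmulE.
by rewrite amula1.
Qed.
Lemma cur_pmulE f a g b : cur_pmul (cpure f a) (cpure g b) =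
  hhact (f \ox g) (cur_incl (pmul a b)).
Proof. by rewrite /cur_pmul !curliftE. Qed.
Fact cur_pmul_linl v : linear (cur_pmul^~ v).
Proof. exact: curlift_lin. Qed.
Fact cur_pmul_linr u : linear (cur_pmul u).
Proof. by apply: curlift_par => f a; apply: curlift_lin. Qed.
Fact cur_pmulH f h a b :
  cur_pmul (hact f a) (hact h b) = hhact (f \ox h) (cur_pmul a b).
Proof.
move: a; apply: cur_ext => [||f' a].
- exact: (lin_comp (@hact_linr K H C f) (cur_pmul_linl _)).
- exact: (lin_comp (cur_pmul_linl b) (hhact_linr _)).
move: b; apply: cur_ext => [||h' b].
- exact: (lin_comp (@hact_linr K H C h) (cur_pmul_linr _)).
- exact: (lin_comp (cur_pmul_linr _) (hhact_linr _)).
by rewrite /= !cur_actE !cur_pmulE -hhactM tmulE.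
Qed.
Definition Cur : pseudo H := Pseudo cur_pmul_linl cur_pmul_linr cur_pmulH.
End Cur.

Section Unital.
Variables (K : fieldType) (H : hopf K) (R : pseudo H).
Local Open Scope classical_set_scope.

(* The unit 1 of X = H^* is the counit, so the last clause is e_1 r = r. *)
Definition pseudoidentity (e : R) :=
  (exists i : CurAlg H K^o -> R,
     [/\ pseudo_hom i, injective i & i (aone \ox aone) = e]) /\
  forall r, xprod (@heps K H) e r r.

(* S is a current subalgebra Cur B of R with 1 (x) 1_B = e. *)
Definition unital_current (e : R) (S : set R) :=
  exists (B : pzAlgType K) (i : CurAlg H B -> R),
    [/\ pseudo_hom i, injective i, i (aone \ox aone) = e & S = range i].

Definition maximal_unital_current (e : R) (S : set R) :=
  unital_current e S /\
  forall S', unital_current e S' -> S `<=` S' -> S' = S.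

End Unital.

(* Main.v *)
(** Since R is simple its left annihilator vanishes, and the right action of the
  pseudoidentity e makes R a Hopf module, so that R = H (x) A with
  A = {r | r * e = (1 (x) 1) (x)_H r}. Under a.b = a_1 b this A is a unital
  algebra on which b |-> e * b is a coaction of H, and R = Diff A. The
  coinvariants of A span the maximal unital current subalgebra; being finite
  dimensional and simple they form a matrix algebra M_n, whence A = M_n (x) Z,
  where Z, the centralizer of M_n, has only scalar coinvariants.

  In Z the elements a with coaction x (x) 1 + 1 (x) a for some x in g form a
  central extension by the scalars of a subalgebra h of g, which provides the
  cocycle phi and a map U_phi -> Z. Choosing functionals t_i on U(g) dual to a
  basis x_i of h, with lifts s_i in Z, the operator a |-> sum_i s_i t_i(a)
  multiplies by n in degree n modulo lower degrees; in characteristic 0 this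
  gives both the injectivity and the surjectivity of U_phi -> Z. The cases of
  current algebras and of Cend_n are h = 0 and phi = 0. *)

Require Import Defs.
From HB Require Import structures.
From mathcomp Require Import all_boot all_order all_algebra.
From mathcomp Require Import boolp classical_sets reals complex.
From mathcomp Require Import zify.

Set Implicit Arguments.
Unset Strict Implicit.
Unset Printing Implicit Defensive.

Import GRing.Theory.
Local Open Scope ring_scope.

(** * Subspaces and linear functionals *)

(** The full PBW theorem is avoided. The operator E = sum_i s_i t_i only asks that t_i(1) = 0 and
    t_i(x_j) = delta_ij, hence only that g -> U(g) has a linear left inverse killing 1. That inverse
    comes from a diamond-lemma argument in which normal forms are truncated to degree one. The same
    operator on U(g) itself shows that primitive elements lie in g.

    Injectivity and surjectivity of U_phi -> Z use two different filtrations. In U_phi it is word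
    length. In Z, where no words are known beforehand, it is nilpotency under the augmentation ideal
    of X = H^*; there the primitive elements of U(g) control degree two.

    Tensor products are quotients of formal expressions, so two devices replace bases. Elements of H
    (x) V are compared by contracting with all linear functionals on H, of which Zorn's lemma
    supplies enough. And (H (x) H) (x)_H M is identified with H (x) M by an explicit inverse built
    from the antipode. The associativity law takes values in a threefold version of this module and
    is exploited through four linear maps out of it, each yielding its own identities. *)

Definition subspace (K : fieldType) (V : lmodType K) (P : V -> Prop) :=
  P 0 /\ forall k x y, P x -> P y -> P (k *: x + y).

Section Subspace.
Variables (K : fieldType) (V : lmodType K) (P : V -> Prop).
Hypothesis sP : subspace P.
Lemma sub0 : P 0. Proof. by case: sP. Qed.
Lemma subD x y : P x -> P y -> P (x + y).
Proof. by move=> Px Py; rewrite -[x]scale1r; apply: sP.2. Qed.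
Lemma subZ k x : P x -> P (k *: x).
Proof. by move=> Px; rewrite -[k *: x]addr0; apply: sP.2 => //; apply: sub0. Qed.
Lemma subN x : P x -> P (- x).
Proof. by move=> Px; rewrite -scaleN1r; apply: subZ. Qed.
Lemma subB x y : P x -> P y -> P (x - y).
Proof. by move=> Px Py; apply: subD => //; apply: subN. Qed.
Lemma sub_sum (I : Type) (r : seq I) (Q : pred I) (F : I -> V) :
  (forall i, Q i -> P (F i)) -> P (\sum_(i <- r | Q i) F i).
Proof.
move=> PF; elim/big_ind: _ => //; [exact: sub0 | exact: subD].
Qed.
End Subspace.

Lemma lin_sum (K : fieldType) (U V : lmodType K) (f : U -> V) (I : Type)
    (r : seq I) (Q : pred I) (F : I -> U) : linear f ->
  f (\sum_(i <- r | Q i) F i) = \sum_(i <- r | Q i) f (F i).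
Proof. by move=> lf; apply: (big_morph f (linD lf) (lin0 lf)). Qed.

Lemma linB (K : fieldType) (U V : lmodType K) (f : U -> V) x y : linear f ->
  f (x - y) = f x - f y.
Proof. by move=> lf; rewrite (linD lf) (linN lf). Qed.

Section Separation.
Variable K : fieldType.

(** A maximal subspace containing P and avoiding w is a hyperplane complementary to w; f is the
    coefficient of w modulo it. *)
Lemma separation (V : lmodType K) (P : V -> Prop) (w : V) :
  subspace P -> ~ P w ->
  exists f : V -> K^o, [/\ linear f, forall v, P v -> f v = 0 & f w = 1].
Proof.
move=> sP Pw.
(* The union with P makes the empty set, the union of the empty chain, an admissible member. *)
pose F (A : set V) := let B := (A `|` P)%classic in subspace B /\ ~ B w.
have [|A [[sA Aw] Amax]] := @Zorn_bigcup V F.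
  move=> C CF tC; split; last first.
    by case=> [[X CX Xw]|//]; have [_ []] := CF _ CX; left.
  split; first by right; apply: sub0.
  move=> k x y.
  have un X Y : C X -> C Y -> exists Z, [/\ C Z, X `<=` Z & Y `<=` Z]%classic.
    move=> CX CY; case: (tC _ _ CX CY) => h; [exists Y|exists X]; split=> //.
  have one X x' y' : C X -> (X `|` P)%classic x' -> (X `|` P)%classic y' ->
      ((\bigcup_(X in C) X) `|` P)%classic (k *: x' + y').
    move=> CX hx hy; have [[_ sX] _] := CF _ CX.
    by case: (sX k _ _ hx hy) => h; [left; exists X|right].
  case=> [[X CX Xx]|Px] [[Y CY Yy]|Py].
  - have [Z [CZ XZ YZ]] := un _ _ CX CY.
    by apply: (one Z) => //; left; [apply: XZ|apply: YZ].
  - by apply: (one X) => //; [left|right].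
  - by apply: (one Y) => //; [right|left].
  - by right; apply: sP.2.
pose B := (A `|` P)%classic.
have dec v : exists c, B (v - c *: w).
  case: (pselect (B v)) => [Bv|Bv]; first by exists 0; rewrite scale0r subr0.
  (* B' is B + K v. It is strictly larger than B, so by maximality it contains w, and the relation
     is solved for v. *)
  pose B' : set V := fun u => exists2 c : K, True & B (u - c *: v).
  have sB' : subspace B'.
    split; first by exists 0 => //; rewrite scale0r subr0; apply: sub0.
    move=> k x y [c _ Bx] [d _ By]; exists (k * c + d) => //.
    rewrite scalerDl opprD addrACA -scalerA -scalerBr; exact: sA.2.
  have BB' u : B u -> B' u by exists 0 => //; rewrite scale0r subr0.
  have : B' w.
    apply: contrapT => nB'w; apply: (Amax B').
      split; last first.
        by move=> h; apply: Bv; left; apply: h; exists 1 => //;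
           rewrite scale1r subrr; apply: sub0.

      by move=> u Au; apply: BB'; left.
    have E : (B' `|` P)%classic = B'.
      by apply/seteqP; split=> [u [//|Pu]|u]; [apply: BB'; right | left].
    by rewrite /F E; split.
  case=> c _ h; have c0 : c != 0.
    apply/eqP => c0; apply: Aw.
    by move: h; rewrite c0 scale0r subr0.
  exists c^-1; have := subZ sA (- c^-1) h.
  by rewrite scalerBr scalerA mulNr mulVf // scaleNr scaleN1r opprK addrC.
have uni v c d : B (v - c *: w) -> B (v - d *: w) -> c = d.
  move=> h1 h2; case: (eqVneq c d) => // cd; exfalso; apply: Aw.
  have := subZ sA (c - d)^-1 (subB sA h2 h1).
  rewrite opprB [v - _ + _]addrC addrA subrK -scalerBl scalerA mulVf ?subr_eq0 //.
  by rewrite scale1r.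
pose f : V -> K^o := fun u => projT1 (cid (dec u)).
have fE u : B (u - f u *: w) by rewrite /f; case: (cid (dec u)).
exists f; split.
- move=> k u v; apply: (uni (k *: u + v)) => //.
  rewrite -[k *: f u]/(k * f u) scalerDl opprD addrACA -scalerA -scalerBr.
  by apply: sA.2; apply: fE.
- by move=> u Pu; apply: (uni u) => //; rewrite scale0r subr0; right.
- by apply: (uni w) => //; rewrite scale1r subrr; apply: sub0.
Qed.

Definition ev (H V : lmodType K) (y : H -> K^o) (t : tens H V) : V :=
  tenslift (fun h v => (y h : K) *: v) t.

Lemma ev_bilin (H V : lmodType K) (y : H -> K^o) : linear y ->
  bilin (fun h (v : V) => (y h : K) *: v).
Proof.
move=> ly; split=> [n|m]; first exact: lin_scalel.
exact: (lin_scale _ (@lin_id _ _)).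
Qed.

Lemma evE (H V : lmodType K) (y : H -> K^o) h (v : V) : linear y ->
  ev y (h \ox v) = (y h : K) *: v.
Proof. by move=> ly; rewrite /ev tensliftE //; apply: ev_bilin. Qed.

Lemma ev_lin (H V : lmodType K) (y : H -> K^o) : linear y ->
  linear (@ev H V y).
Proof. by move=> ly; apply: tenslift_lin; apply: ev_bilin. Qed.

Lemma ev_linl (H V : lmodType K) (t : tens H V) k (y z : H -> K^o) :
  linear y -> linear z ->
  ev (fun h => k *: y h + z h) t = k *: ev y t + ev z t.
Proof.
move=> ly lz; move: t; apply: tens_ext => [||h v].
- by apply: ev_lin; apply: lin_add => //; apply: lin_scale.
- by apply: lin_add; [apply: lin_scale|]; apply: ev_lin.
by rewrite !evE ?scalerDl ?scalerA //; apply: lin_add => //; apply: lin_scale.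
Qed.

Lemma tens_sumP (H V : lmodType K) (t : tens H V) :
  exists n (h : 'I_n -> H) (v : 'I_n -> V), t = \sum_i (h i \ox v i).
Proof.
elim/tens_ind: t => [h v||t u [n [h [v ->]]] [m [h' [v' ->]]]].
- by exists 1%N, (fun=> h), (fun=> v); rewrite big_ord1.
- by exists 0%N, (fun=> 0), (fun=> 0); rewrite big_ord0.
exists (n + m)%N, (fun i => match split i with inl j => h j | inr j => h' j end),
  (fun i => match split i with inl j => v j | inr j => v' j end).
rewrite big_split_ord /=; congr (_ + _); apply: eq_bigr => i _.
  by rewrite -[lshift _ i]/(unsplit (inl i)) unsplitK.
by rewrite -[rshift _ i]/(unsplit (inr i)) unsplitK.
Qed.

(** Induction on the number of pure tensors. If the first left factor depends linearly on the others
    it is absorbed into them; otherwise a functional equal to 1 on it and 0 on the others shows that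
    its right factor vanishes. *)
Lemma tens_sep (H V : lmodType K) (t : tens H V) :
  (forall y : H -> K^o, linear y -> ev y t = 0) -> t = 0.
Proof.
have [n [h [v ->]]] := tens_sumP t; elim: n h v => [|n IH] h v.
  by rewrite big_ord0.
rewrite big_ord_recl => t0.
set h0 := h ord0 in t0 *; set h' := fun i => h (lift ord0 i).
pose P u := exists c : 'I_n -> K, u = \sum_i c i *: h' i.
have sP : subspace P.
  split; first by exists (fun=> 0); rewrite big1 // => i _; rewrite scale0r.
  move=> k x y [c ->] [d ->]; exists (fun i => k * c i + d i).
  rewrite scaler_sumr -big_split; apply: eq_bigr => i _ /=.
  by rewrite scalerDl scalerA.
case: (pselect (P h0)) => [[c E]|nP].
  suff E' : h0 \ox v ord0 + \sum_i (h (lift ord0 i) \ox v (lift ord0 i)) =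
     \sum_i (h' i \ox (v (lift ord0 i) + c i *: v ord0)).
    by rewrite E'; apply: IH => y ly; rewrite -E'; apply: t0.
  rewrite E (lin_sum _ _ _ (tpure_linl _)) -big_split; apply: eq_bigr => i _.
  by rewrite (linD (tpure_linr _)) (linZ (tpure_linl _)) (linZ (tpure_linr _))
    addrC.
have [f [lf f0 f1]] := separation sP nP.
have fh i : f (h' i) = 0.
  apply: f0; exists (fun j => (j == i)%:R).
  rewrite (bigD1 i) //= eqxx scale1r big1 ?addr0 // => j /negPf ->.
  by rewrite scale0r.
have v0 : v ord0 = 0.
  have := t0 f lf; rewrite (linD (ev_lin lf)) evE // f1 scale1r.
  rewrite (lin_sum _ _ _ (ev_lin lf)) big1 ?addr0 // => i _.
  by rewrite evE // -/(h' i) fh scale0r.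
rewrite v0 (lin0 (tpure_linr _)) add0r in t0 *.
exact: IH.
Qed.

Lemma tens_sep2 (H V : lmodType K) (t u : tens H V) :
  (forall y : H -> K^o, linear y -> ev y t = ev y u) -> t = u.
Proof.
move=> E; apply/eqP; rewrite -subr_eq0; apply/eqP/tens_sep => y ly.
by rewrite (linB _ _ (ev_lin ly)) E // subrr.
Qed.

End Separation.

(** * Injectivity of g -> U(g) *)

Section WeakPBW.
Variables (K : fieldType) (g : lieAlg K).
Local Notation m := (\dim {:g}).
Local Notation I := 'I_m.
Local Notation b := (vbasis {:g}).
Implicit Types (u v w : seq I) (F : seq I -> g) (x y : g).

(** F stands for a linear map on the tensor algebra of g, given on words in the basis; this is its
    value at u (x) x (x) v for an arbitrary vector x. *)
Definition insert_br F u v x : g := \sum_k coord b k x *: F (u ++ k :: v).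
Definition insert_br2 F u v x y : g :=
  \sum_k coord b k x *: insert_br F (u ++ [:: k]) v y.

Lemma insert_br_lin F u v : linear (insert_br F u v).
Proof.
move=> k x y; rewrite /insert_br scaler_sumr -big_split; apply: eq_bigr => i _.
by rewrite linearP scalerDl scalerA.
Qed.
Lemma insert_br_basis F u v (i : I) : insert_br F u v b`_i = F (u ++ i :: v).
Proof.
rewrite /insert_br (bigD1 i) //= coord_free ?(basis_free (vbasisP _)) // eqxx.
rewrite scale1r big1 ?addr0 // => j ij.
by rewrite coord_free ?(basis_free (vbasisP _)) // eq_sym (negPf ij) scale0r.
Qed.
Lemma insert_br2_linl F u v y : linear (insert_br2 F u v ^~ y).
Proof.
move=> k x x'; rewrite /insert_br2 scaler_sumr -big_split; apply: eq_bigr => i _.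
by rewrite linearP scalerDl scalerA.
Qed.
Lemma insert_br2_linr F u v x : linear (insert_br2 F u v x).
Proof.
move=> k y y'; rewrite /insert_br2 scaler_sumr -big_split; apply: eq_bigr => i _.
by rewrite insert_br_lin scalerDr scalerA mulrC -scalerA.
Qed.
Lemma insert_br2_basisl F u v (i : I) y :
  insert_br2 F u v b`_i y = insert_br F (u ++ [:: i]) v y.
Proof.
rewrite /insert_br2 (bigD1 i) //= coord_free ?(basis_free (vbasisP _)) // eqxx.
rewrite scale1r big1 ?addr0 // => j ij.
by rewrite coord_free ?(basis_free (vbasisP _)) // eq_sym (negPf ij) scale0r.
Qed.
Lemma insert_br2_basisr F u v x (i : I) :
  insert_br2 F u v x b`_i = insert_br F u (i :: v) x.
Proof.
rewrite /insert_br2 /insert_br; apply: eq_bigr => k _; congr (_ *: _).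
by rewrite -/(insert_br _ _ _ _) insert_br_basis -catA.
Qed.
Lemma basis_dec x : x = \sum_i coord b i x *: b`_i.
Proof. exact: coord_vbasis (memvf x). Qed.
Lemma bilin_basis_ext (f f' : g -> g -> g) : bilin f -> bilin f' ->
  (forall i j : I, f b`_i b`_j = f' b`_i b`_j) -> forall x y, f x y = f' x y.
Proof.
move=> [fl fr] [fl' fr'] E x y; rewrite [x]basis_dec [y]basis_dec.
rewrite (lin_sum _ _ _ (fl _)) (lin_sum _ _ _ (fl' _)); apply: eq_bigr => i _.
rewrite (linZ (fl _)) (linZ (fl' _)); congr (_ *: _).
rewrite (lin_sum _ _ _ (fr _)) (lin_sum _ _ _ (fr' _)); apply: eq_bigr => j _.
by rewrite (linZ (fr _)) (linZ (fr' _)) E.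
Qed.

(* The relation [F (u i j v) - F (u j i v) = F (u [b_i, b_j] v)] at a fixed
   place. *)
Definition straight F u v := forall i j : I,
  F (u ++ i :: j :: v) = F (u ++ j :: i :: v) + insert_br F u v (lie_br b`_i b`_j).

Lemma straight2 F u v x y : straight F u v ->
  insert_br2 F u v x y = insert_br2 F u v y x + insert_br F u v (lie_br x y).
Proof.
move=> sF; move: x y; apply: bilin_basis_ext.
- by split=> z; [exact: insert_br2_linl | exact: insert_br2_linr].
- split=> z; apply: lin_add.
  + exact: insert_br2_linr.
  + exact: (lin_comp (lie_linl z) (insert_br_lin F u v)).
  + exact: insert_br2_linl.
  + exact: (lin_comp (lie_linr z) (insert_br_lin F u v)).
move=> i j; rewrite !insert_br2_basisl !insert_br_basis -!catA /=; exact: sF.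
Qed.

Fixpoint inv w : nat :=
  if w is a :: w' then (count (fun c : I => (c < a)%N) w' + inv w')%N else 0%N.
(** A swap lowers the number of inversions by one, while a bracket shortens the word but may create
    inversions. There are at most n^2 of these in length n, and (n+1)^3 > n^3 + n^2, so the cube
    dominates. *)
Definition meas w : nat := (inv w + size w ^ 3)%N.

Lemma inv_swap u v (a c : I) : (c < a)%N ->
  inv (u ++ a :: c :: v) = (inv (u ++ c :: a :: v)).+1.
Proof.
move=> ca; elim: u => [|d u IH] /=; last first.
  by rewrite IH addnS !count_cat /=; lia.
by rewrite ca [(a < c)%N]ltnNge (ltnW ca) /=; lia.
Qed.
Lemma inv_size w : (inv w <= size w ^ 2)%N.
Proof.
elim: w => [//|a w IH] /=; have := count_size (fun c : I => (c < a)%N) w.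
by move: IH; nia.
Qed.
Lemma meas_swap u v (a c : I) : (c < a)%N ->
  (meas (u ++ c :: a :: v) < meas (u ++ a :: c :: v))%N.
Proof. by move=> ca; rewrite /meas !size_cat (inv_swap _ _ ca) ltn_add2r. Qed.
Lemma meas_size w w' : (size w < size w')%N -> (meas w < meas w')%N.
Proof.
rewrite /meas => ss; have := inv_size w.
have : ((size w).+1 ^ 3 <= size w' ^ 3)%N by rewrite leq_exp2r.
by rewrite !expnS !expn0; nia.
Qed.

Fixpoint descent w : option (seq I * I * I * seq I) :=
  if w is a :: w' then
    if w' is c :: v then
      if (c < a)%N then Some ([::], a, c, v)
      else if descent w' is Some (u', a', c', v') then Some (a :: u', a', c', v')
      else None
    else None
  else None.
Lemma descentP w u a c v : descent w = Some (u, a, c, v) ->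
  w = u ++ a :: c :: v /\ (c < a)%N.
Proof.
elim: w u a c v => [//|d [//|e w] IH] u a c v /=.
case: ifP => [ed [<- <- <- <-] //|_].
case E : (if w is _ :: _ then _ else _) => [[[[u' a'] c'] v']|//].
by move=> [<- <- <- <-]; have [-> ?] := IH _ _ _ _ E.
Qed.
Lemma descent_some u v (a c : I) : (c < a)%N -> descent (u ++ a :: c :: v) <> None.
Proof.
move=> ca; elim: u => [|d u IH] /=; first by rewrite ca.
case: u IH => [|e u] /= IH; first by case: ifP => // _; rewrite ca.
by case: ifP => // _; case: (if _ is _ :: _ then _ else _) IH => [[[[? ?] ?] ?]|].
Qed.

(** Among sorted words only those with one letter count: the recursion computes the degree-one part
    of the PBW normal form. *)
Definition base w : g := if w is [:: i] then b`_i else 0.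
(** [N] is fuel; by [sortval_stable] every value above [meas w] gives the same result. *)
Fixpoint sortval N w : g :=
  if N is N'.+1 then
    if descent w is Some (u, a, c, v) then
      sortval N' (u ++ c :: a :: v) +
      insert_br (sortval N') u v (lie_br b`_a b`_c)
    else base w
  else 0.
Definition straighten w := sortval (meas w).+1 w.

Lemma meas_insert u v (a c k : I) :
  (meas (u ++ k :: v) < meas (u ++ a :: c :: v))%N.
Proof. by apply: meas_size; rewrite !size_cat /= !addnS ltnS. Qed.

Lemma insert_br_ext F F' u v x : (forall k, F (u ++ k :: v) = F' (u ++ k :: v)) ->
  insert_br F u v x = insert_br F' u v x.
Proof. by move=> E; apply: eq_bigr => k _; rewrite E. Qed.

Lemma sortval_stable N N' w : (meas w < N)%N -> (meas w < N')%N ->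
  sortval N w = sortval N' w.
Proof.
elim: N N' w => [//|N IH] [//|N'] w /=; rewrite !ltnS => wN wN'.
case E : (descent w) => [[[[u a] c] v]|//]; have [Ew ca] := descentP E.
have ms := meas_swap u v ca; rewrite -Ew in ms.
have mi k := meas_insert u v a c k; rewrite -Ew in mi.
congr (_ + _); first by apply: IH; [apply: leq_trans wN|apply: leq_trans wN'].
apply: insert_br_ext => k.
by apply: IH; [apply: leq_trans wN|apply: leq_trans wN'].
Qed.

Definition swap_val F u v (a c : I) : g :=
  F (u ++ c :: a :: v) + insert_br F u v (lie_br b`_a b`_c).

Lemma straighten_descent w u a c v : descent w = Some (u, a, c, v) ->
  straighten w = swap_val straighten u v a c.
Proof.
move=> E; have [Ew ca] := descentP E; rewrite {1}/straighten /= E /swap_val.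
congr (_ + _).
  by apply: sortval_stable => //; rewrite Ew; apply: meas_swap.
apply: insert_br_ext => k.
by apply: sortval_stable => //; rewrite Ew; apply: meas_insert.
Qed.

(** The two kinds of ambiguity in the diamond lemma: descents sharing a letter, and disjoint
    descents. *)
Lemma overlap u v u' v' (a c a' c' : I) :
  u ++ a :: c :: v = u' ++ a' :: c' :: v' -> (size u < size u')%N ->
  [/\ u' = u ++ [:: a], c = a' & v = c' :: v'] \/
  (exists z, u' = u ++ a :: c :: z /\ v = z ++ a' :: c' :: v').
Proof.
elim: u u' => [|d u IH] [//|d' u'] /=.
  case: u' => [|e u'] /=; first by move=> [-> -> ->] _; left.
  by move=> [-> -> ->] _; right; exists u'.
move=> [->] /IH{}IH /IH [[-> -> ->]|[z [-> ->]]]; first by left.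
by right; exists z.
Qed.

Section Diamond.
Variable w : seq I.
Hypothesis IH : forall u v (a c : I), (meas (u ++ a :: c :: v) < meas w)%N ->
  (c < a)%N ->
  straighten (u ++ a :: c :: v) = swap_val straighten u v a c.

Lemma straight_small u v : (size u + size v + 2 < size w)%N ->
  straight straighten u v.
Proof.
move=> suv i j; have small (k l : I) : (meas (u ++ k :: l :: v) < meas w)%N.
  by apply: meas_size; rewrite size_cat /= -addn2 addnA addn2 -addn2.
case: (ltngtP i j) => [ij|ji|/val_inj ->].
- rewrite (IH (small j i) ij) /swap_val (lie_anti b`_i).
  by rewrite (linN (insert_br_lin _ _ _)) addrK.
- exact: (IH (small i j) ji).
by rewrite lie_alt (lin0 (insert_br_lin _ _ _)) addr0.
Qed.

(** For three overlapping letters both reductions are continued to the increasing order of the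
    letters, and the remaining difference is the Jacobi identity. Disjoint reductions commute, the
    terms with two brackets forming the same double sum in either order. *)
Lemma diamond u v u' v' (a c a' c' : I) :
  w = u ++ a :: c :: v -> w = u' ++ a' :: c' :: v' -> (size u < size u')%N ->
  (c < a)%N -> (c' < a')%N ->
  swap_val straighten u v a c = swap_val straighten u' v' a' c'.
Proof.
move=> Ew Ew' ss ca ca'.
have IH1 u1 v1 (a1 c1 : I) : size (u1 ++ a1 :: c1 :: v1) = size w ->
    (inv (u1 ++ a1 :: c1 :: v1) < inv w)%N -> (c1 < a1)%N ->
    straighten (u1 ++ a1 :: c1 :: v1) = swap_val straighten u1 v1 a1 c1.
  by move=> s1 i1; apply: IH; rewrite /meas s1 ltn_add2r.
have Iw : inv w = (inv (u ++ c :: a :: v)).+1 by rewrite Ew inv_swap.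
have Iw' : inv w = (inv (u' ++ c' :: a' :: v')).+1 by rewrite Ew' inv_swap.
case: (overlap (etrans (esym Ew) Ew') ss) => [[E1 E2 E3]|[z [E1 E2]]].
- subst u' c v; rewrite -catA /= in Ew' Iw'.
  have ca2 : (c' < a)%N by apply: ltn_trans ca' ca.
  have sw : size w = (size u + size v' + 3)%N.
    by rewrite Ew size_cat /= !addnS addn0.
  have sm : straight straighten u v' by apply: straight_small; rewrite sw; lia.
  have s3 (i j k : I) : size (u ++ i :: j :: k :: v') = size w.
    by rewrite sw size_cat /= !addnS addn0.
  have i1 := @inv_swap (u ++ [:: a']) v' _ _ ca2.
  have i2 := @inv_swap u (c' :: v') _ _ ca.
  have i3 := @inv_swap (u ++ [:: c']) v' _ _ ca.
  have i4 := @inv_swap u (a' :: v') _ _ ca2.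
  have i5 := @inv_swap u (a :: v') _ _ ca'.
  have i6 := @inv_swap (u ++ [:: a]) v' _ _ ca'.
  rewrite -!catA /= in i1 i2 i3 i4 i5 i6 Iw *.
  have j1 := IH1 (u ++ [:: a']) v' a c'.
  have j2 := IH1 u (a :: v') a' c'.
  have j3 := IH1 u (a' :: v') a c'.
  have j4 := IH1 (u ++ [:: c']) v' a a'.
  rewrite -!catA /= in j1 j2 j3 j4.
  rewrite /swap_val -!catA /=.
  rewrite j1 ?s3 //; last by lia.
  rewrite j3 ?s3 //; last by lia.
  rewrite /swap_val -!catA /= j2 ?s3 //; last by lia.
  rewrite j4 ?s3 //; last by lia.
  rewrite /swap_val -!catA /=.
  rewrite -!insert_br2_basisr -!insert_br2_basisl.
  rewrite -!addrA; congr (_ + _).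
  have S x y := straight2 x y sm.
  (* Moving each bracket past the third letter gives the two-letter terms of both sides the same
     form; what is left over are three double brackets. *)
  rewrite [insert_br2 _ _ _ (lie_br b`_a' b`_c') _]S.
  rewrite [insert_br2 _ _ _ (lie_br b`_a b`_c') _]S.
  rewrite [insert_br2 _ _ _ (lie_br b`_a b`_a') _]S.
  set X := insert_br2 _ _ _ b`_a _; set Y := insert_br2 _ _ _ b`_a' _.
  set Z := insert_br2 _ _ _ b`_c' _.
  set J1 := insert_br _ _ _ (lie_br (lie_br b`_a' _) _).
  set J2 := insert_br _ _ _ (lie_br (lie_br b`_a b`_c') _).
  set J3 := insert_br _ _ _ (lie_br (lie_br b`_a b`_a') _).
  suff J : J1 + J3 = J2 by rewrite -J !addrA [LHS](ACl (4*3*2*5*1)).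
  rewrite /J1 /J2 /J3 -(linD (insert_br_lin _ _ _)); congr insert_br.
  apply/eqP; rewrite -subr_eq0; apply/eqP; rewrite -[RHS]oppr0.
  rewrite -[in RHS](lie_jacobi b`_a b`_a' b`_c').
  rewrite (lie_anti (lie_br b`_a' b`_c')) (lie_anti (lie_br b`_a b`_a')).
  rewrite (lie_anti (lie_br b`_a b`_c')) (lie_anti b`_c' b`_a).
  by rewrite (linN (lie_linr _)) !opprD !opprK addrAC.
- subst u' v.
  set x := lie_br b`_a b`_c; set y := lie_br b`_a' b`_c'.
  have sw : size w = (size u + size z + size v' + 4)%N.
    by rewrite Ew !size_cat /= size_cat /=; lia.
  have L1 : straighten (u ++ c :: a :: z ++ a' :: c' :: v') =
      swap_val straighten (u ++ c :: a :: z) v' a' c'.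
    rewrite -(IH1 (u ++ c :: a :: z)) -?catA ?cat_cons //; last by rewrite Iw.
    by rewrite sw !size_cat /= size_cat /=; lia.
  have L2 k : straighten (u ++ k :: z ++ a' :: c' :: v') =
      swap_val straighten (u ++ k :: z) v' a' c'.
    rewrite -(@IH (u ++ k :: z)) -?catA ?cat_cons //; apply: meas_size.
    by rewrite sw !size_cat /= size_cat /=; lia.
  have R1 : straighten (u ++ a :: c :: z ++ c' :: a' :: v') =
      swap_val straighten u (z ++ c' :: a' :: v') a c.
    rewrite -(IH1 u) //; last by rewrite Iw' -catA.
    by rewrite sw !size_cat /= size_cat /=; lia.
  have R2 k : straighten (u ++ a :: c :: z ++ k :: v') =
      swap_val straighten u (z ++ k :: v') a c.
    rewrite -(@IH u) //; apply: meas_size.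
    by rewrite sw !size_cat /= size_cat /=; lia.
  rewrite {1}/swap_val L1 {1}/swap_val [RHS]/swap_val -!catA !cat_cons R1.
  rewrite {1}/swap_val -!addrA; congr (_ + _).
  rewrite /insert_br -/x -/y; under [in LHS]eq_bigr => k _ do
    rewrite -?catA ?cat_cons.
  under [X in _ + X = _]eq_bigr => k _ do
    rewrite L2 /swap_val scalerDr -?catA ?cat_cons -/y /insert_br scaler_sumr.
  under [X in _ = _ + X]eq_bigr => k _ do
    rewrite -?catA ?cat_cons R2 /swap_val scalerDr -/x /insert_br scaler_sumr.
  rewrite !big_split /= addrCA; congr (_ + (_ + _)).
  rewrite exchange_big; apply: eq_bigr => k _; apply: eq_bigr => l _.
  by rewrite !scalerA mulrC -?catA ?cat_cons.
Qed.
End Diamond.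

(** [straighten] reduces at the first descent of a word. Induction on the measure and [diamond] show
    that any other descent could have been chosen. *)
Lemma straighten_swap u v (a c : I) : (c < a)%N ->
  straighten (u ++ a :: c :: v) = swap_val straighten u v a c.
Proof.
have [N] := ubnP (meas (u ++ a :: c :: v)).
elim: N u v a c => [//|N IHN] u v a c; rewrite ltnS => wN ca.
have IH u1 v1 (a1 c1 : I) :
    (meas (u1 ++ a1 :: c1 :: v1) < meas (u ++ a :: c :: v))%N -> (c1 < a1)%N ->
    straighten (u1 ++ a1 :: c1 :: v1) = swap_val straighten u1 v1 a1 c1.
  by move=> h; apply: IHN; apply: leq_trans h wN.
case E : (descent (u ++ a :: c :: v)) => [[[[u' a'] c'] v']|]; last first.
  by have := descent_some ca E.
have [Ew ca'] := descentP E; rewrite (straighten_descent E).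
case: (ltngtP (size u) (size u')) => [ss|ss|ss].
- by apply/esym/(diamond IH _ Ew ss).
- exact: (diamond IH Ew _ ss).
move/eqP: Ew; rewrite eqseq_cat // => /andP [/eqP <- /eqP [<- <- <-]] //.
Qed.

Lemma straighten_straight u v : straight straighten u v.
Proof.
move=> i j; case: (ltngtP i j) => [ij|ji|/val_inj ->].
- rewrite (straighten_swap _ _ ij) /swap_val (lie_anti b`_i).
  by rewrite (linN (insert_br_lin _ _ _)) addrK.
- exact: straighten_swap.
by rewrite lie_alt (lin0 (insert_br_lin _ _ _)) addr0.
Qed.

(* Right insertion makes the functions satisfying the straightening relations
   into a representation of g, on which formal terms therefore act. *)
Fixpoint act (t : aterm g) F : seq I -> g :=
  match t with
  | AGen x => fun w => insert_br F w [::] x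
  | AZero => fun=> 0
  | AOne => F
  | AOpp s => fun w => - act s F w
  | AAdd s s' => fun w => act s F w + act s' F w
  | AScale k s => fun w => k *: act s F w
  | AMul s s' => act s (act s' F)
  end.

Definition good F := forall u v, straight F u v.

(** Letters are inserted at the right end of a word, which does not interfere with the relation at
    the place between u and v. *)
Lemma act_good t F : good F -> good (act t F).
Proof.
elim: t F => //= [x|F gF|s IH F gF|s IH s' IH' F gF|k s IH F gF|s IH s' IH' F gF].
- move=> F gF u v i j.
  have E k : F ((u ++ i :: j :: v) ++ [:: k]) = F ((u ++ j :: i :: v) ++ [:: k]) +
     insert_br F u (v ++ [:: k]) (lie_br b`_i b`_j).
    by rewrite -!catA /= gF.
  rewrite /insert_br; under eq_bigr do rewrite E scalerDr.
  rewrite big_split; congr (_ + _); rewrite /insert_br.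
  under eq_bigr do rewrite scaler_sumr; rewrite exchange_big.
  apply: eq_bigr => k _; rewrite scaler_sumr; apply: eq_bigr => l _.
  by rewrite !scalerA mulrC -catA.
- by move=> u v i j; rewrite /insert_br big1 ?addr0 // => k _; rewrite scaler0.
- move=> u v i j; rewrite IH // opprD; congr (_ + _).
  rewrite /insert_br -sumrN; apply: eq_bigr => k _; by rewrite scalerN.
- move=> u v i j; rewrite IH // IH' // addrACA; congr (_ + _).
  by rewrite /insert_br -big_split; apply: eq_bigr => l _; rewrite scalerDr.
- move=> u v i j; rewrite IH // scalerDr; congr (_ + _).
  rewrite /insert_br scaler_sumr; apply: eq_bigr => l _.
  by rewrite !scalerA mulrC.
- by apply: IH; apply: IH'.
Qed.

Lemma act_lin t k F F' w :
  act t (fun w => k *: F w + F' w) w = k *: act t F w + act t F' w.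
Proof.
elim: t F F' w => //= [x F F' w|F F' w|s IH F F' w|s IH s' IH' F F' w|c s IH F F' w|
   s IH s' IH' F F' w].
- rewrite /insert_br scaler_sumr -big_split; apply: eq_bigr => i _.
  by rewrite scalerDr !scalerA mulrC.
- by rewrite scaler0 addr0.
- by rewrite IH opprD scalerN.
- by rewrite IH IH' scalerDr addrACA.
- by rewrite IH scalerDr !scalerA mulrC.
- rewrite -IH; congr (act s _ w); apply/funext => w'; exact: IH'.
Qed.

Lemma act_cong s t : acong (@lie_rel K g) s t -> forall F, good F -> act s F = act t F.
Proof.
elim=> {s t} /=.
- by [].
- by move=> s t _ IH F gF; rewrite IH.
- by move=> s t r _ IH _ IH' F gF; rewrite IH // IH'.
- by move=> s t _ IH F gF; rewrite IH.
- by move=> s t s' t' _ IH _ IH' F gF; rewrite IH // IH'.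
- by move=> k s t _ IH F gF; rewrite IH.
- move=> s t s' t' _ IH _ IH' F gF; rewrite IH' // IH //; exact: act_good.
- by move=> s t r F gF; apply/funext => w; rewrite addrA.
- by move=> s t F gF; apply/funext => w; rewrite addrC.
- by move=> s F gF; apply/funext => w; rewrite add0r.
- by move=> s F gF; apply/funext => w; rewrite addNr.
- by move=> k l s F gF; apply/funext => w; rewrite scalerA.
- by move=> s F gF; apply/funext => w; rewrite scale1r.
- by move=> k s t F gF; apply/funext => w; rewrite scalerDr.
- by move=> s k l F gF; apply/funext => w; rewrite scalerDl.
- by [].
- by [].
- by [].
- by [].
- by move=> k s t r F gF; apply/funext => w; rewrite act_lin.
- by move=> k x y F gF; apply/funext => w; rewrite insert_br_lin.
move=> s t [x y] F gF; apply/funext => w /=.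
have E x' y' : insert_br (fun w => insert_br F w [::] x') w [::] y' =
     insert_br2 F w [::] y' x' by [].
by rewrite !E (straight2 _ _ (gF w [::])).
Qed.

(* The part of an element of U(g) lying in g. As this is a left inverse of
   g -> U(g), that map is injective. *)
Definition Ugen_coef (u : UH g) : g :=
  act (prep u) straighten [::].

Lemma Ugen_coef_cl t :
  Ugen_coef (pcl (@ac_refl K g _) (@ac_sym K g _) (@ac_trans K g _) t) =
  act t straighten [::].
Proof.
rewrite /Ugen_coef; congr (_ [::]); apply: act_cong; last exact: straighten_straight.
by apply/(pclP (@ac_refl K g _) (@ac_sym K g _) (@ac_trans K g _)); rewrite prepK.
Qed.
Lemma Ugen_coef_lin : linear Ugen_coef.
Proof.
move=> k x y; rewrite -[k *: x + y]/(pcl _ _ _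
  (AAdd (prep (pcl _ _ _ (AScale k (prep x)))) (prep y))).
by rewrite Ugen_coef_cl /= -[act _ _ _]/(Ugen_coef (pcl _ _ _ _)) Ugen_coef_cl.
Qed.
Lemma Ugen_coef1 : Ugen_coef aone = 0.
Proof. exact: (Ugen_coef_cl AOne). Qed.
Lemma Ugen_coef_gen x : Ugen_coef (Ugen x) = x.
Proof.
rewrite [RHS]basis_dec; exact: (Ugen_coef_cl (AGen x)).
Qed.

End WeakPBW.

(** * Subalgebras *)

Section SubAlgebra.
Variables (K : fieldType) (V : lmodType K) (mul : V -> V -> V) (one : V).
Variable P : V -> Prop.

(** The laws are asked on P alone because the ambient product need not satisfy them: for [dot] on R,
    the pseudoidentity is a right unit on [rconst] only. *)
Record subalg_axioms : Prop := SubalgAxioms {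
  subalg_sub : subspace P;
  subalg_linl : forall y, linear (mul^~ y);
  subalg_linr : forall x, linear (mul x);
  subalg_one : P one;
  subalg_mul : forall x y, P x -> P y -> P (mul x y);
  subalg_assoc : forall x y z, P x -> P y -> P z ->
    mul x (mul y z) = mul (mul x y) z;
  subalg_one_l : forall x, P x -> mul one x = x;
  subalg_one_r : forall x, P x -> mul x one = x
}.

Variable ax : subalg_axioms.
Definition subalg_pred : {pred V} := fun v => `[< P v >].
Fact subalg_submod : submod_closed subalg_pred.
Proof.
split; first by apply/asboolP; apply: sub0 (subalg_sub ax).
by move=> k x y /asboolP Px /asboolP Py; apply/asboolP/(subalg_sub ax).2.
Qed.

Definition subalg (_ : subalg_axioms) := {v : V | subalg_pred v}.
Local Notation A := (subalg ax).
HB.instance Definition _ := SubChoice.on A.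
#[local] HB.instance Definition _ :=
  GRing.isSubmodClosed.Build K V subalg_pred subalg_submod.
HB.instance Definition _ := [SubChoice_isSubLmodule of A by <:].
Definition subalg_val (a : A) : V := val a.
Definition Subalg (v : V) (Pv : P v) : A := exist _ v (asboolT Pv).
Lemma subalg_val_inj : injective subalg_val. Proof. exact: val_inj. Qed.
Lemma subalg_valP a : P (subalg_val a). Proof. exact/asboolP/(valP a). Qed.
Lemma subalg_val_lin : linear subalg_val. Proof. exact: linearP. Qed.

Definition subalg_mulf (a b : A) : A :=
  Subalg (subalg_mul ax (subalg_valP a) (subalg_valP b)).
Definition subalg_onef : A := Subalg (subalg_one ax).
Fact subalg_mulA : associative subalg_mulf.
Proof.
move=> a b c; apply: subalg_val_inj.
by apply: (subalg_assoc ax); apply: subalg_valP.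
Qed.
Fact subalg_mul1 : left_id subalg_onef subalg_mulf.
Proof.
by move=> a; apply: subalg_val_inj; apply: (subalg_one_l ax); apply: subalg_valP.
Qed.
Fact subalg_mulr1 : right_id subalg_onef subalg_mulf.
Proof.
by move=> a; apply: subalg_val_inj; apply: (subalg_one_r ax); apply: subalg_valP.
Qed.
Fact subalg_mul_linl y : linear (subalg_mulf^~ y).
Proof.
move=> k u v; apply: subalg_val_inj; rewrite subalg_val_lin /=.
by rewrite {1}/subalg_val /= subalg_val_lin (subalg_linl ax).
Qed.
Fact subalg_mul_linr x : linear (subalg_mulf x).
Proof.
move=> k u v; apply: subalg_val_inj; rewrite subalg_val_lin /=.
by rewrite {1}/subalg_val /= subalg_val_lin (subalg_linr ax).
Qed.
HB.instance Definition _ := Lmodule_isPzAlgebra.Build K A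
  subalg_mulA subalg_mul1 subalg_mulr1 subalg_mul_linl subalg_mul_linr.
End SubAlgebra.

(** * Tensor products over U(g) *)

(** The unit is generalized to an arbitrary right factor in P; then a product of two elements acts
    by two successive left multiplications. *)
Lemma palg_ind_left (K : fieldType) (V : lmodType K) rel (P : @palg K V rel -> Prop) :
  P aone -> subspace P -> (forall v u, P u -> P (pgen rel v ** u)) -> forall u, P u.
Proof.
move=> P1 sP Pg u; rewrite -[u]amula1; move: aone P1.
elim/palg_ind: u => [x|||x y IHx IHy|k x IHx|x y IHx IHy] u Pu.
- exact: Pg.
- by rewrite amul1a.
- by rewrite amul0l; apply: sub0.
- by rewrite amulDl; apply: subD => //; [exact: IHx|exact: IHy].
- by rewrite amulZl; apply: subZ => //; exact: IHx.
- by rewrite -amulA; apply: IHx; apply: IHy.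
Qed.

Section EnvelopingFacts.
Variables (K : fieldType) (g : lieAlg K).
Local Notation H := (UH g).

Lemma U_ind_left (P : H -> Prop) : P aone -> subspace P ->
  (forall (x : g) u, P u -> P (Ugen x ** u)) -> forall u, P u.
Proof. exact: palg_ind_left. Qed.

Lemma U_ind_right (P : H -> Prop) : P aone -> subspace P ->
  (forall (x : g) u, P u -> P (u ** Ugen x)) -> forall u, P u.
Proof.
move=> P1 sP Pg u; rewrite -[u](@amul1a K H); move: (aone : H) P1.
elim/palg_ind: u => [x|||x y IHx IHy|k x IHx|x y IHx IHy] u Pu.
- exact: Pg.
- by rewrite -[pA in u ** pA]/(aone : H) amula1.
- by rewrite -[pA in u ** pA]/(0 : H) amul0r; apply: sub0.
- by rewrite (@amulDr K H); apply: subD; [|exact: IHx|exact: IHy].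
- by rewrite (@amulZr K H); apply: subZ; [|exact: IHx].
- by rewrite (@amulA K H); apply: IHy; apply: IHx.
Qed.

Lemma UHS_M (x y : H) : hS (x ** y) = hS y ** hS x.
Proof. exact: U_SM. Qed.
Lemma UHS_1 : hS (aone : H) = aone.
Proof. exact: U_S1. Qed.
Lemma UHS_gen (x : g) : hS (Ugen x : H) = - Ugen x.
Proof. exact: U_S_gen. Qed.
Lemma UHD_gen (x : g) : hD (Ugen x : H) = Ugen x \ox aone + aone \ox Ugen x.
Proof. exact: U_D_gen. Qed.
Lemma UHeps_gen (x : g) : heps (Ugen x : H) = 0.
Proof. exact: U_eps_gen. Qed.

Lemma hD_lin (h : hopf K) : linear (@hD K h).
Proof. by case: (hD_hom h). Qed.
Lemma hD1 (h : hopf K) : hD (aone : h) = aone \ox aone.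
Proof. by case: (hD_hom h). Qed.
Lemma hDM (h : hopf K) (x y : h) : hD (x ** y) = (hD x : tens h h) ** hD y.
Proof. by case: (hD_hom h). Qed.
Lemma heps_lin (h : hopf K) : linear (@heps K h).
Proof. by case: (heps_hom h). Qed.
Lemma heps1 (h : hopf K) : heps (aone : h) = 1.
Proof. by case: (heps_hom h). Qed.
Lemma hepsM (h : hopf K) (x y : h) : heps (x ** y) = (heps x : K) * heps y.
Proof. by case: (heps_hom h). Qed.

Lemma UHeps_S (h : H) : heps (hS h) = heps h.
Proof.
elim/U_ind_left: h => [||x u IH]; first by rewrite UHS_1.
  split; first by rewrite (lin0 (@hS_lin _ _)).
  by move=> k x y Ex Ey; rewrite (@hS_lin K H) !(@heps_lin H) Ex Ey.
by rewrite UHS_M !hepsM UHS_gen IH (linN (@heps_lin H)) UHeps_gen oppr0 mulrC.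
Qed.

Definition tswap (V W : lmodType K) : tens V W -> tens W V :=
  tenslift (fun v w => w \ox v).
Lemma tswap_bilin (V W : lmodType K) : bilin (fun (v : V) (w : W) => w \ox v).
Proof. by split=> z; [exact: tpure_linr | exact: tpure_linl]. Qed.
Lemma tswapE (V W : lmodType K) (v : V) (w : W) : tswap (v \ox w) = w \ox v.
Proof. by rewrite /tswap tensliftE //; apply: tswap_bilin. Qed.
Lemma tswap_lin (V W : lmodType K) : linear (@tswap V W).
Proof. by apply: tenslift_lin; apply: tswap_bilin. Qed.
Lemma tswap_hom (A B : pzAlgType K) : alg_hom (@tswap A B).
Proof.
split; [exact: tswap_lin | by rewrite !toneE tswapE |move=> t u].
move: t; apply: tens_ext => [||a b].
- exact: (lin_comp (amul_linl u) (@tswap_lin _ _)).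
- exact: (lin_comp (@tswap_lin _ _) (amul_linl _)).
move: u; apply: tens_ext => [||a' b'].
- exact: (lin_comp (amul_linr _) (@tswap_lin _ _)).
- exact: (lin_comp (@tswap_lin _ _) (amul_linr _)).
by rewrite !(tmulE, tswapE).
Qed.

Lemma UH_cocomm (h : H) : tswap (hD h) = hD h.
Proof.
move: h; apply: U_ext => [||x].
- exact: (hom_comp (hD_hom H) (@tswap_hom H H)).
- exact: (hD_hom H).
by rewrite UHD_gen (linD (@tswap_lin _ _)) !tswapE addrC.
Qed.

End EnvelopingFacts.

Section HHtFacts.
Variables (K : fieldType) (g : lieAlg K).
Local Notation H := (UH g).
Variable M : hmodule H.

(** Delta is multiplicative and U(g) is generated by g, so balancing over H reduces to elements of
    g, for which Delta has two terms. *)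
Lemma HHbal_gen (Q : lmodType K) (f : tens H H -> M -> Q) :
  (forall m, linear (f^~ m)) -> (forall t, linear (f t)) ->
  (forall (x : g) t m, f (t ** (Ugen x \ox aone)) m + f (t ** (aone \ox Ugen x)) m =
     f t (hact (Ugen x : H) m)) -> HHbal f.
Proof.
move=> fl fr fg; split=> // h; elim/U_ind_left: h => [||x u IH].
- by move=> t m; rewrite hact1 hD1 amula1.
- split=> [t m|k x y Ex Ey t m].
    by rewrite (lin0 (@hD_lin K H)) amul0r (lin0 (fl _)) (lin0 (hact_linl _))
      (lin0 (fr _)).
  by rewrite (@hD_lin K H) amul_linr fl Ex Ey hact_linl fr.
move=> t m; rewrite hDM amulA IH hactM -fg UHD_gen amulDr.
by rewrite (linD (fl _)).
Qed.

Lemma hD3_gen (x : g) : hD3 (Ugen x : H) =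
  ((Ugen x \ox aone) \ox aone + (aone \ox Ugen x) \ox aone) +
  (aone \ox aone) \ox Ugen x.
Proof.
rewrite /hD3 UHD_gen (linD (tmap_lin (@hD_lin K H) (@lin_id _ _))).
rewrite !tmapE //; try exact: hD_lin.
by rewrite UHD_gen hD1 (linD (tpure_linl _)).
Qed.

Definition HHHbal (Q : lmodType K) (f : tens (tens H H) H -> M -> Q) :=
  [/\ forall m, linear (f^~ m), forall t, linear (f t)
    & forall h t m, f (t ** hD3 h) m = f t (hact h m)].
Definition HHHlift (Q : lmodType K) (f : tens (tens H H) H -> M -> Q)
  (u : HHHt M) : Q := tlift f u.
Lemma HHHliftE (Q : lmodType K) (f : tens (tens H H) H -> M -> Q) t m :
  HHHbal f -> HHHlift f (hpure3 t m) = f t m.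
Proof. exact: tliftE. Qed.
Lemma HHHlift_lin (Q : lmodType K) (f : tens (tens H H) H -> M -> Q) :
  HHHbal f -> linear (HHHlift f).
Proof. exact: tlift_lin. Qed.

Lemma hD3_hom : alg_hom (@hD3 K H).
Proof. exact: (hom_comp (hD_hom H) (tmap_hom (hD_hom H) (hom_id H))). Qed.

Lemma HHHbal_gen (Q : lmodType K) (f : tens (tens H H) H -> M -> Q) :
  (forall m, linear (f^~ m)) -> (forall t, linear (f t)) ->
  (forall (x : g) t m, f (t ** ((Ugen x \ox aone) \ox aone)) m +
     f (t ** ((aone \ox Ugen x) \ox aone)) m +
     f (t ** ((aone \ox aone) \ox Ugen x)) m =
     f t (hact (Ugen x : H) m)) -> HHHbal f.
Proof.
have [l3 l31 l3M] := hD3_hom.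
move=> fl fr fg; split=> // h; elim/U_ind_left: h => [||x u IH].
- by move=> t m; rewrite hact1 l31 amula1.
- split=> [t m|k x y Ex Ey t m].
    by rewrite (lin0 l3) amul0r (lin0 (fl _)) (lin0 (hact_linl _))
      (lin0 (fr _)).
  by rewrite l3 amul_linr fl Ex Ey hact_linl fr.
move=> t m; rewrite l3M amulA IH hactM -fg hD3_gen !amulDr.
by rewrite !(linD (fl _)).
Qed.

(* (H (x) H) (x)_H M = H (x) M, via the elements (f (x) 1) (x)_H m. *)
Definition jmap (t : tens H M) : HHt M :=
  tenslift (fun f m => (f \ox aone) \oxH m) t.
Lemma jmap_bilin : bilin (fun (f : H) (m : M) => (f \ox aone) \oxH m).
Proof.
split=> [m|f]; last exact: hpure_linr.
exact: (lin_comp (tpure_linl aone) (hpure_linl m)).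
Qed.
Lemma jmap_lin : linear jmap.
Proof. exact: tenslift_lin jmap_bilin. Qed.
Lemma jmapE f m : jmap (f \ox m) = (f \ox aone) \oxH m.
Proof. exact: tensliftE jmap_bilin. Qed.

(** Induction on the second leg: for x in g, [f \ox cx] equals [(f \ox c)] Delta(x) minus
    [fx \ox c], and Delta(x) passes over to the module. *)
Lemma jmap_surj u : exists t, u = jmap t.
Proof.
suff L : forall (c : H) (f : H) m, exists t, (f \ox c) \oxH m = jmap t.
  elim/btens_ind: u => [t m||u v [t ->] [t' ->]].
  - rewrite -/(hpure t m); elim/tens_ind: t => [f c||t t' [u E] [u' E']].
    + exact: L.
    + by exists 0; rewrite (lin0 (hpure_linl _)) (lin0 jmap_lin).
    + by exists (u + u'); rewrite (linD (hpure_linl _)) (linD jmap_lin) E E'.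
  - by exists 0; rewrite (lin0 jmap_lin).
  - by exists (t + t'); rewrite (linD jmap_lin).
elim/U_ind_right => [f m||x c IH f m].
- by exists (f \ox m); rewrite jmapE.
- split=> [f m|k x y IHx IHy f m].
    by exists 0; rewrite (lin0 (tpure_linr _)) (lin0 (hpure_linl _)) (lin0 jmap_lin).
  have [t Et] := IHx f m; have [t' Et'] := IHy f m; exists (k *: t + t').
  by rewrite tpure_linr hpure_linl jmap_lin Et Et'.
have [t Et] := IH f (hact (Ugen x : H) m).
have [t' Et'] := IH (f ** Ugen x) m.
exists (t - t'); rewrite (linB _ _ jmap_lin) -Et -Et' -hpure_bal UHD_gen amulDr.
by rewrite !tmulE !amula1 (linD (hpure_linl _)) addrAC subrr add0r.
Qed.

Definition jmapr (t : tens H M) : HHt M :=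
  tenslift (fun f m => (aone \ox f) \oxH m) t.
Lemma jmapr_bilin : bilin (fun (f : H) (m : M) => (aone \ox f) \oxH m).
Proof.
split=> [m|f]; last exact: hpure_linr.
exact: (lin_comp (tpure_linr aone) (hpure_linl m)).
Qed.
Lemma jmapr_lin : linear jmapr.
Proof. exact: tenslift_lin jmapr_bilin. Qed.
Lemma jmaprE f m : jmapr (f \ox m) = (aone \ox f) \oxH m.
Proof. exact: tensliftE jmapr_bilin. Qed.

Lemma jmapr_surj u : exists t, u = jmapr t.
Proof.
suff L : forall (c : H) (f : H) m, exists t, (c \ox f) \oxH m = jmapr t.
  elim/btens_ind: u => [t m||u v [t ->] [t' ->]].
  - rewrite -/(hpure t m); elim/tens_ind: t => [f c||t t' [u E] [u' E']].
    + exact: L.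
    + by exists 0; rewrite (lin0 (hpure_linl _)) (lin0 jmapr_lin).
    + by exists (u + u'); rewrite (linD (hpure_linl _)) (linD jmapr_lin) E E'.
  - by exists 0; rewrite (lin0 jmapr_lin).
  - by exists (t + t'); rewrite (linD jmapr_lin).
elim/U_ind_right => [f m||x c IH f m].
- by exists (f \ox m); rewrite jmaprE.
- split=> [f m|k x y IHx IHy f m].
    by exists 0; rewrite (lin0 (tpure_linl _)) (lin0 (hpure_linl _)) (lin0 jmapr_lin).
  have [t Et] := IHx f m; have [t' Et'] := IHy f m; exists (k *: t + t').
  by rewrite tpure_linl hpure_linl jmapr_lin Et Et'.
have [t Et] := IH f (hact (Ugen x : H) m).
have [t' Et'] := IH (f ** Ugen x) m.
exists (t - t'); rewrite (linB _ _ jmapr_lin) -Et -Et' -hpure_bal UHD_gen amulDr.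
by rewrite !tmulE !amula1 (linD (hpure_linl _)) addrK.
Qed.

(** The Fourier transform: [f \ox c] equals [(f S(c_1) \ox 1)] Delta(c_2), so the inverse of [jmap]
    has to send the class of [(f \ox c)] with m to [f S(c_1) \ox c_2 m]. *)
Let thf0 (m : M) (f : H) (a b : H) : tens H M := (f ** hS a) \ox hact b m.
Let thf (t : tens H H) (m : M) : tens H M :=
  tenslift (fun f c => tenslift (thf0 m f) (hD c)) t.
Let thf0_bi (m : M) f : bilin (thf0 m f).
Proof.
split=> [b|a].
  exact: (lin_comp (@hS_lin K H) (lin_comp (amul_linr f) (tpure_linl _))).
exact: (lin_comp (hact_linl m) (tpure_linr _)).
Qed.
Let thf_bi m : bilin (fun f c => tenslift (thf0 m f) (hD c)).
Proof.
split=> [c|f]; last exact: (lin_comp (@hD_lin K H) (tenslift_lin (thf0_bi m f))).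
apply: tenslift_par => a b; exact: (lin_comp (amul_linl _) (tpure_linl _)).
Qed.
Let thfE f c m : thf (f \ox c) m = tenslift (thf0 m f) (hD c).
Proof. by rewrite /thf tensliftE. Qed.
Let thf_linr t : linear (thf t).
Proof.
apply: tenslift_par => f c; apply: tenslift_par => a b.
exact: (lin_comp (hact_linr b) (tpure_linr _)).
Qed.
Let thf_bal : HHbal thf.
Proof.
apply: HHbal_gen => [m|t|x t m]; [exact: tenslift_lin|exact: thf_linr|].
have L1 : linear (fun t => thf (t ** (Ugen x \ox aone)) m).
  exact: (lin_comp (amul_linl _) (tenslift_lin (thf_bi m))).
have L2 : linear (fun t => thf (t ** (aone \ox Ugen x)) m).
  exact: (lin_comp (amul_linl _) (tenslift_lin (thf_bi m))).
move: t; apply: tens_ext => [||f c].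
- exact: (lin_add L1 L2).
- exact: tenslift_lin.
rewrite !tmulE !amula1 !thfE hDM UHD_gen amulDr.
rewrite (linD (tenslift_lin (thf0_bi m f))).
have B k := tenslift_lin (thf0_bi m k).
move: (hD c); apply: tens_ext => [||a b].
- apply: lin_add; first exact: B.
  by apply: lin_add; exact: (lin_comp (amul_linl _) (B _)).
- exact: tenslift_lin.
rewrite !tmulE !amula1 !tensliftE // /thf0 UHS_M UHS_gen amulNl amulNr.
by rewrite (linN (tpure_linl _)) amulA addrA subrr add0r hactM.
Qed.
Definition theta : HHt M -> tens H M := HHlift thf.
Lemma theta_lin : linear theta. Proof. exact: HHlift_lin. Qed.
Lemma theta_pure f m : theta ((f \ox aone) \oxH m) = f \ox m.
Proof.
by rewrite /theta HHliftE // thfE hD1 tensliftE // /thf0 UHS_1 amula1 hact1.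
Qed.
Lemma thetaK t : theta (jmap t) = t.
Proof.
move: t; apply: tens_ext => [||f m]; last by rewrite jmapE theta_pure.
  exact: (lin_comp jmap_lin theta_lin).
exact: lin_id.
Qed.
Lemma jmapK u : jmap (theta u) = u.
Proof. by have [t ->] := jmap_surj u; rewrite thetaK. Qed.

(* (f (x) g) (x)_H m |-> eps(f) g m, whose value at a * b is a_1 b. *)
Let prod1f (t : tens H H) (m : M) : M :=
  tenslift (fun f c => (heps f : K) *: hact c m) t.
Let prod1_bi (m : M) : bilin (fun f c : H => (heps f : K) *: hact c m).
Proof.
split=> [c|f]; first exact: (lin_scalel _ (@heps_lin K H)).
exact: (lin_scale _ (hact_linl m)).
Qed.
Let prod1_bal : HHbal prod1f.
Proof.
apply: HHbal_gen => [m|t|x t m]; first exact: tenslift_lin.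
  by apply: tenslift_par => f c; exact: (lin_scale _ (@hact_linr K H M c)).
move: t; apply: tens_ext => [||f c].
- by apply: lin_add; exact: (lin_comp (amul_linl _) (tenslift_lin (prod1_bi m))).
- exact: tenslift_lin.
rewrite !tmulE !amula1 /prod1f !tensliftE // hepsM UHeps_gen mulr0 scale0r add0r.
by rewrite hactM.
Qed.
Definition prod1 : HHt M -> M := HHlift prod1f.
Lemma prod1_lin : linear prod1. Proof. exact: HHlift_lin. Qed.
Lemma prod1E f c m : prod1 ((f \ox c) \oxH m) = (heps f : K) *: hact c m.
Proof. by rewrite /prod1 HHliftE // /prod1f tensliftE. Qed.
Lemma prod1_theta u : prod1 u = ev (@heps K H) (theta u).
Proof.
rewrite -{1}[u]jmapK; move: (theta u); apply: tens_ext => [||f m].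
- exact: (lin_comp jmap_lin prod1_lin).
- exact: (ev_lin (@heps_lin K H)).
by rewrite jmapE prod1E hact1 evE //; apply: heps_lin.
Qed.

End HHtFacts.

Section TripleMaps.
Variables (K : fieldType) (g : lieAlg K).
Local Notation H := (UH g).
Variable M : hmodule H.
Local Notation H3 := (tens (tens H H) H).

(* Linear maps out of (H (x) H (x) H) (x)_H M sending (f (x) c (x) h) (x)_H m
   to, respectively, eps(f) (c (x) h) (x)_H m, eps(c) (f (x) h) (x)_H m,
   f S(c_1) (x) ((c_2 (x) h) (x)_H m) and f S(h_1) (x) c S(h_2) (x) h_3 m. *)
Let m1f (t : H3) (m : M) : HHt M :=
  tenslift (fun fc h => tenslift (fun f c => (heps f : K) *: ((c \ox h) \oxH m)) fc) t.
Let m2f (t : H3) (m : M) : HHt M :=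
  tenslift (fun fc h => tenslift (fun f c => (heps c : K) *: ((f \ox h) \oxH m)) fc) t.
Let p0 (m : M) (h f a b : H) : tens H (HHt M) := (f ** hS a) \ox ((b \ox h) \oxH m).
Let p1 (m : M) (h f c : H) : tens H (HHt M) := tenslift (p0 m h f) (hD c).
Let psif (t : H3) (m : M) : tens H (HHt M) :=
  tenslift (fun fc h => tenslift (p1 m h) fc) t.
Let th0 (m : M) (fc : tens H H) (a b : H) : tens (tens H H) M :=
  (fc ** tmap (@hS K H) (@hS K H) (hD a)) \ox hact b m.
Let th3f (t : H3) (m : M) : tens (tens H H) M :=
  tenslift (fun fc h => tenslift (th0 m fc) (hD h)) t.

Let m1_bi0 (m : M) (h : H) : bilin (fun f c : H => (heps f : K) *: ((c \ox h) \oxH m)).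
Proof.
split=> z; first exact: (lin_scalel _ (@heps_lin K H)).
exact: (lin_scale _ (lin_comp (tpure_linl h) (hpure_linl m))).
Qed.
Let m1_bi (m : M) :
  bilin (fun fc (h : H) => tenslift (fun f c : H => (heps f : K) *: ((c \ox h) \oxH m)) fc).
Proof.
split=> [h|fc]; first exact: tenslift_lin.
apply: tenslift_par => f c.
exact: (lin_scale _ (lin_comp (tpure_linr c) (hpure_linl m))).
Qed.
Let m2_bi0 (m : M) (h : H) : bilin (fun f c : H => (heps c : K) *: ((f \ox h) \oxH m)).
Proof.
split=> z; last exact: (lin_scalel _ (@heps_lin K H)).
exact: (lin_scale _ (lin_comp (tpure_linl h) (hpure_linl m))).
Qed.
Let m2_bi (m : M) :
  bilin (fun fc (h : H) => tenslift (fun f c : H => (heps c : K) *: ((f \ox h) \oxH m)) fc).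
Proof.
split=> [h|fc]; first exact: tenslift_lin.
apply: tenslift_par => f c.
exact: (lin_scale _ (lin_comp (tpure_linr f) (hpure_linl m))).
Qed.
Let p0_bi (m : M) (h f : H) : bilin (p0 m h f).
Proof.
split=> [b|a].
  exact: (lin_comp (@hS_lin K H) (lin_comp (amul_linr f) (tpure_linl _))).
exact: (lin_comp (lin_comp (tpure_linl h) (hpure_linl m)) (tpure_linr _)).
Qed.
Let p1_bi (m : M) (h : H) : bilin (p1 m h).
Proof.
split=> [c|f]; last exact: (lin_comp (@hD_lin K H) (tenslift_lin (p0_bi m h f))).
by apply: tenslift_par => a b; apply: (lin_comp (amul_linl _) (tpure_linl _)).
Qed.
Let psi_bi (m : M) : bilin (fun fc (h : H) => tenslift (p1 m h) fc).
Proof.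
split=> [h|fc]; first exact: tenslift_lin.
apply: tenslift_par => f c; apply: tenslift_par => a b.
exact: (lin_comp (lin_comp (tpure_linr b) (hpure_linl m)) (tpure_linr _)).
Qed.
Let SS := tmap (@hS K H) (@hS K H).
Let SS_lin : linear SS.
Proof. exact: (tmap_lin (@hS_lin K H) (@hS_lin K H)). Qed.
Let th0_bi (m : M) fc : bilin (th0 m fc).
Proof.
split=> [b|a]; last exact: (lin_comp (hact_linl m) (tpure_linr _)).
exact: (lin_comp (lin_comp (@hD_lin K H) SS_lin)
   (lin_comp (amul_linr fc) (tpure_linl _))).
Qed.
Let th3_bi (m : M) : bilin (fun fc (h : H) => tenslift (th0 m fc) (hD h)).
Proof.
split=> [h|fc]; last exact: (lin_comp (@hD_lin K H) (tenslift_lin (th0_bi m fc))).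
by apply: tenslift_par => a b; apply: (lin_comp (amul_linl _) (tpure_linl _)).
Qed.

Let m1fE f c h m : m1f ((f \ox c) \ox h) m = (heps f : K) *: ((c \ox h) \oxH m).
Proof. by rewrite /m1f !tensliftE. Qed.
Let m2fE f c h m : m2f ((f \ox c) \ox h) m = (heps c : K) *: ((f \ox h) \oxH m).
Proof. by rewrite /m2f !tensliftE. Qed.
Let psifE f c h m : psif ((f \ox c) \ox h) m = tenslift (p0 m h f) (hD c).
Proof. by rewrite /psif !tensliftE. Qed.
Let th3fE fc h m : th3f (fc \ox h) m = tenslift (th0 m fc) (hD h).
Proof. by rewrite /th3f !tensliftE. Qed.

Let H3_ext (Q : lmodType K) (F G : H3 -> Q) : linear F -> linear G ->
  (forall f c h, F ((f \ox c) \ox h) = G ((f \ox c) \ox h)) -> forall t, F t = G t.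
Proof.
move=> lF lG E; apply: tens_ext => // fc h; move: fc; apply: tens_ext => // .
  exact: (lin_comp (tpure_linl h) lF).
exact: (lin_comp (tpure_linl h) lG).
Qed.

Let bal_gen (Q : lmodType K) (F : H3 -> M -> Q) :
  (forall m, linear (F^~ m)) -> (forall t, linear (F t)) ->
  (forall (x : g) f c h m, F ((f ** Ugen x \ox c) \ox h) m +
     F ((f \ox (c ** Ugen x)) \ox h) m + F ((f \ox c) \ox (h ** Ugen x)) m =
     F ((f \ox c) \ox h) (hact (Ugen x : H) m)) -> HHHbal F.
Proof.
move=> Fl Fr E; apply: HHHbal_gen => // x t m.
move: t; apply: H3_ext => [||f c h].
- by apply: lin_add; [apply: lin_add|]; exact: (lin_comp (amul_linl _) (Fl m)).
- exact: Fl.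
by rewrite !tmulE !amula1 E.
Qed.

Let m1_bal : HHHbal m1f.
Proof.
apply: bal_gen => [m|t|x f c h m]; first exact: tenslift_lin.
  apply: tenslift_par => fc h; apply: tenslift_par => f c.
  exact: (lin_scale _ (@hpure_linr K H M _)).
rewrite !m1fE hepsM UHeps_gen mulr0 scale0r add0r -scalerDr; congr (_ *: _).
by rewrite -hpure_bal UHD_gen amulDr !tmulE !amula1 (linD (hpure_linl _)).
Qed.
Let m2_bal : HHHbal m2f.
Proof.
apply: bal_gen => [m|t|x f c h m]; first exact: tenslift_lin.
  apply: tenslift_par => fc h; apply: tenslift_par => f c.
  exact: (lin_scale _ (@hpure_linr K H M _)).
rewrite !m2fE hepsM UHeps_gen mulr0 scale0r addr0 -scalerDr; congr (_ *: _).
by rewrite -hpure_bal UHD_gen amulDr !tmulE !amula1 (linD (hpure_linl _)).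
Qed.
Let psi_bal : HHHbal psif.
Proof.
apply: bal_gen => [m|t|x f c h m]; first exact: tenslift_lin.
  apply: tenslift_par => fc h; apply: tenslift_par => f c.
  apply: tenslift_par => a b.
  exact: (lin_comp (@hpure_linr K H M _) (tpure_linr _)).
rewrite !psifE hDM UHD_gen amulDr (linD (tenslift_lin (p0_bi m h f))).
have B m' h' f' := tenslift_lin (p0_bi m' h' f').
move: (hD c); apply: tens_ext => [||a b].
- apply: lin_add; last exact: B.
  apply: lin_add; first exact: B.
  by apply: lin_add; exact: (lin_comp (amul_linl _) (B _ _ _)).
- exact: B.
rewrite !tmulE !amula1 !tensliftE // /p0 UHS_M UHS_gen amulNl amulNr.
rewrite (linN (tpure_linl _)) amulA addrA subrr add0r -(linD (tpure_linr _)).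
rewrite -hpure_bal UHD_gen amulDr !tmulE !amula1 (linD (hpure_linl _)) //.
Qed.
Let SS_anti (x : g) (t : tens H H) :
  SS (t ** (Ugen x \ox aone + aone \ox Ugen x)) =
  - ((Ugen x \ox aone + aone \ox Ugen x : tens H H) ** SS t).
Proof.
move: t; apply: tens_ext => [||a b].
- exact: (lin_comp (amul_linl _) SS_lin).
- exact: (lin_opp (lin_comp SS_lin (amul_linr _))).
rewrite amulDr !tmulE (linD SS_lin) /SS !tmapE; try exact: hS_lin.
rewrite amulDl !tmulE !amul1a !UHS_M !UHS_1 !UHS_gen !amul1a !amulNl.
by rewrite (linN (tpure_linl _)) (linN (tpure_linr _)) opprD.
Qed.
Let th3_bal : HHHbal th3f.
Proof.
apply: bal_gen => [m|t|x f c h m]; first exact: tenslift_lin.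
  apply: tenslift_par => fc h; apply: tenslift_par => a b.
  exact: (lin_comp (hact_linr b) (tpure_linr _)).
rewrite !th3fE hDM UHD_gen amulDr (linD (tenslift_lin (th0_bi m _))).
have B m' fc := tenslift_lin (th0_bi m' fc).
move: (hD h); apply: tens_ext => [||a b].
- apply: lin_add; first by apply: lin_add; exact: B.
  by apply: lin_add; exact: (lin_comp (amul_linl _) (B _ _)).
- exact: B.
rewrite !tmulE !amula1 !tensliftE // /th0 hDM UHD_gen -/SS SS_anti.
rewrite amulNr (linN (tpure_linl _)) amulA amulDr !tmulE !amula1.
rewrite -(linD (tpure_linl _)) -amulDl addrA subrr add0r hactM //.
Qed.

Definition counit1 : HHHt M -> HHt M := HHHlift m1f.
Definition counit2 : HHHt M -> HHt M := HHHlift m2f.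
Definition theta1 : HHHt M -> tens H (HHt M) := HHHlift psif.
Definition theta3 : HHHt M -> tens (tens H H) M := HHHlift th3f.
Lemma counit1_lin : linear counit1. Proof. exact: HHHlift_lin. Qed.
Lemma counit2_lin : linear counit2. Proof. exact: HHHlift_lin. Qed.
Lemma theta1_lin : linear theta1. Proof. exact: HHHlift_lin. Qed.
Lemma theta3_lin : linear theta3. Proof. exact: HHHlift_lin. Qed.
Lemma counit1E f c h (m : M) :
  counit1 (hpure3 ((f \ox c) \ox h) m) = (heps f : K) *: ((c \ox h) \oxH m).
Proof. by rewrite /counit1 HHHliftE. Qed.
Lemma counit2E f c h (m : M) :
  counit2 (hpure3 ((f \ox c) \ox h) m) = (heps c : K) *: ((f \ox h) \oxH m).
Proof. by rewrite /counit2 HHHliftE. Qed.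
Lemma theta1E f h (m : M) :
  theta1 (hpure3 ((f \ox aone) \ox h) m) = f \ox ((aone \ox h) \oxH m).
Proof.
by rewrite /theta1 HHHliftE // psifE hD1 tensliftE // /p0 UHS_1 amula1.
Qed.
Lemma theta3E fc (m : M) : theta3 (hpure3 (fc \ox aone) m) = fc \ox m.
Proof.
rewrite /theta3 HHHliftE // th3fE hD1 tensliftE // /th0 hD1 tmapE; try exact: hS_lin.
by rewrite !UHS_1 hact1 -toneE amula1.
Qed.
End TripleMaps.

(** * The associativity law under the four maps *)

Section Products.
Variables (K : fieldType) (g : lieAlg K).
Local Notation H := (UH g).
Variable R : pseudo H.
Implicit Types a b d e r s : R.

Let DL : alg_hom (tmap (@hD K H) (@id H)) := tmap_hom (@hD_hom K H) (hom_id H).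
Let DR : alg_hom (fun t : tens H H => tassoc (tmap (@id H) (@hD K H) t)) :=
  hom_comp (tmap_hom (hom_id H) (@hD_hom K H)) (@tassoc_hom K H H H).
Let hDl := @hD_lin K H.

Definition ext_l (c : tens H H) : HHt R -> HHHt R :=
  HHlift (fun t m => hpure3 ((c \ox aone) ** tmap (@hD K H) id t) m).
Definition ext_r (c : tens H H) : HHt R -> HHHt R :=
  HHlift (fun t m =>
    hpure3 (tassoc (aone \ox c) ** tassoc (tmap id (@hD K H) t)) m).

Let ext_l_bal (c : tens H H) : HHbal (fun t (m : R) =>
  hpure3 ((c \ox aone) ** tmap (@hD K H) id t) m).
Proof.
have [Dl _ DM] := DL; split=> [m|t|h t m].
- exact: (lin_comp Dl (lin_comp (amul_linr (c \ox aone)) (hpure3_linl m))).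
- exact: hpure3_linr.
- by rewrite DM amulA hpure3_bal.
Qed.
Let ext_r_bal (c : tens H H) : HHbal (fun t (m : R) =>
  hpure3 (tassoc (aone \ox c) ** tassoc (tmap id (@hD K H) t)) m).
Proof.
have [Dl _ DM] := DR; split=> [m|t|h t m].
- exact: (lin_comp Dl (lin_comp (amul_linr _) (hpure3_linl m))).
- exact: hpure3_linr.
- by rewrite DM amulA -hD_assoc hpure3_bal.
Qed.
Lemma ext_l_lin c : linear (ext_l c). Proof. exact: HHlift_lin. Qed.
Lemma ext_r_lin c : linear (ext_r c). Proof. exact: HHlift_lin. Qed.
Lemma ext_lE c t (m : R) :
  ext_l c (t \oxH m) = hpure3 ((c \ox aone) ** tmap (@hD K H) id t) m.
Proof. exact: HHliftE. Qed.
Lemma ext_rE c t (m : R) : ext_r c (t \oxH m) =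
  hpure3 (tassoc (aone \ox c) ** tassoc (tmap id (@hD K H) t)) m.
Proof. exact: HHliftE. Qed.

Lemma pmul_ext_l_lin e : linear (fun u : HHt R => pmul_ext_l u e).
Proof.
have [Dl D1 DM] := DL; apply: HHlift_lin; split=> [m|t|h t m].
- apply: HHlift_par => t n.
  exact: (lin_comp (tpure_linl aone)
    (lin_comp (amul_linl (tmap (@hD K H) id t)) (hpure3_linl n))).
- exact: (lin_comp (pmul_linl e) (ext_l_lin t)).
rewrite pmulHl -!/(ext_l _ _); move: (pmul m e); apply: HHt_ext => [||s n].
- exact: ext_l_lin.
- exact: (lin_comp (hhact_linr _) (ext_l_lin _)).
rewrite hhactE !ext_lE; congr hpure3.
by rewrite DM tmapE // amulA tmulE amul1a.
Qed.

Lemma pmul_ext_r_lin a : linear (fun u : HHt R => pmul_ext_r a u).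
Proof.
have [Dl D1 DM] := DR; have [al a1 aM] := @tassoc_hom K H H H.
apply: HHlift_lin; split=> [m|t|h t m].
- apply: HHlift_par => t n.
  exact: (lin_comp (lin_comp (tpure_linr aone) al)
    (lin_comp (amul_linl (tassoc (tmap id (@hD K H) t))) (hpure3_linl n))).
- exact: (lin_comp (pmul_linr a) (ext_r_lin t)).
rewrite pmulHr -!/(ext_r _ _); move: (pmul a m); apply: HHt_ext => [||s n].
- exact: ext_r_lin.
- exact: (lin_comp (hhact_linr _) (ext_r_lin _)).
rewrite hhactE !ext_rE; congr hpure3.
by rewrite DM tmapE // amulA -(aM (aone \ox t)) tmulE amul1a.
Qed.

(* Both sides of the associativity law on elements of the form
   (f (x) 1) (x)_H d, with the inner product in left or right normal form. *)
Lemma pmul_ext_lE1 f d e t : pmul d e = jmapr t ->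
  pmul_ext_l ((f \ox aone) \oxH d) e =
  tenslift (fun h m => hpure3 ((f \ox aone) \ox h) m) t.
Proof.
have [Dl D1 DM] := DL.
move=> E; rewrite pmul_ext_lE E -/(ext_l _ _); move: t {E}.
apply: tens_ext => [||h m].
- exact: (lin_comp (@jmapr_lin _ _ _) (ext_l_lin _)).
- apply: tenslift_lin; split=> z; last exact: hpure3_linr.
  exact: (lin_comp (tpure_linr _) (hpure3_linl z)).
rewrite jmaprE ext_lE tensliftE; last first.
  split=> z; last exact: hpure3_linr.
  exact: (lin_comp (tpure_linr _) (hpure3_linl z)).
by rewrite tmapE // hD1 tmulE amul1a -toneE amula1.
Qed.

Lemma pmul_ext_rE1 a f d t : pmul a d = jmap t ->
  pmul_ext_r a ((f \ox aone) \oxH d) =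
  tenslift (fun k m => hpure3 ((k \ox f) \ox aone) m) t.
Proof.
have [Dl D1 DM] := DR.
move=> E; rewrite pmul_ext_rE E -/(ext_r _ _); move: t {E}.
apply: tens_ext => [||k m].
- exact: (lin_comp (@jmap_lin _ _ _) (ext_r_lin _)).
- apply: tenslift_lin; split=> z; last exact: hpure3_linr.
  exact: (lin_comp (tpure_linl _) (lin_comp (tpure_linl _) (hpure3_linl z))).
rewrite jmapE ext_rE tensliftE; last first.
  split=> z; last exact: hpure3_linr.
  exact: (lin_comp (tpure_linl _) (lin_comp (tpure_linl _) (hpure3_linl z))).
by rewrite tmapE // hD1 !tassocE !tmulE !amul1a amula1.
Qed.

Let lin_ext_l (Q : lmodType K) (F : HHHt R -> Q) e : linear F ->
  linear (fun t => F (pmul_ext_l (jmap t) e)).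
Proof.
move=> lF; exact: (lin_comp (@jmap_lin _ _ _) (lin_comp (pmul_ext_l_lin e) lF)).
Qed.
Let lin_ext_r (Q : lmodType K) (F : HHHt R -> Q) a : linear F ->
  linear (fun t => F (pmul_ext_r a (jmap t))).
Proof.
move=> lF; exact: (lin_comp (@jmap_lin _ _ _) (lin_comp (pmul_ext_r_lin a) lF)).
Qed.
Let h3l_bi f : bilin (fun h (m : R) => hpure3 ((f \ox (aone : H)) \ox h) m).
Proof.
split=> z; last exact: hpure3_linr.
exact: (lin_comp (tpure_linr _) (hpure3_linl z)).
Qed.
Let h3r_bi (f : H) : bilin (fun (k : H) (m : R) => hpure3 ((k \ox f) \ox (aone : H)) m).
Proof.
split=> z; last exact: hpure3_linr.
exact: (lin_comp (tpure_linl _) (lin_comp (tpure_linl _) (hpure3_linl z))).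
Qed.

(** This and the next seven lemmas compute both sides of the associativity law under each map.
    [theta1] shows that coefficients lie in [rconst], [counit2] gives multiplicativity of the
    coaction and controls the left annihilator, [counit1] gives the form of the pseudoproduct and
    associativity of [dot], [theta3] gives coassociativity. *)
Lemma theta1_l t e :
  theta1 (pmul_ext_l (jmap t) e) = tmap id (fun d => pmul d e) t.
Proof.
move: t; apply: tens_ext => [||f d].
- exact: lin_ext_l (@theta1_lin _ _ _).
- exact: (tmap_lin (@lin_id _ _) (pmul_linl e)).
have [t Et] := jmapr_surj (pmul d e).
rewrite jmapE (pmul_ext_lE1 f Et) tmapE //; last exact: pmul_linl.
rewrite Et; move: t {Et}; apply: tens_ext => [||h m].
- exact: (lin_comp (tenslift_lin (h3l_bi f)) (@theta1_lin _ _ _)).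
- exact: (lin_comp (@jmapr_lin _ _ _) (tpure_linr f)).
by rewrite tensliftE // theta1E jmaprE.
Qed.

Lemma theta1_r1 a d : theta1 (pmul_ext_r a ((aone \ox aone) \oxH d)) =
  tmap id (fun m => (aone \ox aone) \oxH m) (theta (pmul a d)).
Proof.
rewrite (pmul_ext_rE1 _ (esym (jmapK (pmul a d)))); move: (theta _).
apply: tens_ext => [||k m].
- exact: (lin_comp (tenslift_lin (h3r_bi _)) (@theta1_lin _ _ _)).
- exact: (tmap_lin (@lin_id _ _) (@hpure_linr _ _ _ _)).
by rewrite tensliftE // theta1E tmapE //; exact: hpure_linr.
Qed.

Lemma counit2_r a t : counit2 (pmul_ext_r a (jmap t)) = pmul a (ev (@heps K H) t).
Proof.
move: t; apply: tens_ext => [||f d].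
- exact: lin_ext_r (@counit2_lin _ _ _).
- exact: (lin_comp (ev_lin (@heps_lin K H)) (pmul_linr a)).
rewrite jmapE (pmul_ext_rE1 f (esym (jmapK (pmul a d)))) evE; last exact: heps_lin.
rewrite (linZ (pmul_linr a)) -{2}[pmul a d]jmapK; move: (theta _).
apply: tens_ext => [||k m].
- exact: (lin_comp (tenslift_lin (h3r_bi _)) (@counit2_lin _ _ _)).
- exact: (lin_scale _ (@jmap_lin _ _ _)).
by rewrite tensliftE // counit2E jmapE.
Qed.

Lemma counit2_l t e : counit2 (pmul_ext_l (jmap t) e) =
  tenslift (fun f d => hhact (f \ox aone) (pmul d e)) t.
Proof.
have bi : bilin (fun f d => hhact (f \ox aone) (pmul d e)).
  split=> z; first exact: (lin_comp (tpure_linl _) (hhact_linl _)).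
  exact: (lin_comp (pmul_linl e) (hhact_linr _)).
move: t; apply: tens_ext => [||f d].
- exact: lin_ext_l (@counit2_lin _ _ _).
- exact: tenslift_lin.
have [t Et] := jmapr_surj (pmul d e).
rewrite jmapE (pmul_ext_lE1 f Et) tensliftE // Et; move: t {Et}.
apply: tens_ext => [||h m].
- exact: (lin_comp (tenslift_lin (h3l_bi f)) (@counit2_lin _ _ _)).
- exact: (lin_comp (@jmapr_lin _ _ _) (hhact_linr _)).
by rewrite tensliftE // counit2E heps1 scale1r jmaprE hhactE tmulE amula1 amul1a.
Qed.

Lemma counit1_l t e : counit1 (pmul_ext_l (jmap t) e) = pmul (ev (@heps K H) t) e.
Proof.
move: t; apply: tens_ext => [||f d].
- exact: lin_ext_l (@counit1_lin _ _ _).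
- exact: (lin_comp (ev_lin (@heps_lin K H)) (pmul_linl e)).
have [t Et] := jmapr_surj (pmul d e).
rewrite jmapE (pmul_ext_lE1 f Et) evE; last exact: heps_lin.
rewrite (linZ (pmul_linl e)) Et; move: t {Et}; apply: tens_ext => [||h m].
- exact: (lin_comp (tenslift_lin (h3l_bi f)) (@counit1_lin _ _ _)).
- exact: (lin_scale _ (@jmapr_lin _ _ _)).
by rewrite tensliftE // counit1E jmaprE.
Qed.

Lemma counit1_r a t : counit1 (pmul_ext_r a (jmap t)) =
  jmap (tmap id (fun d => prod1 (pmul a d)) t).
Proof.
have lw : linear (fun d => prod1 (pmul a d)) := lin_comp (pmul_linr a) (@prod1_lin _ _ _).
move: t; apply: tens_ext => [||f d].
- exact: lin_ext_r (@counit1_lin _ _ _).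
- exact: (lin_comp (tmap_lin (@lin_id _ _) lw) (@jmap_lin _ _ _)).
rewrite jmapE (pmul_ext_rE1 f (esym (jmapK (pmul a d)))) tmapE // jmapE prod1_theta.
move: (theta _); apply: tens_ext => [||k m].
- exact: (lin_comp (tenslift_lin (h3r_bi _)) (@counit1_lin _ _ _)).
- exact: (lin_comp (ev_lin (@heps_lin K H)) (@hpure_linr _ _ _ _)).
rewrite tensliftE // counit1E evE; last exact: heps_lin.
by rewrite (linZ (@hpure_linr _ _ _ _)).
Qed.

Lemma theta3_l1 d e : theta3 (pmul_ext_l ((aone \ox aone) \oxH d) e) =
  tmap (@hD K H) id (theta (pmul d e)).
Proof.
rewrite pmul_ext_lE -/(ext_l _ _) -{1}[pmul d e]jmapK; move: (theta _).
apply: tens_ext => [||f m].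
- exact: (lin_comp (@jmap_lin _ _ _) (lin_comp (ext_l_lin _) (@theta3_lin _ _ _))).
- exact: (tmap_lin hDl (@lin_id _ _)).
by rewrite jmapE ext_lE tmapE // -!toneE amul1a theta3E tmapE.
Qed.

Lemma theta3_r a t : theta3 (pmul_ext_r a (jmap t)) =
  tmap (@tswap K H H) id (tassoc (tmap id (fun d => theta (pmul a d)) t)).
Proof.
have lt : linear (fun d => theta (pmul a d)) :=
  lin_comp (pmul_linr a) (@theta_lin _ _ _).
have lr := lin_comp (@tassoc_lin K H H R) (tmap_lin (@tswap_lin K H H) (@lin_id _ _)).
move: t; apply: tens_ext => [||f d].
- exact: lin_ext_r (@theta3_lin _ _ _).
- exact: (lin_comp (tmap_lin (@lin_id _ _) lt) lr).
rewrite jmapE (pmul_ext_rE1 f (esym (jmapK (pmul a d)))) tmapE //.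
move: (theta _); apply: tens_ext => [||k m].
- exact: (lin_comp (tenslift_lin (h3r_bi _)) (@theta3_lin _ _ _)).
- exact: (lin_comp (tpure_linr _) lr).
by rewrite tensliftE // theta3E tassocE tmapE ?tswapE //; exact: tswap_lin.
Qed.
End Products.

Section TensorMore.
Variable K : fieldType.
Lemma ev_tmap (H V W : lmodType K) (y : H -> K^o) (F : V -> W) t :
  linear y -> linear F -> ev y (tmap id F t) = F (ev y t).
Proof.
move=> ly lF; move: t; apply: tens_ext => [||h v].
- exact: (lin_comp (tmap_lin (@lin_id _ _) lF) (ev_lin ly)).
- exact: (lin_comp (ev_lin ly) lF).
by rewrite tmapE // !evE // (linZ lF).
Qed.
Lemma tmap_comp (L M N L' M' N' : lmodType K) (f : L -> M) (f' : M -> N)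
    (k : L' -> M') (k' : M' -> N') t :
  linear f -> linear f' -> linear k -> linear k' ->
  tmap f' k' (tmap f k t) = tmap (fun x => f' (f x)) (fun x => k' (k x)) t.
Proof.
move=> lf lf' lk lk'; move: t; apply: tens_ext => [||h v].
- exact: (lin_comp (tmap_lin lf lk) (tmap_lin lf' lk')).
- exact: (tmap_lin (lin_comp lf lf') (lin_comp lk lk')).
rewrite !tmapE //; first exact: (lin_comp lf lf').
exact: (lin_comp lk lk').
Qed.
Lemma tmap_eq (L M L' M' : lmodType K) (f f' : L -> M) (k k' : L' -> M') t :
  (forall x, f x = f' x) -> (forall x, k x = k' x) -> tmap f k t = tmap f' k' t.
Proof. by move=> /funext -> /funext ->. Qed.
Lemma tmap_id (L M : lmodType K) (t : tens L M) : tmap id id t = t.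
Proof.
move: t; apply: tens_ext => [||h v]; last by rewrite tmapE.
  exact: (tmap_lin (@lin_id _ _) (@lin_id _ _)).
exact: lin_id.
Qed.
End TensorMore.

(** * The decomposition of R *)

Section Decomposition.
Variables (K : fieldType) (g : lieAlg K).
Local Notation H := (UH g).
Variables (R : pseudo H) (e : R).
Hypothesis Ras : passoc R.
Hypothesis eE : pmul e e = (aone \ox aone) \oxH e.
Hypothesis e1 : forall r, ev (@heps K H) (theta (pmul e r)) = r.
Implicit Types a b d r s : R.

Definition ione (r : R) : HHt R := (aone \ox aone) \oxH r.
Lemma ione_lin : linear ione. Proof. exact: hpure_linr. Qed.
Lemma ioneE r : ione r = jmap (aone \ox r).
Proof. by rewrite jmapE. Qed.
Lemma theta_ione r : theta (ione r) = aone \ox r.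
Proof. by rewrite ioneE thetaK. Qed.
Lemma prod1_ione r : prod1 (ione r) = r.
Proof. by rewrite prod1E heps1 scale1r hact1. Qed.

(* RA below is {r | rconst r}, with the product dot a b = a_1 b; if
   coact b = sum f (x) b' then e * b = sum (f (x) 1) (x)_H b'. *)
Definition rconst r := pmul r e = ione r.
Definition dot a b : R := prod1 (pmul a b).
Definition coact b : tens H R := theta (pmul e b).
Definition actT (t : tens H R) : R := tenslift (fun h m => hact h m) t.

Lemma actT_bi : bilin (fun (h : H) (m : R) => hact h m).
Proof. by split=> z; [exact: hact_linl | exact: hact_linr]. Qed.
Lemma actT_lin : linear actT. Proof. exact: tenslift_lin actT_bi. Qed.
Lemma actTE h m : actT (h \ox m) = hact h m.
Proof. exact: tensliftE actT_bi. Qed.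
Lemma coact_lin : linear coact.
Proof. exact: (lin_comp (pmul_linr e) (@theta_lin _ _ _)). Qed.
Lemma dot_linl b : linear (dot^~ b).
Proof. exact: (lin_comp (pmul_linl b) (@prod1_lin _ _ _)). Qed.
Lemma dot_linr a : linear (dot a).
Proof. exact: (lin_comp (pmul_linr a) (@prod1_lin _ _ _)). Qed.

Lemma rconst_ev (t : tens H R) y : linear y ->
  tmap id (fun d => pmul d e) t = tmap id ione t -> rconst (ev y t).
Proof.
by move=> ly E; rewrite /rconst -(ev_tmap _ ly (pmul_linl e)) E ev_tmap //;
   exact: ione_lin.
Qed.

(** Associativity for r, e, e: the coefficients of r * e lie in [rconst]. This is the projection to
    coinvariants in Hopf module theory. *)
Lemma theta_r_e r : tmap id (fun d => pmul d e) (theta (pmul r e)) =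
  tmap id ione (theta (pmul r e)).
Proof.
have := congr1 (@theta1 _ _ _) (Ras r e e).
by rewrite -{1}[pmul r e]jmapK theta1_l eE theta1_r1.
Qed.

Lemma rconst_dot a b : rconst b -> rconst (dot a b).
Proof.
move=> bA; rewrite /dot prod1_theta; apply: rconst_ev; first exact: heps_lin.
have := congr1 (@theta1 _ _ _) (Ras a b e).
by rewrite -{1}[pmul a b]jmapK theta1_l bA theta1_r1.
Qed.

Lemma rconst_coact b : rconst b ->
  tmap id (fun d => pmul d e) (coact b) = tmap id ione (coact b).
Proof.
move=> bA; have := congr1 (@theta1 _ _ _) (Ras e b e).
by rewrite -{1}[pmul e b]jmapK theta1_l bA theta1_r1.
Qed.

Definition proj r : R := dot r e.
Lemma proj_lin : linear proj. Proof. exact: dot_linl. Qed.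
Lemma rconst_proj r : rconst (proj r).
Proof.
rewrite /proj /dot prod1_theta; apply: rconst_ev; first exact: heps_lin.
exact: theta_r_e.
Qed.
Lemma proj_id r : rconst r -> proj r = r.
Proof. by rewrite /proj /dot => ->; exact: prod1_ione. Qed.

Lemma tmap_proj (t : tens H R) :
  tmap id (fun d => pmul d e) t = tmap id ione t -> tmap id proj t = t.
Proof.
move=> E; have <- : tmap id (@prod1 _ _ R) (tmap id (fun d => pmul d e) t) = tmap id proj t.
  by rewrite tmap_comp //; [exact: pmul_linl | exact: prod1_lin].
rewrite E tmap_comp //; try exact: ione_lin; try exact: prod1_lin.
by rewrite -[RHS]tmap_id; apply: tmap_eq => // x; rewrite prod1_ione.
Qed.

(** Compare (a * e) * b with a * (e * b), using that a * e is [ione a]. The product by a thus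
    depends on b through its coaction alone, which is the shape of the pseudoproduct of Diff. *)
Lemma pmul_rconst a b : rconst a -> pmul a b = jmap (tmap id (dot a) (coact b)).
Proof.
move=> aA; have := congr1 (@counit1 _ _ _) (Ras a e b).
rewrite aA -[pmul e b]jmapK counit1_r ioneE counit1_l evE; last exact: heps_lin.
by rewrite heps1 scale1r.
Qed.

Lemma dotA a b d : dot a (dot b d) = dot (dot a b) d.
Proof.
have := congr1 (fun u => prod1 (counit1 u)) (Ras a b d).
rewrite -{1}[pmul a b]jmapK -[pmul b d]jmapK counit1_l counit1_r -prod1_theta -/(dot a b).
rewrite -/(dot (dot a b) d) => ->; rewrite prod1_theta thetaK.
rewrite (@ev_tmap K H R R (@heps K H) (dot a)); [|exact: heps_lin|exact: dot_linr].
by rewrite -prod1_theta.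
Qed.

Lemma pmul_actT t s : pmul (actT t) s =
  tenslift (fun f u => hhact (f \ox aone) u) (tmap id (fun d => pmul d s) t).
Proof.
have bi : bilin (fun (f : H) (u : HHt R) => hhact (f \ox aone) u).
  split=> z; last exact: hhact_linr.
  exact: (lin_comp (tpure_linl _) (hhact_linl _)).
move: t; apply: tens_ext => [||f d].
- exact: (lin_comp actT_lin (pmul_linl s)).
- exact: (lin_comp (tmap_lin (@lin_id _ _) (pmul_linl s)) (tenslift_lin bi)).
by rewrite actTE tmapE ?tensliftE ?pmulHl //; exact: pmul_linl.
Qed.

Lemma pmul_actT_ione t : tenslift (fun f u => hhact (f \ox aone) u) (tmap id ione t)
  = jmap t.
Proof.
have bi : bilin (fun (f : H) (u : HHt R) => hhact (f \ox aone) u).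
  split=> z; last exact: hhact_linr.
  exact: (lin_comp (tpure_linl _) (hhact_linl _)).
move: t; apply: tens_ext => [||f d].
- exact: (lin_comp (tmap_lin (@lin_id _ _) ione_lin) (tenslift_lin bi)).
- exact: jmap_lin.
by rewrite tmapE ?tensliftE //; [rewrite hhactE tmulE !amula1 jmapE|exact: ione_lin].
Qed.

(** The counit on the middle leg turns r * (e * s) into r * s, because e_1 s = s; and (r * e) * s is
    zero. *)
Lemma lann_e r : pmul r e = 0 -> forall s, pmul r s = 0.
Proof.
move=> r0 s; have := congr1 (@counit2 _ _ _) (Ras r e s).
rewrite r0 (lin0 (pmul_ext_l_lin s)) (lin0 (@counit2_lin _ _ _)) -[pmul e s]jmapK counit2_r.
by rewrite e1.
Qed.

(** The identity e * (a * b) = (e * a) * b with the counit on the middle leg. The coefficients of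
    [coact a] lie in [rconst], so [proj] does not change them; writing it makes [pmul_rconst]
    applicable to each pure tensor separately. *)
Lemma coact_dot a b : rconst a -> rconst b ->
  coact (dot a b) = tenslift (fun f d => tenslift (fun f' d' =>
    (f ** f') \ox dot d d') (coact b)) (tmap id proj (coact a)).
Proof.
move=> aA bA.
have := congr1 (fun u => theta (counit2 u)) (Ras e a b).
rewrite -{1}[pmul e a]jmapK counit2_l -[pmul a b]jmapK counit2_r -prod1_theta -/(dot a b).
rewrite -/(coact (dot a b)) => <-; rewrite -/(coact a) -{1}(tmap_proj (rconst_coact aA)).
have bi0 d : bilin (fun (f' : H) d' => f' \ox dot d d').
  split=> z; first exact: tpure_linl.
  exact: (lin_comp (dot_linr d) (tpure_linr z)).
have bi1 f d : bilin (fun (f' : H) d' => (f ** f') \ox dot d d').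
  split=> z; first exact: (lin_comp (amul_linr _) (tpure_linl _)).
  exact: (lin_comp (dot_linr d) (tpure_linr _)).
have bi2 : bilin (fun f d => tenslift (fun f' d' => (f ** f') \ox dot d d') (coact b)).
  split=> z; apply: tenslift_par => f' d'.
    exact: (lin_comp (amul_linl _) (tpure_linl _)).
  exact: (lin_comp (dot_linl _) (tpure_linr _)).
have bi3 : bilin (fun (f : H) d => hhact (f \ox aone) (pmul d b)).
  split=> z; first exact: (lin_comp (tpure_linl _) (hhact_linl _)).
  exact: (lin_comp (pmul_linl b) (hhact_linr _)).
move: (coact a); apply: tens_ext => [||f d].
- exact: (lin_comp (tmap_lin (@lin_id _ _) proj_lin)
    (lin_comp (tenslift_lin bi3) (@theta_lin _ _ _))).
- exact: (lin_comp (tmap_lin (@lin_id _ _) proj_lin) (tenslift_lin bi2)).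
rewrite !tmapE; [|by []|exact: proj_lin].
rewrite !tensliftE // (pmul_rconst _ (rconst_proj d)); move: (coact b).
have lp : linear (dot (proj d)) by exact: dot_linr.
apply: tens_ext => [||f' d'].
- exact: (lin_comp (tmap_lin (@lin_id _ _) lp) (lin_comp (@jmap_lin _ _ _)
    (lin_comp (hhact_linr _) (@theta_lin _ _ _)))).
- exact: tenslift_lin.
rewrite tmapE // jmapE hhactE tmulE amula1 theta_pure tensliftE //.
Qed.

(** [theta3] yields coassociativity with the two legs in H exchanged; cocommutativity of U(g)
    removes the exchange. *)
Lemma coact_coassoc b :
  tassoc (tmap id coact (coact b)) = tmap (@hD K H) id (coact b).
Proof.
have := congr1 (@theta3 _ _ _) (Ras e e b).
rewrite eE theta3_l1 -[in X in _ = X -> _](jmapK (pmul e b)) theta3_r -/(coact b).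
have sw (t : tens (tens H H) R) :
    tmap (@tswap K H H) id (tmap (@tswap K H H) id t) = t.
  rewrite tmap_comp //; try exact: tswap_lin.
  rewrite -[RHS]tmap_id; apply: tmap_eq => // u.
  move: u; apply: tens_ext => [||x y]; last by rewrite !tswapE.
    exact: (lin_comp (@tswap_lin _ _ _) (@tswap_lin _ _ _)).
  exact: lin_id.
move/(congr1 (tmap (@tswap K H H) id)); rewrite sw => <-.
rewrite tmap_comp //; try exact: hD_lin; try exact: tswap_lin.
by apply: tmap_eq => // u; rewrite UH_cocomm.
Qed.

Lemma coact_e : coact e = aone \ox e.
Proof. by rewrite /coact eE -/(ione e) theta_ione. Qed.

Lemma rconst_subspace : subspace rconst.
Proof.
split; first by rewrite /rconst (lin0 (pmul_linl _)) (lin0 ione_lin).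
by move=> k x y Px Py; rewrite /rconst pmul_linl Px Py ione_lin.
Qed.

Lemma rconst_alg : subalg_axioms dot e rconst.
Proof.
split.
- exact: rconst_subspace.
- exact: dot_linl.
- exact: dot_linr.
- exact: eE.
- by move=> x y _; apply: rconst_dot.
- by move=> x y z _ _ _; apply: dotA.
- by move=> x _; rewrite /dot prod1_theta e1.
- by move=> x xA; apply: proj_id.
Qed.

Definition RA : pzAlgType K := subalg rconst_alg.
Definition RAval : RA -> R := @subalg_val _ _ _ _ _ rconst_alg.
Definition RAproj (r : R) : RA := Subalg rconst_alg (rconst_proj r).
Lemma RAval_lin : linear RAval. Proof. exact: subalg_val_lin. Qed.
Lemma RAval_inj : injective RAval. Proof. exact: subalg_val_inj. Qed.
Lemma RAval_rconst (a : RA) : rconst (RAval a). Proof. exact: subalg_valP. Qed.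
Lemma RAprojK r : RAval (RAproj r) = proj r. Proof. by []. Qed.
Lemma RAvalK (a : RA) : RAproj (RAval a) = a.
Proof. by apply: RAval_inj; rewrite RAprojK proj_id //; exact: RAval_rconst. Qed.
Lemma RAproj_lin : linear RAproj.
Proof.
by move=> k x y; apply: RAval_inj; rewrite RAval_lin !RAprojK proj_lin.
Qed.
Lemma RAvalM (a b : RA) : RAval (a ** b) = dot (RAval a) (RAval b). Proof. by []. Qed.
Lemma RAval1 : RAval aone = e. Proof. by []. Qed.

Definition RAcoact (a : RA) : tens H RA := tmap id RAproj (coact (RAval a)).
Lemma tmap_RAval_inj : injective (tmap id RAval : tens H RA -> tens H R).
Proof.
move=> t u /(congr1 (tmap id RAproj)).
have id' (v : tens H RA) : tmap id RAproj (tmap id RAval v) = v.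
  rewrite tmap_comp //; try exact: RAval_lin; try exact: RAproj_lin.
  by rewrite -[RHS]tmap_id; apply: tmap_eq => // x; rewrite RAvalK.
by rewrite !id'.
Qed.
Lemma RAcoact_val (a : RA) : tmap id RAval (RAcoact a) = coact (RAval a).
Proof.
rewrite /RAcoact tmap_comp //; try exact: RAproj_lin; try exact: RAval_lin.
exact: tmap_proj (rconst_coact (RAval_rconst a)).
Qed.
Lemma RAcoact_lin : linear RAcoact.
Proof.
exact: (lin_comp RAval_lin (lin_comp coact_lin (tmap_lin (@lin_id _ _) RAproj_lin))).
Qed.

Lemma RAcoact_hom : alg_hom RAcoact.
Proof.
have lv := tmap_lin (@lin_id _ H) RAval_lin.
split; first exact: RAcoact_lin.
  by apply: tmap_RAval_inj; rewrite RAcoact_val RAval1 coact_e toneE tmapE.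
move=> x y; move: x y => a b; apply: tmap_RAval_inj; rewrite RAcoact_val RAvalM.
rewrite coact_dot; try exact: RAval_rconst.
rewrite (tmap_proj (rconst_coact (RAval_rconst a))) -!RAcoact_val.
have bi1 (f : H) d : bilin (fun (f' : H) d' => (f ** f') \ox dot d d').
  split=> z; first exact: (lin_comp (amul_linr _) (tpure_linl _)).
  exact: (lin_comp (dot_linr d) (tpure_linr _)).
have bi2 w : bilin (fun (f : H) d =>
    tenslift (fun f' d' => (f ** f') \ox dot d d') w).
  split=> z; apply: tenslift_par => f' d'.
    exact: (lin_comp (amul_linl _) (tpure_linl _)).
  exact: (lin_comp (dot_linl _) (tpure_linr _)).
move: (RAcoact a) (RAcoact b) => t u; move: t; apply: tens_ext => [||f d].
- exact: (lin_comp lv (tenslift_lin (bi2 _))).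
- exact: (lin_comp (amul_linl u) lv).
rewrite tmapE // ?tensliftE //; try exact: RAval_lin.
move: u; apply: tens_ext => [||f' d'].
- exact: (lin_comp lv (tenslift_lin (bi1 _ _))).
- exact: (lin_comp (amul_linr _) lv).
rewrite tmapE // ?tensliftE //; try exact: RAval_lin.
by rewrite tmulE tmapE //; try exact: RAval_lin.
Qed.

Lemma RAcoact_coassoc (a : RA) :
  tassoc (tmap id RAcoact (RAcoact a)) = tmap (@hD K H) id (RAcoact a).
Proof.
have lv := tmap_lin (@lin_id _ H) RAval_lin.
have inj : injective (tmap id RAval : tens (tens H H) RA -> tens (tens H H) R).
  move=> t u /(congr1 (tmap id RAproj)).
  have id' (v : tens (tens H H) RA) : tmap id RAproj (tmap id RAval v) = v.
    rewrite tmap_comp //; try exact: RAval_lin; try exact: RAproj_lin.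
    by rewrite -[RHS]tmap_id; apply: tmap_eq => // x; rewrite RAvalK.
  by rewrite !id'.
have nat (t : tens H (tens H RA)) :
    tmap id RAval (tassoc t) = tassoc (tmap id (tmap id RAval) t).
  have lvv := tmap_lin (@lin_id _ (tens H H)) RAval_lin.
  move: t; apply: tens_ext => [||f t].
  - exact: (lin_comp (@tassoc_lin _ _ _ _) lvv).
  - exact: (lin_comp (tmap_lin (@lin_id _ _) lv) (@tassoc_lin _ _ _ _)).
  rewrite tmapE //; move: t; apply: tens_ext => [||f' d].
  - exact: (lin_comp (tpure_linr _) (lin_comp (@tassoc_lin _ _ _ _) lvv)).
  - exact: (lin_comp (lin_comp lv (tpure_linr _)) (@tassoc_lin _ _ _ _)).
  by rewrite tassocE !tmapE ?tassocE //; try exact: RAval_lin.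
apply: inj; rewrite nat tmap_comp //; last exact: RAcoact_lin.
rewrite (@tmap_comp K _ _ _ _ _ _ (@hD K H) id id RAval) //; last 1 first.
- exact: hD_lin.
have -> : tmap id (fun x => tmap id RAval (RAcoact x)) (RAcoact a) =
    tmap id coact (tmap id RAval (RAcoact a)).
  rewrite tmap_comp //; try exact: RAval_lin; try exact: coact_lin.
  by apply: tmap_eq => // x; rewrite RAcoact_val.
rewrite RAcoact_val coact_coassoc -RAcoact_val tmap_comp //; exact: hD_lin.
Qed.

Lemma RAcoact_counit (a : RA) : ev (@heps K H) (RAcoact a) = a.
Proof.
apply: RAval_inj; rewrite -(ev_tmap _ (@heps_lin K H) RAval_lin) RAcoact_val.
exact: e1.
Qed.

Lemma pmul_RA (a b : RA) : pmul (RAval a) (RAval b) =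
  jmap (tmap id RAval ((aone \ox a : tens H RA) ** RAcoact b)).
Proof.
have lv := tmap_lin (@lin_id _ H) RAval_lin.
rewrite (pmul_rconst _ (RAval_rconst a)) -RAcoact_val; congr jmap.
have ld : linear (dot (RAval a)) by exact: dot_linr.
move: (RAcoact b); apply: tens_ext => [||f d].
- exact: (lin_comp lv (tmap_lin (@lin_id _ _) ld)).
- exact: (lin_comp (amul_linr _) lv).
rewrite tmulE !tmapE ?amul1a //; try exact: RAval_lin.
Qed.

Hypothesis lann : forall r, (forall s, pmul r s = 0) -> r = 0.

(** Both sides have the same product with e, and an element r with r * e = 0 lies in the left
    annihilator, hence is zero. *)
Lemma actT_theta r : actT (theta (pmul r e)) = r.
Proof.
apply/eqP; rewrite -subr_eq0; apply/eqP/lann/lann_e.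
by rewrite (linB _ _ (pmul_linl e)) pmul_actT theta_r_e pmul_actT_ione jmapK subrr.
Qed.

(* R = H (x) RA, an instance of the structure theorem of Hopf modules. *)
Definition decomp (r : R) : tens H RA := tmap id RAproj (theta (pmul r e)).
Definition recomp (t : tens H RA) : R := actT (tmap id RAval t).
Lemma decomp_lin : linear decomp.
Proof.
exact: (lin_comp (pmul_linl e) (lin_comp (@theta_lin _ _ _)
  (tmap_lin (@lin_id _ _) RAproj_lin))).
Qed.
Lemma recomp_lin : linear recomp.
Proof. exact: (lin_comp (tmap_lin (@lin_id _ _) RAval_lin) actT_lin). Qed.
Lemma recompE h (a : RA) : recomp (h \ox a) = hact h (RAval a).
Proof. by rewrite /recomp tmapE ?actTE //; try exact: RAval_lin. Qed.
Lemma decompK r : recomp (decomp r) = r.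
Proof.
rewrite /recomp /decomp tmap_comp //; try exact: RAproj_lin; try exact: RAval_lin.
by rewrite (tmap_proj (theta_r_e r)) actT_theta.
Qed.
Lemma recompK t : decomp (recomp t) = t.
Proof.
move: t; apply: tens_ext => [||h a].
- exact: (lin_comp recomp_lin decomp_lin).
- exact: lin_id.
rewrite recompE /decomp pmulHl (RAval_rconst a) ioneE jmapE hhactE tmulE !amula1.
rewrite theta_pure tmapE ?RAvalK //; exact: RAproj_lin.
Qed.

End Decomposition.

Section LeftAnnihilator.
Variables (K : fieldType) (g : lieAlg K).
Local Notation H := (UH g).
Variable R : pseudo H.

Lemma xprodE (x : H -> K^o) (a b y : R) : linear x -> xprod x a b y ->
  y = ev (fun h => x (hS h)) (theta (pmul a b)).
Proof. by move=> lx [t E ->]; rewrite E -/(jmap t) thetaK. Qed.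

(** The left annihilator is an ideal, and it is not R because e * e is nonzero. *)
Lemma simple_lann (e : R) : passoc R -> simple_pseudo R -> pmul e e <> 0 ->
  forall r : R, (forall s, pmul r s = 0) -> r = 0.
Proof.
move=> Ras Rs ee r0 Lr.
pose L : set R := fun r => forall s, pmul r s = 0.
have iL : ideal_in setT L.
  split=> //.
    split; first by move=> s; rewrite (lin0 (pmul_linl _)).
    - by move=> a b La Lb s; rewrite (linD (pmul_linl _)) La Lb addr0.
    - by move=> h a La s; rewrite pmulHl La (lin0 (hhact_linr _)).
  move=> x lx a b y La _.
  have lxS : linear (fun h => x (hS h)) := lin_comp (@hS_lin K H) lx.
  split=> /(xprodE lx) ->.
    by move=> s; rewrite La (lin0 (@theta_lin _ _ _)) (lin0 (ev_lin lxS))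
       (lin0 (pmul_linl _)).
  (* For a in L, the coefficients d of b * a satisfy d * s = 0, since the d * s are the components
     under [theta1] of b * (a * s) = 0. *)
  move=> s; rewrite -(ev_tmap _ lxS (pmul_linl s)) -theta1_l jmapK Ras La.
  by rewrite (lin0 (pmul_ext_r_lin _)) (lin0 (@theta1_lin _ _ _)) (lin0 (ev_lin lxS)).
case: (Rs L iL) => E; first by have : L r0 by []; rewrite E.
by exfalso; apply: ee; have : L e by rewrite E.
Qed.
End LeftAnnihilator.

(** * Comodule algebras over U(g) *)

Section XAction.
Variables (K : fieldType) (g : lieAlg K).
Local Notation H := (UH g).
Variables (A : pzAlgType K) (co : A -> tens H A).
Hypothesis co_hom : alg_hom co.
Implicit Types (y z : H -> K^o) (a b : A).

Definition xa y a : A := ev y (co a).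

Lemma xa_lin y : linear y -> linear (xa y).
Proof. by move=> ly; case: co_hom => lc _ _; apply: (lin_comp lc (ev_lin ly)). Qed.

Lemma xa_linl k y z a : linear y -> linear z ->
  xa (fun h => k *: y h + z h) a = k *: xa y a + xa z a.
Proof. exact: ev_linl. Qed.

Lemma xa_1 y : linear y -> xa y aone = (y aone : K) *: aone.
Proof. by case: co_hom => _ c1 _ ly; rewrite /xa c1 evE. Qed.

Lemma xa_prim y x s b : linear y -> co s = x \ox aone + aone \ox s ->
  xa y (s ** b) = s ** xa y b + xa (fun h => y (x ** h)) b.
Proof.
case: co_hom => _ _ cM ly E; rewrite /xa cM E amulDl.
have lx : linear (fun h => y (x ** h)) := lin_comp (amul_linr x) ly.
move: (co b); apply: tens_ext => [||h a].
- exact: (lin_comp (lin_add (amul_linr _) (amul_linr _)) (ev_lin ly)).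
- exact: (lin_add (lin_comp (ev_lin ly) (amul_linr s)) (ev_lin lx)).
by rewrite !tmulE !amul1a (linD (ev_lin ly)) !evE // amulZr addrC.
Qed.

Lemma lin_mull y x : linear y -> linear (fun h : H => y (x ** h)).
Proof. by move=> ly; apply: (lin_comp (amul_linr x) ly). Qed.

(** As [heps] is the unit of X, this is the component of y in the augmentation ideal, the
    functionals vanishing at 1. *)
Definition aug y : H -> K^o := fun h => (- y aone) *: heps h + y h.
Lemma aug_lin y : linear y -> linear (aug y).
Proof. by move=> ly; apply: lin_add => //; apply: lin_scale; apply: heps_lin. Qed.
Lemma aug1 y : aug y aone = 0.
Proof. by rewrite /aug heps1 -[_ *: _]/(_ * _) mulr1 addNr. Qed.

Hypothesis co_counit : forall a, ev (@heps K H) (co a) = a.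
Lemma xa_aug y a : linear y -> xa y a = (y aone : K) *: a + xa (aug y) a.
Proof.
move=> ly; rewrite xa_linl //; last exact: heps_lin.
by rewrite /xa co_counit scaleNr addNKr.
Qed.
End XAction.

Section Coassociativity.
Variables (K : fieldType) (g : lieAlg K).
Local Notation H := (UH g).
Variables (A : pzAlgType K) (co : A -> tens H A).
Hypothesis co_hom : alg_hom co.
Hypothesis coA : forall a, tassoc (tmap id co (co a)) = tmap (@hD K H) id (co a).

(** The functional on the right is the product of y and z in X. *)
Lemma xa_xa y z a : linear y -> linear z ->
  xa co z (xa co y a) = xa co (fun h => z (xa (@hD K H) y h)) a.
Proof.
move=> ly lz; have [lc _ _] := co_hom.
pose yz (t : tens H H) : K^o := z (ev y t).
have lyz : linear yz := lin_comp (ev_lin ly) lz.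
have lyz' : linear (fun h => z (xa (@hD K H) y h)).
  exact: (lin_comp (@hD_lin K H) lyz).
transitivity (ev yz (tassoc (tmap id co (co a)))).
  rewrite {1}/xa {1}/xa; move: (co a); apply: tens_ext => [||h b].
  - exact: (lin_comp (ev_lin ly) (lin_comp lc (ev_lin lz))).
  - exact: (lin_comp (tmap_lin (@lin_id _ _) lc)
      (lin_comp (@tassoc_lin _ _ _ _) (ev_lin lyz))).
  rewrite tmapE // evE // (linZ lc) (linZ (ev_lin lz)).
  move: (co b); apply: tens_ext => [||h' c].
  - exact: (lin_scale _ (ev_lin lz)).
  - exact: (lin_comp (tpure_linr _) (lin_comp (@tassoc_lin _ _ _ _) (ev_lin lyz))).
  by rewrite tassocE !evE // scalerA /yz evE // (linZ lz).
rewrite coA /xa; move: (co a); apply: tens_ext => [||h b].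
- exact: (lin_comp (tmap_lin (@hD_lin K H) (@lin_id _ _)) (ev_lin lyz)).
- exact: ev_lin.
by rewrite tmapE ?evE //; exact: hD_lin.
Qed.

Lemma xa_comm y z a : linear y -> linear z ->
  xa co z (xa co y a) = xa co y (xa co z a).
Proof.
move=> ly lz; rewrite !xa_xa //; congr xa; apply/funext => h; rewrite /xa.
rewrite -{1}UH_cocomm; move: (hD h); apply: tens_ext => [||b c].
- exact: (lin_comp (@tswap_lin _ _ _) (lin_comp (ev_lin ly) lz)).
- exact: (lin_comp (ev_lin lz) ly).
by rewrite tswapE !evE // (linZ ly) (linZ lz) /GRing.scale /= mulrC.
Qed.

(* a is annihilated by all products of n elements of the augmentation ideal
   of X. *)
Fixpoint xnil n a : Prop :=
  if n is n'.+1 then forall y, linear y -> y aone = 0 -> xnil n' (xa co y a)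
  else a = 0.
End Coassociativity.

(** * The word filtration and the Euler operator *)

Section WordFiltration.
Variables (K : fieldType) (g : lieAlg K).
Local Notation H := (UH g).
Variables (A : pzAlgType K) (co : A -> tens H A).
Hypothesis co_hom : alg_hom co.
Hypothesis co_counit : forall a, ev (@heps K H) (co a) = a.
Variables (V : vectType K) (gam : V -> A) (kap : V -> g) (tV : H -> V).
Hypotheses (gam_lin : linear gam) (tV_lin : linear tV).
Hypothesis co_gam : forall v, co (gam v) = Ugen (kap v) \ox aone + aone \ox gam v.
Hypothesis tV1 : tV aone = 0.
Hypothesis tV_kap : forall v, tV (Ugen (kap v)) = v.
Hypothesis gam_comm : forall v w, exists u (c : K),
  gam v ** gam w = gam w ** gam v + gam u + c *: aone.
Implicit Types (y z : H -> K^o) (a b : A).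

(** The span of the words of length less than n in the [gam v]; with this shift [fil 0] is zero and
    [fil 1] consists of the scalars. The section serves both U(g) and U_phi. *)
Inductive fil : nat -> A -> Prop :=
| fil_0 n : fil n 0
| fil_1 n : fil n.+1 aone
| fil_D n a b : fil n a -> fil n b -> fil n (a + b)
| fil_Z n k a : fil n a -> fil n (k *: a)
| fil_M n v a : fil n a -> fil n.+1 (gam v ** a).

Lemma fil_sub n : subspace (fil n).
Proof.
split; first exact: fil_0.
by move=> k x y fx fy; apply: fil_D => //; apply: fil_Z.
Qed.
Lemma fil_S n a : fil n a -> fil n.+1 a.
Proof.
elim=> {n a}; by [constructor | move=> *; apply: fil_D | move=> *; apply: fil_Z
 | move=> *; apply: fil_M].
Qed.
Lemma fil_le n m a : (n <= m)%N -> fil n a -> fil m a.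
Proof.
elim: m => [|m IH]; first by rewrite leqn0 => /eqP ->.
by rewrite leq_eqVlt => /orP [/eqP ->//|nm] /IH h; apply: fil_S; apply: h.
Qed.
Lemma fil0 a : fil 0 a -> a = 0.
Proof.
move E : 0%N => n f; elim: f E => {n a} //.
- by move=> n a b _ IHa _ IHb E; rewrite IHa // IHb // addr0.
- by move=> n k a _ IHa E; rewrite IHa // scaler0.
Qed.
Lemma fil1 a : fil 1 a -> exists c : K, a = c *: aone.
Proof.
move E : 1%N => n f; elim: f E => {n a}.
- by move=> n _; exists 0; rewrite scale0r.
- by move=> n _; exists 1; rewrite scale1r.
- move=> n a b _ IHa _ IHb E; have [c ->] := IHa E; have [d ->] := IHb E.
  by exists (c + d); rewrite scalerDl.
- by move=> n k a _ IHa E; have [c ->] := IHa E; exists (k * c); rewrite scalerA.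
- by move=> n v a f _ [E]; exists 0; rewrite -E in f; rewrite (fil0 f) amul0r scale0r.
Qed.

(** Moving y past the letter [gam v] leaves y unchanged, plus a term in which the letter has
    disappeared from the word and y has become y(kap(v) . ). The second term has lower degree, and
    in the first the vanishing at 1 persists. *)
Lemma fil_xa n a : fil n a ->
  (forall y, linear y -> fil n (xa co y a)) /\
  (forall y, linear y -> y aone = 0 -> fil n.-1 (xa co y a)).
Proof.
elim=> {n a}.
- by move=> n; split=> y ly *; rewrite (lin0 (xa_lin co_hom ly)); apply: fil_0.
- move=> n; split=> y ly => [|y1]; rewrite xa_1 //; first by apply: fil_Z; apply: fil_1.
  by rewrite y1 scale0r; apply: fil_0.
- move=> n a b _ [IHa IHa'] _ [IHb IHb']; split=> y ly *;
  rewrite (linD (xa_lin co_hom ly)); apply: fil_D; auto.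
- move=> n k a _ [IHa IHa']; split=> y ly *;
  rewrite (linZ (xa_lin co_hom ly)); apply: fil_Z; auto.
move=> n v a fa [IHa IHa'].
have E y : linear y -> xa co y (gam v ** a) = gam v ** xa co y a +
    xa co (fun h => y ((Ugen (kap v) : H) ** h)) a.
  by move=> ly; apply: xa_prim => //; rewrite co_gam.
have lm y : linear y -> linear (fun h : H => y ((Ugen (kap v) : H) ** h)).
  exact: lin_mull.
split=> y ly => [|y1]; rewrite E //.
  apply: fil_D; first by apply: fil_M; apply: IHa.
  by apply: fil_S; apply: IHa; apply: lm.
apply: fil_D; last by apply: IHa; apply: lm.
case: n fa IHa' {IHa} => [|n] fa IHa'.
  rewrite (fil0 fa) (lin0 (xa_lin co_hom ly)) amul0r; exact: fil_0.
by apply: fil_M; apply: IHa'.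
Qed.

Local Notation b := (vbasis {:V}).
Definition tcoord (i : 'I_(\dim {:V})) : H -> K^o := fun h => coord b i (tV h).
Lemma tcoord_lin i : linear (tcoord i).
Proof. by move=> k x y; rewrite /tcoord tV_lin linearP. Qed.
Lemma tcoord1 i : tcoord i aone = 0.
Proof. by rewrite /tcoord tV1 linear0. Qed.
Definition euler a : A := \sum_(i < \dim {:V}) gam b`_i ** xa co (tcoord i) a.
Lemma euler_lin : linear euler.
Proof.
move=> k x y; rewrite /euler scaler_sumr -big_split; apply: eq_bigr => i _ /=.
by rewrite (xa_lin co_hom (tcoord_lin i)) amul_linr.
Qed.
Lemma vdec v : v = \sum_(i < \dim {:V}) coord b i v *: b`_i.
Proof. exact: coord_vbasis (memvf v). Qed.

Lemma fil_comm n v w a : fil n a ->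
  fil n.+1 ((gam v ** gam w - gam w ** gam v) ** a).
Proof.
move=> fa; have [u [c ->]] := gam_comm v w.
rewrite -[_ + _ + c *: _]addrA addrAC subrr add0r amulDl.
apply: fil_D; first exact: fil_M.
by rewrite amulZl amul1a; apply: fil_Z; apply: fil_S.
Qed.

(* On the associated graded algebra E is the Euler operator, that is,
   multiplication by the degree. *)
Lemma fil_euler n a : fil n a -> fil n.-1 (euler a - n.-1%:R *: a).
Proof.
elim=> {n a}.
- by move=> n; rewrite (lin0 euler_lin) scaler0 subrr; apply: fil_0.
- move=> n /=; apply: (subB (fil_sub _)).
    apply: (sub_sum (fil_sub _)) => i _; rewrite xa_1 //; last exact: tcoord_lin.
    by rewrite tcoord1 scale0r amul0r; apply: fil_0.
  case: n => [|n]; first by rewrite scale0r; apply: fil_0.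
  by apply: fil_Z; apply: fil_1.
- move=> n x z _ IHa _ IHb; rewrite (linD euler_lin) scalerDr opprD addrACA.
  exact: fil_D.
- move=> n k x _ IH; rewrite (linZ euler_lin) scalerA mulrC -scalerA -scalerBr.
  exact: fil_Z.
move=> n v a fa IH /=; case: n fa IH => [|k] fa IH.
  by rewrite (fil0 fa) amul0r (lin0 euler_lin) scaler0 subrr; apply: fil_0.
have ft i : fil k (xa co (tcoord i) a).
  by apply: (fil_xa fa).2; [exact: tcoord_lin | exact: tcoord1].
pose yi i : H -> K^o := fun h => tcoord i ((Ugen (kap v) : H) ** h).
have lyi i : linear (yi i) by apply: lin_mull; apply: tcoord_lin.
have yi1 i : yi i aone = coord b i v.
  by rewrite /yi amula1 /tcoord tV_kap.
(* Moving t_i past [gam v] contributes coord_i(v) times [gam b_i ** a]. These terms sum to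
   [gam v ** a], which raises the eigenvalue by one; the commutators and the augmented remainders
   have lower degree. *)
have E : euler (gam v ** a) = gam v ** euler a + gam v ** a +
   \sum_(i < \dim {:V})
   ((gam b`_i ** gam v - gam v ** gam b`_i) ** xa co (tcoord i) a +
    gam b`_i ** xa co (aug (yi i)) a).
  have {2}-> : gam v ** a = \sum_(i < \dim {:V}) coord b i v *: (gam b`_i ** a).
    rewrite {1}[v]vdec (lin_sum _ _ _ gam_lin) (lin_sum _ _ _ (amul_linl a)).
    by apply: eq_bigr => i _; rewrite (linZ gam_lin) amulZl.
  rewrite /euler (lin_sum _ _ _ (amul_linr (gam v))) -!big_split.
  apply: eq_bigr => i _ /=.
  rewrite (@xa_prim _ _ _ _ co_hom _ (Ugen (kap v))) ?co_gam //; last exact: tcoord_lin.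
  rewrite -[X in _ ** (_ + X)]/(xa co (yi i) a) (xa_aug co_counit a (lyi i)).
  rewrite yi1 !amulDr amulZr amulDl amulNl !amulA.
  by rewrite [RHS](AC (2*(2*1)) ((3*(2*5))*(1*4))) /= subrr addr0.
rewrite E; have -> : k.+1%:R *: (gam v ** a) =
    gam v ** (k%:R *: a) + gam v ** a.
  by rewrite amulZr -[k.+1]addn1 natrD scalerDl scale1r.
rewrite addrAC opprD addrACA subrr addr0 -amulNr -amulDr.
apply: fil_D; first by apply: fil_M.
apply: (sub_sum (fil_sub _)) => i _; apply: fil_D; first exact: fil_comm.
apply: fil_M; apply: (fil_xa fa).2; [exact: aug_lin | exact: aug1].
Qed.

End WordFiltration.

(** * Primitive elements of U(g) in characteristic zero *)

Section CharZero.
Variables (K : fieldType).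
Hypothesis char0 : forall n, n.+1%:R != 0 :> K.

Lemma sub_natZ (V : lmodType K) (P : V -> Prop) n x : subspace P ->
  P (n.+1%:R *: x) -> P x.
Proof.
by move=> sP /(subZ sP n.+1%:R^-1); rewrite scalerA mulVf // scale1r.
Qed.

Section Primitive.
Variable g : lieAlg K.
Local Notation H := (UH g).
Lemma UH_comm (v w : g) : exists (u : g) (c : K),
  (Ugen v : H) ** Ugen w = (Ugen w : H) ** Ugen v + (Ugen u : H) + c *: aone.
Proof. by exists (lie_br v w), 0; rewrite scale0r addr0; exact: UgenM. Qed.
Lemma UH_fil (h : H) : exists n, fil (@Ugen K g : g -> H) n h.
Proof.
elim/U_ind_left: h => [||x u [n fu]].
- by exists 1%N; apply: fil_1.
- split; first by exists 0%N; apply: fil_0.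
  move=> k x y [n fx] [m fy]; exists (maxn n m).
  apply: (fil_sub _ _).2; [apply: fil_le fx | apply: fil_le fy].
    exact: leq_maxl.
  exact: leq_maxr.
by exists n.+1; apply: fil_M.
Qed.

Lemma UH_counit (h : H) : ev (@heps K H) (hD h) = h.
Proof. exact: heps_l. Qed.

(** Friedrichs' theorem. On a primitive p the Euler operator returns an element of g, while modulo
    lower degree it multiplies p by its degree. Dividing by the degree lowers it repeatedly until p
    lies in g plus scalars, and the counit excludes the scalar. *)
Lemma primitive_gen (p : H) : hD p = p \ox aone + aone \ox p ->
  exists x : g, p = Ugen x.
Proof.
move=> pp; have [n fp] := UH_fil p.
have eps1 : heps (aone : H) = 1 := heps1 _.
have lg := @Ugen_lin K g.
have xaE y : linear y -> y aone = 0 -> xa (@hD K H) y p = (y p : K) *: aone.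
  move=> ly y1; rewrite /xa pp (linD (ev_lin ly)) !evE // y1 scale0r addr0 //.
pose E := euler (@hD K H) (@Ugen K g : g -> H) (@Ugen_coef K g).
have EE : E p = Ugen (Ugen_coef p).
  rewrite [in RHS](vdec (Ugen_coef p)) (lin_sum _ _ _ lg) /E /euler.
  apply: eq_bigr => i _; rewrite xaE.
  - by rewrite amulZr amula1 (linZ lg).
  - exact: tcoord_lin (@Ugen_coef_lin K g) i.
  - exact: tcoord1 (@Ugen_coef1 K g) i.
have fE m : fil (@Ugen K g : g -> H) m p ->
    fil (@Ugen K g : g -> H) m.-1 (Ugen (Ugen_coef p) - m.-1%:R *: p).
  rewrite -EE; apply: (@fil_euler K g H (@hD K H) (hD_hom H) UH_counit g
    (@Ugen K g) id (@Ugen_coef K g)).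
  - exact: lg.
  - exact: Ugen_coef_lin.
  - by move=> v; exact: UHD_gen.
  - exact: Ugen_coef1.
  - exact: Ugen_coef_gen.
  - exact: UH_comm.
have epsp : heps p = 0.
  have := UH_counit p; rewrite -/(xa _ _ _) /xa pp (linD (ev_lin (@heps_lin K H))).
  rewrite !evE; try exact: heps_lin.
  rewrite heps1 scale1r => /(canRL (addrK _)); rewrite subrr => /(congr1 (@heps K H)).
  by rewrite (lin0 (@heps_lin K H)) (linZ (@heps_lin K H)) heps1 /GRing.scale /= mulr1.
suff f2 : fil (@Ugen K g : g -> H) 2 p.
  have /fil1 [c] := fE 2 f2; rewrite /= scale1r => Ec.
  have c0 : c = 0.
    have := congr1 (@heps K H) Ec; rewrite (linB _ _ (@heps_lin K H)) epsp subr0.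
    by rewrite UHeps_gen (linZ (@heps_lin K H)) heps1 => ->; rewrite /GRing.scale /= mulr1.
  by exists (Ugen_coef p); apply/eqP; rewrite eq_sym -subr_eq0 Ec c0 scale0r.
elim: n fp => [|[|n] IH] fp.
- exact: (fil_le _ fp).
- exact: (fil_le _ fp).
case: n IH fp => [//|n] IH fp; apply: IH.
have := fE _ fp; rewrite /= => f.
have fg : fil (@Ugen K g : g -> H) n.+2 (Ugen (Ugen_coef p)).
  apply: (@fil_le _ _ _ _ 2) => //.
  rewrite -[Ugen _](@amula1 K H); apply: fil_M; exact: fil_1.
have := subB (fil_sub _ _) fg f; rewrite opprB addrC subrK.
exact: sub_natZ (fil_sub _ _).
Qed.

End Primitive.

End CharZero.

(** A [{vspace V}] of maximal dimension inside P exhausts P, as any further vector of P would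
    enlarge it. *)
Lemma subspace_vspace (K : fieldType) (V : vectType K) (P : V -> Prop) :
  subspace P -> exists U : {vspace V}, forall x, x \in U <-> P x.
Proof.
move=> sP.
pose Q (n : nat) := `[< exists2 U : {vspace V}, (forall x, x \in U -> P x) & \dim U = n >].
have Q0 : exists n, Q n.
  exists 0%N; apply/asboolP; exists 0%VS; last exact: dimv0.
  by move=> x; rewrite memv0 => /eqP ->; apply: sub0.
have Qb n : Q n -> (n <= \dim {:V})%N.
  by move=> /asboolP [U _ <-]; apply: dimvS; apply: subvf.
case: (ex_maxnP Q0 Qb) => n /asboolP [U UP Un] max.
exists U => x; split; first exact: UP.
move=> Px; apply: contrapT => xU.
have : Q (\dim (U + <[x]>)%VS).
  apply/asboolP; exists (U + <[x]>)%VS => // y /memv_addP [u uU [v /vlineP [k ->] ->]].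
  by apply: subD => //; [apply: UP|apply: subZ].
move/max; rewrite -Un leqNgt => /negP; apply.
rewrite (ltn_leqif (dimv_leqif_eq (addvSl _ _))); apply/negP => /eqP E.
by apply: xU; rewrite E memvE addvSr.
Qed.

(** * Generation of Z by lifts of elements of g *)

Section CoinvariantScalars.
Variables (K : fieldType).
Hypothesis char0 : forall n, n.+1%:R != 0 :> K.
Variable g : lieAlg K.
Local Notation H := (UH g).
Variables (A : pzAlgType K) (co : A -> tens H A).
Hypothesis co_hom : alg_hom co.
Hypothesis co_counit : forall a, ev (@heps K H) (co a) = a.
Hypothesis coA : forall a, tassoc (tmap id co (co a)) = tmap (@hD K H) id (co a).
Hypothesis A1 : (aone : A) <> 0.
Variable Z : A -> Prop.
Hypothesis Zsub : subspace Z.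
Hypothesis ZM : forall a b, Z a -> Z b -> Z (a ** b).
Hypothesis Z1 : Z aone.
Hypothesis Zxa : forall (y : H -> K^o) a, linear y -> Z a -> Z (xa co y a).
Hypothesis Zco : forall a, Z a -> co a = aone \ox a -> exists c : K, a = c *: aone.
Implicit Types (y z : H -> K^o) (a b : A).

Let lxa y (ly : linear y) := xa_lin co_hom ly.

Lemma UH_xnil (h : H) n : fil (@Ugen K g : g -> H) n h -> xnil (@hD K H) n h.
Proof.
elim: n h => [|n IH] h f; first exact: (fil0 f).
move=> /= y ly y1; apply: IH.
have := @fil_xa K g H (@hD K H) (hD_hom H) g (@Ugen K g) id _ n.+1 h f.
by case=> [|_ /(_ y ly y1)] //; move=> v; exact: UHD_gen.
Qed.

(** The coaction of a involves finitely many elements of U(g), all of bounded word length, and the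
    augmentation ideal of X lowers that length. *)
Lemma xnil_exists a : exists n, xnil co n a.
Proof.
have [m [h [v E]]] := tens_sumP (co a).
have [n hn] : exists n, forall i, fil (@Ugen K g : g -> H) n (h i).
  elim: m h {v E} => [|m IH] h; first by exists 0%N => -[].
  have [n hn] := IH (fun i => h (lift ord0 i)).
  have [n' hn'] := UH_fil (h ord0).
  exists (maxn n n') => i; case: (unliftP ord0 i) => [j ->|->].
    by apply: (fil_le (leq_maxl _ _)); apply: hn.
  by apply: (fil_le (leq_maxr _ _)).
exists n.
(* This expansion passes to y(a) with each [h i] replaced by [xa hD y (h i)], so the induction needs
   no further knowledge of a. *)
have {E} : forall z, linear z -> xa co z a = \sum_i (z (h i) : K) *: v i.
  move=> z lz; rewrite /xa E (lin_sum _ _ _ (ev_lin lz)).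
  by apply: eq_bigr => i _; rewrite evE.
have {hn} : forall i, xnil (@hD K H) n (h i) by move=> i; apply: UH_xnil.
elim: n h a => [|n IH] h a hn E /=.
  rewrite -[a]co_counit -/(xa co _ a) E; last exact: heps_lin.
  by rewrite big1 // => i _; rewrite (hn i : h i = 0) (lin0 (@heps_lin K H)) scale0r.
move=> y ly y1; apply: (IH (fun i => xa (@hD K H) y (h i))).
  by move=> i; apply: (hn i).
move=> z lz; rewrite xa_xa // E //.
exact: (lin_comp (lin_comp (@hD_lin K H) (ev_lin ly)) lz).
Qed.

(** The elements of Z killed by the n-th power of the augmentation ideal of X, a coradical
    filtration shifted by one: [G 0] is zero and, by [G1], elements of [G 1] are scalars. *)
Fixpoint G n a : Prop :=
  if n is n'.+1 then Z a /\ forall y, linear y -> y aone = 0 -> G n' (xa co y a)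
  else a = 0.

Lemma G_sub n : subspace (G n).
Proof.
elim: n => [|n IH] /=.
  by split=> // k x y -> ->; rewrite scaler0 addr0.
split=> [|k a b [Za Ga] [Zb Gb]]; split.
- exact: sub0.
- by move=> y ly _; rewrite (lin0 (lxa ly)); apply: sub0.
- exact: Zsub.2.
- by move=> y ly y1; rewrite lxa //; apply: IH.2; [apply: Ga|apply: Gb].
Qed.
Lemma G1 a : G 1 a -> exists c : K, a = c *: aone.
Proof.
move=> [Za Ga]; apply: Zco => //; apply: tens_sep2 => y ly.
rewrite evE // -/(xa co y a) (xa_aug co_counit) //.
by rewrite (Ga _ (aug_lin ly) (aug1 y)) addr0.
Qed.
Lemma G_exists a : Z a -> exists n, G n a.
Proof.
have [n an] := xnil_exists a => Za; exists n.
elim: n a an Za => [//|n IH] a an Za; split=> // y ly y1.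
by apply: IH; [apply: an|apply: Zxa].
Qed.

Definition symb (x : g) : Prop :=
  exists2 a, Z a & co a = (Ugen x : H) \ox aone + aone \ox a.

(** In degree two every y(a) with y(1) = 0 is scalar, so the coaction of a is [p \ox 1 + 1 \ox a].
    Coassociativity makes p primitive, hence an element of g lifted by a, on which z vanishes. *)
Lemma G2_symb z a : linear z -> z aone = 0 ->
  (forall x, symb x -> z (Ugen x) = 0) -> G 2 a -> xa co z a = 0.
Proof.
move=> lz z1 zs [Za Ga].
have s0 : subspace (fun a : A => a = 0).
  by split=> // k x y -> ->; rewrite scaler0 addr0.
have [l [ll _ l1]] := separation s0 A1.
have bl : bilin (fun (h : H) a => (l a : K) *: h).
  split=> b; first exact: (lin_scale _ (@lin_id _ _)).
  exact: (lin_scalel _ ll).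
(* The second factors of w turn out to be scalars; l, normalized by l(1) = 1, reads them off. *)
pose w := co a - aone \ox a; pose p := tenslift (fun (h : H) a => (l a : K) *: h) w.
have lev (y : H -> K^o) t : linear y ->
    y (tenslift (fun (h : H) a => (l a : K) *: h) t) = l (ev y t).
  move=> ly; move: t; apply: tens_ext => [||h b].
  - exact: (lin_comp (tenslift_lin bl) ly).
  - exact: (lin_comp (ev_lin ly) ll).
  by rewrite tensliftE // evE // (linZ ly) (linZ ll) /GRing.scale /= mulrC.
have Ea : co a = p \ox aone + aone \ox a.
  apply/eqP; rewrite -subr_eq; apply/eqP/tens_sep2 => y ly.
  rewrite evE // /p lev // -/w /w (linB _ _ (ev_lin ly)) evE //.
  rewrite -/(xa co y a) (xa_aug co_counit) // addrC addKr.
  have [c ->] := G1 (Ga _ (aug_lin ly) (aug1 y)).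
  by rewrite (linZ ll) l1 /GRing.scale /= mulr1.
have := coA a; have [lc c1 _] := co_hom.
rewrite Ea !(linD (tmap_lin _ _)) //; try exact: hD_lin.
rewrite !tmapE //; try exact: hD_lin.
rewrite c1 Ea hD1 (linD (tpure_linr _)) !(linD (@tassoc_lin _ _ _ _)) !tassocE addrA.
move/addIr; rewrite -(linD (tpure_linl _)).
move=> /(congr1 (tenslift (fun (h : tens H H) a => (l a : K) *: h))).
rewrite !tensliftE ?l1 ?scale1r; try by split=> b;
  [exact: (lin_scale _ (@lin_id _ _)) | exact: (lin_scalel _ ll)].
move=> Ep; have [x px] := primitive_gen char0 (esym Ep).
rewrite /xa Ea (linD (ev_lin lz)) !evE // z1 scale0r addr0 px zs ?scale0r //.
by exists a => //; rewrite Ea px.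
Qed.

(** A functional vanishing at 1 and on all lifted elements of g lowers the degree by two, as the
    square of the augmentation ideal would. The induction uses that X is commutative. *)
Lemma G_symb z n a : linear z -> z aone = 0 ->
  (forall x, symb x -> z (Ugen x) = 0) -> G n.+2 a -> G n (xa co z a).
Proof.
move=> lz z1 zs; elim: n a => [|n IH] a; first exact: G2_symb.
move=> [Za Ga]; split; first exact: Zxa.
by move=> y ly y1; rewrite xa_comm //; apply: IH; apply: Ga.
Qed.

Section Generation.
Variables (V : vectType K) (s : V -> A) (kap : V -> g) (tV : H -> V).
Hypotheses (s_lin : linear s) (kap_lin : linear kap) (tV_lin : linear tV).
Hypothesis co_s : forall v, co (s v) = (Ugen (kap v) : H) \ox aone + aone \ox s v.
Hypothesis Zs : forall v, Z (s v).
Hypothesis tV1 : tV aone = 0.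
Hypothesis tV_kap : forall v, tV (Ugen (kap v)) = v.
Hypothesis symb_kap : forall x, symb x -> exists v, x = kap v.
Local Notation b := (vbasis {:V}).
Local Notation E := (euler co s tV).
Local Notation t := (tcoord tV).

Let lt (i : 'I_(\dim {:V})) : linear (t i) := tcoord_lin tV_lin i.
Let t1 i : t i aone = 0 := tcoord1 tV1 i.

(** The counterpart of [fil_euler] without words: membership in [G] is tested by applying every y of
    the augmentation ideal. Then y(E a) is E(y(a)), plus sum_i y(x_i) t_i(a), plus terms in which
    two augmented functionals act; the middle sum supplies the extra unit in the eigenvalue. *)
Lemma G_euler n a : G n.+1 a -> G n (E a - n%:R *: a).
Proof.
elim: n a => [|n IH] a Ga.
  have [c ->] := G1 Ga; rewrite scale0r subr0 /=.
  rewrite /euler big1 // => i _.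
  by rewrite (linZ (lxa (lt i))) xa_1 // t1 scale0r scaler0 amul0r.
have [Za Gy] := Ga.
split.
  apply: (subB Zsub); last exact: subZ.
  apply: (sub_sum Zsub) => i _; apply: ZM => //; exact: Zxa.
move=> y ly y1.
have Gt i : G n.+1 (xa co (t i) a) by apply: Gy.
pose yi i : H -> K^o := fun h => y ((Ugen (kap b`_i) : H) ** h).
have lyi (i : 'I_(\dim {:V})) : linear (yi i) by apply: lin_mull.
(* Subtracting sum_i y(x_i) t_i makes y vanish on the span h of the x_i, so that [G_symb] applies:
   modulo functionals lowering the degree by two, the t_i account for y. *)
pose z : H -> K^o := fun h =>
  (-1) *: (\sum_(i < \dim {:V}) (y (Ugen (kap b`_i)) : K) *: t i h) + y h.
have lz0 : linear (fun h => \sum_(i < \dim {:V}) (y (Ugen (kap b`_i)) : K) *: t i h : K^o).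
  move=> k h h'; rewrite scaler_sumr -big_split; apply: eq_bigr => i _.
  by rewrite lt scalerDr !scalerA mulrC.
have lz : linear z by apply: lin_add => //; apply: lin_scale.
have zE c : xa co z c = xa co y c -
   \sum_(i < \dim {:V}) (y (Ugen (kap b`_i)) : K) *: xa co (t i) c.
  rewrite /z xa_linl // scaleN1r addrC; congr (_ - _).
  rewrite /xa; move: (co c); apply: tens_ext => [||h d].
  - exact: ev_lin.
  - move=> k u v; rewrite scaler_sumr -big_split; apply: eq_bigr => i _.
    by rewrite (ev_lin (lt i)) scalerDr !scalerA mulrC.
  rewrite evE // scaler_suml; apply: eq_bigr => i _.
  by rewrite evE // scalerA.
have Gz : G n (xa co z a).
  apply: G_symb => //.
    rewrite /z y1 big1 ?scaler0 ?addr0 // => i _.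
    by rewrite t1 scaler0.
  move=> x /symb_kap [v ->]; rewrite /z.
  rewrite {2}[v]vdec (lin_sum _ _ _ kap_lin) (lin_sum _ _ _ (@Ugen_lin K g)).
  rewrite (lin_sum _ _ _ ly) scaleN1r addrC; apply/eqP; rewrite subr_eq0; apply/eqP.
  apply: eq_bigr => i _; rewrite /tcoord tV_kap (linZ kap_lin) (linZ (@Ugen_lin K g)).
  by rewrite (linZ ly) /GRing.scale /= mulrC.
have -> : xa co y (E a - n.+1%:R *: a) =
   (E (xa co y a) - n%:R *: xa co y a) - xa co z a +
   \sum_(i < \dim {:V}) xa co (aug (yi i)) (xa co (t i) a).
  rewrite (linB _ _ (lxa ly)) (linZ (lxa ly)) zE -[n.+1]addn1 natrD scalerDl scale1r.
  have -> : xa co y (E a) = E (xa co y a) +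
     (\sum_(i < \dim {:V}) (y (Ugen (kap b`_i)) : K) *: xa co (t i) a +
     \sum_(i < \dim {:V}) xa co (aug (yi i)) (xa co (t i) a)).
    rewrite /euler (lin_sum _ _ _ (lxa ly)) -!big_split; apply: eq_bigr => i _ /=.
    rewrite (xa_prim co_hom _ ly (co_s _)) -/(yi i).
    rewrite -[X in _ + X = _]/(xa co (yi i) (xa co (t i) a)).
    rewrite (xa_aug co_counit _ (lyi i)) (xa_comm co_hom coA) //.
    by rewrite {1}/yi amula1.
  by rewrite !opprD opprK [LHS](AC ((1*2)*2) (((1*4)*(5*2))*3)).
apply: (subD (G_sub _)).
  by apply: (subB (G_sub _)) => //; apply: IH; apply: Gy.
apply: (sub_sum (G_sub _)) => i _; have [_ h] := Gt i.
by apply: h; [apply: aug_lin | apply: aug1].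
Qed.

(** Modulo lower degree n a equals E a = sum_i s_i t_i(a), and the t_i(a) have lower degree; both
    are covered by the induction, and n is invertible. *)
Lemma G_generated (Im : A -> Prop) : subspace Im -> Im aone ->
  (forall v a, Im a -> Im (s v ** a)) -> forall n a, G n a -> Im a.
Proof.
move=> sI I1 Is; elim=> [|n IH] a Ga; first by rewrite (Ga : a = 0); apply: sub0.
case: n IH Ga => [|n] IH Ga.
  by have [c ->] := G1 Ga; apply: subZ.
apply: (@sub_natZ _ char0 _ _ n) => //.
have := IH _ (G_euler Ga); move/(subN sI); rewrite opprB => /(subD sI).
move=> /(_ (E a)); rewrite subrK; apply.
apply: (sub_sum sI) => i _; apply: Is; apply: IH; exact: Ga.2.
Qed.
End Generation.
End CoinvariantScalars.

Lemma ev_hom (K : fieldType) (H A : pzAlgType K) (y : H -> K^o) :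
  alg_hom y -> alg_hom (@ev K H A y).
Proof.
move=> [ly y1 yM]; split; first exact: ev_lin.
  by rewrite toneE evE // y1 scale1r.
move=> t u; move: t; apply: tens_ext => [||a b].
- exact: (lin_comp (amul_linl u) (ev_lin ly)).
- exact: (lin_comp (ev_lin ly) (amul_linl _)).
move: u; apply: tens_ext => [||a' b'].
- exact: (lin_comp (amul_linr _) (ev_lin ly)).
- exact: (lin_comp (ev_lin ly) (amul_linr _)).
by rewrite tmulE !evE // yM amulZl amulZr scalerA.
Qed.

(** * Scalar coinvariants and U_phi *)

Section TwistedCoaction.
Variables (K : fieldType) (g : lieAlg K) (h : {vspace g}) (hc : lie_closed h).
Local Notation H := (UH g).
Local Notation L := (lie_sub hc).
Local Notation j := (Umap (lie_sub_hom hc)).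
Variables (phi : L -> L -> K^o) (phiC : cocycle2 phi).
Local Notation U := (Uphi phiC).

(* The antipode appears because Diff A has
   (1 (x) a) * (1 (x) b) = (S(b_1) (x) 1) (x)_H (1 (x) a b_0). *)
Definition uco (u : U) : tens H U :=
  tswap (tmap id (fun v => j (hS v)) (Uphi_co u)).

Let jS (v : opalg (UH L)) : H := j (hS (unop v)).
Let jS_hom : alg_hom jS.
Proof.
have [lj j1 jM] := hopf_fun_hom j; split.
- exact: (lin_comp (lin_comp (@unop_lin _ _) (@hS_lin _ _)) lj).
- by rewrite /jS -j1; congr (j _); exact: UHS_1.
by move=> x y; rewrite /jS opmulE UHS_M jM.
Qed.
Lemma jS_lin : linear (fun v : UH L => j (hS v)).
Proof.
have [lj j1 jM] := hopf_fun_hom j.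
exact: (lin_comp (@hS_lin _ _) lj).
Qed.
Lemma ucoE u : uco u = tswap (tmap id jS (rho u)).
Proof.
rewrite /uco /Uphi_co tmap_comp //; exact: jS_lin.
Qed.
Lemma uco_hom : alg_hom uco.
Proof.
have -> : uco = fun u => tswap (tmap id jS (rho u)) by apply/funext => u; exact: ucoE.
have h1 := hom_comp (rho_hom phiC) (tmap_hom (hom_id U) jS_hom).
exact: (hom_comp h1 (@tswap_hom K _ _)).
Qed.
Lemma Uphi_pgen (u : hat_op phiC) :
  pgen (@Uphi_rel K L phi phiC) u = Uphi_gen phiC u.1 + (u.2 : K) *: aone.
Proof.
have c1 : pgen (@Uphi_rel K L phi phiC) ((0, 1) : hat_op phiC) = aone.
  have /palg_rel // : Uphi_rel (AGen ((0, 1) : hat_op phiC)) AOne by right.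
rewrite -c1 -(linZ (@pgen_lin _ _ _)) -(linD (@pgen_lin _ _ _)); congr pgen.
case: u => x c; congr pair => /=; first by rewrite scaler0 addr0.
by rewrite add0r /GRing.scale /= mulr1.
Qed.
Lemma Uphi_gen_lin : linear (Uphi_gen phiC).
Proof.
by move=> k u v; rewrite /Uphi_gen -(@pgen_lin _ _ _); congr pgen; congr pair;
   rewrite /= scaler0 addr0.
Qed.
Lemma Uphi_genM (x y : L) : Uphi_gen phiC x ** Uphi_gen phiC y =
  Uphi_gen phiC y ** Uphi_gen phiC x - Uphi_gen phiC (lie_br x y) +
  (phi x y : K) *: aone.
Proof.
have /palg_rel /= E : Uphi_rel
  (AMul (AGen ((x, 0) : hat_op phiC)) (AGen ((y, 0) : hat_op phiC)))
  (AAdd (AMul (AGen ((y, 0) : hat_op phiC)) (AGen ((x, 0) : hat_op phiC)))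
     (AGen (@lie_br _ (hat_op phiC) (x, 0) (y, 0)))) by left.
rewrite [LHS]E (Uphi_pgen (@lie_br K (hat_op phiC) (x, 0) (y, 0))) addrA.
congr (_ + _ + _).
rewrite -[_.1]/(lie_br y x) lie_anti.
exact: linN Uphi_gen_lin _.
Qed.
(** The sign cancels the one from the antipode in [uco] and turns the opposite bracket of U_phi into
    that of h. *)
Definition ugam (x : L) : U := - Uphi_gen phiC x.
Lemma ugam_lin : linear ugam. Proof. exact: (lin_opp Uphi_gen_lin). Qed.
Lemma uco_ugam x : uco (ugam x) = (Ugen (vsval x) : H) \ox aone + aone \ox ugam x.
Proof.
have [lu _ _] := uco_hom; have [lj j1 jM] := jS_hom.
rewrite /ugam (linN lu) ucoE rho_gen (linD (tmap_lin (@lin_id _ _) lj)) !tmapE //.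
rewrite j1 (linD (@tswap_lin _ _ _)) !tswapE opprD addrC; congr (_ + _).
  rewrite /jS /unop /toop UHS_gen (linN (let: And3 l _ _ := hopf_fun_hom j in l)).
  by rewrite (linN (tpure_linl _)) opprK -[j _]/(Umap_fun _ _)
    (Umap_gen (lie_sub_hom hc)).
exact/esym/(linN (tpure_linr _)).
Qed.
Lemma ugam_comm (v w : L) : exists (u : L) (c : K),
  ugam v ** ugam w = ugam w ** ugam v + ugam u + c *: aone.
Proof.
exists (lie_br v w), (phi v w).
by rewrite /ugam !amulNl !amulNr !opprK Uphi_genM.
Qed.
Lemma uco_counit u : ev (@heps K H) (uco u) = u.
Proof.
have hh := hom_comp uco_hom (ev_hom U (heps_hom H)).
apply: (palg_ext hh (hom_id _)) => -[x c].
have [lu u1 _] := uco_hom; have le := ev_lin (V := U) (@heps_lin K H).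
rewrite Uphi_pgen (linD lu) (linZ lu) u1 (linD le) (linZ le) toneE.
rewrite evE ?heps1 ?scale1r; last exact: heps_lin.
congr (_ + _); have -> /= : Uphi_gen phiC x = - ugam x by rewrite opprK.
rewrite (linN lu) uco_ugam (linN le) (linD le) !evE; try exact: heps_lin.
by rewrite UHeps_gen scale0r heps1 scale1r add0r.
Qed.
Definition utV (u : H) : L := vsproj h (Ugen_coef u).
Lemma utV_lin : linear utV.
Proof. by move=> k x y; rewrite /utV Ugen_coef_lin linearP. Qed.
Lemma utV1 : utV aone = 0.
Proof. by rewrite /utV Ugen_coef1 linear0. Qed.
Lemma utV_val x : utV (Ugen (vsval x)) = x.
Proof. by rewrite /utV Ugen_coef_gen vsvalK. Qed.

Lemma Uphi_fil (u : U) : exists n, fil ugam n u.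
Proof.
elim/palg_ind_left: u => [||[x c] u [n fu]].
- by exists 1%N; apply: fil_1.
- split; first by exists 0%N; apply: fil_0.
  move=> k x y [n fx] [m fy]; exists (maxn n m).
  apply: (fil_sub _ _).2; [apply: fil_le fx | apply: fil_le fy].
    exact: leq_maxl.
  exact: leq_maxr.
exists n.+1; rewrite Uphi_pgen amulDl amulZl amul1a /=; apply: fil_D.
  have -> : Uphi_gen phiC x = (-1) *: ugam x by rewrite /ugam scaleN1r opprK.
  by rewrite amulZl; apply: fil_Z; apply: fil_M.
by apply: fil_Z; apply: fil_S.
Qed.

Hypothesis char0 : forall n, n.+1%:R != 0 :> K.
(** Let u in the kernel have minimal degree. As psi respects the coactions, each y(u) with y(1) = 0
    is in the kernel and of lower degree, hence zero. So E u = 0, and E u being a multiple of u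
    modulo lower degree makes u a scalar, which psi does not kill. *)
Lemma Uphi_inj (A : pzAlgType K) (co : A -> tens H A) (psi : U -> A) :
  (aone : A) <> 0 -> alg_hom psi ->
  (forall u, co (psi u) = tmap id psi (uco u)) -> injective psi.
Proof.
move=> A1 [lp p1 _] pco.
suff inj0 n : forall u, fil ugam n u -> psi u = 0 -> u = 0.
  move=> u v E; apply/eqP; rewrite -subr_eq0; apply/eqP.
  have [n f] := Uphi_fil (u - v); apply: (inj0 n) => //.
  by rewrite (linB _ _ lp) E subrr.
have pxa (y : H -> K^o) u : linear y -> psi (xa uco y u) = xa co y (psi u).
  by move=> ly; rewrite /xa pco ev_tmap.
elim: n => [|n IH] u fu pu; first exact: fil0 fu.
have xu (y : H -> K^o) : linear y -> y aone = 0 -> xa uco y u = 0.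
  move=> ly y1; apply: IH.
    exact: ((fil_xa uco_hom uco_ugam fu).2 y ly y1).
  rewrite pxa // pu; rewrite /xa -(lin0 lp) pco.
  have [lu _ _] := uco_hom; rewrite (lin0 lu) (lin0 (tmap_lin (@lin_id _ _) lp)).
  by rewrite (lin0 (ev_lin ly)) (lin0 lp).
have /= := fil_euler uco_hom uco_counit ugam_lin utV_lin uco_ugam utV1 utV_val
  ugam_comm fu.
have -> : euler uco ugam utV u = 0.
  rewrite /euler big1 // => i _; rewrite xu ?amul0r //.
    exact: (tcoord_lin utV_lin).
  exact: (tcoord1 utV1).
rewrite sub0r; case: n IH fu => [|n] IH fu f; last first.
  apply: IH => //; apply: (@sub_natZ _ char0 _ _ n u (fil_sub ugam _)).
  by have := subN (fil_sub ugam _) f; rewrite opprK.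
have [c Ec] := fil1 fu; move: pu; rewrite Ec (linZ lp) p1 => c1.
case: (eqVneq c 0) => [->|c0]; first by rewrite scale0r.
by case: A1; rewrite -[aone]scale1r -(mulVf c0) -scalerA c1 scaler0.
Qed.
End TwistedCoaction.

Section Commutator.
Variables (K : fieldType) (A : pzAlgType K).
Implicit Types x y z : A.
Definition comm x y : A := x ** y - y ** x.
Lemma comm_linl y : linear (comm^~ y).
Proof. exact: (lin_add (amul_linl y) (lin_opp (amul_linr y))). Qed.
Lemma comm_linr x : linear (comm x).
Proof. exact: (lin_add (amul_linr x) (lin_opp (amul_linl x))). Qed.
Lemma comm_scal x (c : K) : comm x (c *: aone) = 0.
Proof. by rewrite /comm amulZl amulZr amula1 amul1a subrr. Qed.
Lemma comm_scall x (c : K) : comm (c *: aone) x = 0.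
Proof. by rewrite /comm amulZl amulZr amula1 amul1a subrr. Qed.
Lemma comm_jacobi x y z :
  comm x (comm y z) + comm y (comm z x) + comm z (comm x y) = 0.
Proof.
rewrite /comm !(amulDl, amulDr, amulNl, amulNr) !amulA !opprD !opprK.
set a := x ** y ** z; set b := x ** z ** y; set c := y ** z ** x.
set d := z ** y ** x; set e := y ** x ** z; set f := z ** x ** y.
have E (p q : A) : p - p + q = q by rewrite subrr add0r.
by rewrite [LHS](AC ((2*2)*(2*2)*(2*2))
  ((1*11)*((8*2)*((5*3)*((4*10)*((12*6)*(9*7))))))) /= !E subrr.
Qed.
End Commutator.

(** * The subalgebra h, the cocycle and the map from U_phi *)

Section CoinvariantScalars.
Variables (K : fieldType).
Hypothesis char0 : forall n, n.+1%:R != 0 :> K.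
Variable g : lieAlg K.
Local Notation H := (UH g).
Variables (A : pzAlgType K) (co : A -> tens H A).
Hypothesis co_hom : alg_hom co.
Hypothesis co_counit : forall a, ev (@heps K H) (co a) = a.
Hypothesis coA : forall a, tassoc (tmap id co (co a)) = tmap (@hD K H) id (co a).
Hypothesis A1 : (aone : A) <> 0.
Variable Z : A -> Prop.
Hypothesis Zsub : subspace Z.
Hypothesis ZM : forall a b, Z a -> Z b -> Z (a ** b).
Hypothesis Z1 : Z aone.
Hypothesis Zxa : forall (y : H -> K^o) a, linear y -> Z a -> Z (xa co y a).
Hypothesis Zco : forall a, Z a -> co a = aone \ox a -> exists c : K, a = c *: aone.

Lemma symb_sub : subspace (symb co Z).
Proof.
have [lc _ _] := co_hom.
split; first by exists 0; [exact: sub0|rewrite (lin0 lc) (lin0 (@Ugen_lin K g))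
  (lin0 (tpure_linl _)) (lin0 (tpure_linr _)) addr0].
move=> k x y [a Za Ea] [b Zb Eb]; exists (k *: a + b); first exact: Zsub.2.
rewrite lc Ea Eb (@Ugen_lin K g) tpure_linl tpure_linr scalerDr.
by rewrite addrACA.
Qed.
Lemma symb_br x y : symb co Z x -> symb co Z y -> symb co Z (lie_br x y).
Proof.
have [lc _ cM] := co_hom.
move=> [a Za Ea] [b Zb Eb]; exists (comm a b).
  by apply: (subB Zsub); apply: ZM.
rewrite /comm (linB _ _ lc) !cM Ea Eb !amulDl !amulDr !tmulE !amul1a !amula1.
have -> : (Ugen x : H) ** Ugen y = (Ugen y : H) ** Ugen x + Ugen (lie_br x y).
  exact: UgenM.
rewrite (linD (tpure_linl _)) (linB _ _ (tpure_linr _)) !opprD.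
set p := (Ugen y ** Ugen x) \ox aone; set q := Ugen (lie_br x y) \ox aone.
set r := Ugen x \ox b; set s := Ugen y \ox a; set t := aone \ox (a ** b).
have E (u v : tens H A) : u - u + v = v by rewrite subrr add0r.
by rewrite [LHS](AC ((((2*1)*2))*(2*2)) ((1*6)*((3*8)*((4*7)*(2*(5*9)))))) /= !E.
Qed.

Theorem coinvariants_scalar_Uphi :
  exists (h : {vspace g}) (hc : lie_closed h)
    (phi : lie_sub hc -> lie_sub hc -> K^o) (phiC : cocycle2 phi)
    (psi : Uphi phiC -> A),
    [/\ alg_hom psi, forall u, co (psi u) = tmap id psi (uco u), injective psi,
      forall u, Z (psi u) & forall a, Z a -> exists u, a = psi u].
Proof.
have [lc c1 cM] := co_hom.
have [h hP] := subspace_vspace symb_sub.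
have hc : lie_closed h.
  by move=> x y /hP sx /hP sy; apply/hP; apply: symb_br.
exists h, hc; set L := lie_sub hc.
have bex (i : 'I_(\dim {:L})) : exists a : A, Z a /\
    co a = (Ugen (vsval (vbasis {:L})`_i) : H) \ox aone + aone \ox a.
  have /hP [a Za Ea] : vsval (vbasis {:L})`_i \in h by exact: subvsP.
  by exists a.
pose a i := projT1 (cid (bex i)).
have aP i : Z (a i) /\
    co (a i) = (Ugen (vsval (vbasis {:L})`_i) : H) \ox aone + aone \ox a i.
  by rewrite /a; case: (cid (bex i)).
(* Lifts are chosen on a basis and extended linearly, as arbitrary lifts are only unique up to
   scalars. *)
pose s (v : L) : A := \sum_i coord (vbasis {:L}) i v *: a i.
have s_lin : linear s.
  move=> k v w; rewrite /s scaler_sumr -big_split; apply: eq_bigr => i _.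
  by rewrite linearP scalerDl scalerA.
have Zs v : Z (s v) by apply: (sub_sum Zsub) => i _; apply: subZ; case: (aP i).
have vl : linear (vsval : L -> g) := sub_vlin (h := h).
have co_s v : co (s v) = (Ugen (vsval v) : H) \ox aone + aone \ox s v.
  rewrite {2}[v]vdec /s (lin_sum _ _ _ lc) (lin_sum _ _ _ vl).
  rewrite (lin_sum _ _ _ (@Ugen_lin K g)) (lin_sum _ _ _ (tpure_linl _)).
  rewrite (lin_sum _ _ _ (tpure_linr _)) -big_split; apply: eq_bigr => i _ /=.
  rewrite (linZ lc) (aP i).2 scalerDr (linZ (@Ugen_lin K g)).
  by rewrite (linZ (tpure_linl _)) (linZ (tpure_linr _)).
have sl : subspace (fun a : A => a = 0).
  by split=> // k x y -> ->; rewrite scaler0 addr0.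
have [l [ll _ l1]] := separation sl A1.
(* The failure of s to preserve brackets. The parts of its coaction in g cancel, so it is
   coinvariant and hence a scalar, which l reads off. *)
pose dfc (v w : L) : A := comm (s v) (s w) - s (lie_br v w).
pose phi (v w : L) : K^o := l (dfc v w).
have dfc_phi v w : dfc v w = (phi v w : K) *: aone.
  have [c E] : exists c : K, dfc v w = c *: aone.
    apply: Zco.
      by apply: (subB Zsub) => //; apply: (subB Zsub); apply: ZM.
    rewrite /dfc /comm !(linB _ _ lc) !cM !co_s !amulDl !amulDr !tmulE !amul1a !amula1.
    rewrite [vsval (lie_br v w)]sub_brE //.
    have -> : (Ugen (vsval v) : H) ** Ugen (vsval w) =
      (Ugen (vsval w) : H) ** Ugen (vsval v) + Ugen (lie_br (vsval v) (vsval w)).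
      exact: UgenM.
    rewrite (linD (tpure_linl _)) !(linB _ _ (tpure_linr _)) !opprD.
    have E (p q : tens H A) : p - p + q = q by rewrite subrr add0r.
    by rewrite [LHS](AC (((((2*1)*2))*(2*2))*2)
      ((1*6)*((3*8)*((4*7)*((2*10)*((5*9)*11)))))) /= !E.
  by rewrite /phi E (linZ ll) l1 /GRing.scale /= mulr1.
have phi_bi : bilin phi.
  split=> v; apply: (fun hl => lin_comp hl ll).
    apply: lin_add; first exact: (lin_comp s_lin (comm_linl _)).
    exact: (lin_opp (lin_comp (lie_linl v) s_lin)).
  apply: lin_add; first exact: (lin_comp s_lin (comm_linr _)).
  exact: (lin_opp (lin_comp (lie_linr v) s_lin)).
have sbr v w : s (lie_br v w) = comm (s v) (s w) - (phi v w : K) *: aone.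
  by rewrite -dfc_phi /dfc opprB addrC subrK.
have phiC : cocycle2 phi.
  split=> // [v|u v w].
    by rewrite /phi /dfc lie_alt (lin0 s_lin) /comm !subrr (lin0 ll).
  rewrite /phi -!(linD ll) /dfc.
  (* Scalars are central, so inside a commutator s may be treated as preserving brackets; the
     cocycle identity follows from the Jacobi identities in A and in h. *)
  have cs x y z : comm (s x) (s (lie_br y z)) = comm (s x) (comm (s y) (s z)).
    by rewrite sbr (linB _ _ (comm_linr _)) comm_scal subr0.
  rewrite !cs [X in l (X + _)]addrACA [X in l X]addrACA comm_jacobi add0r.
  by rewrite -!opprD -!(linD s_lin) lie_jacobi (lin0 s_lin) oppr0 (lin0 ll).
(* The minus sign turns the opposite bracket used in U_phi into the commutator of the lifts. *)
pose f (u : hat_op phiC) : A := - s u.1 + (u.2 : K) *: aone.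
have f_lin : linear f.
  move=> k u v; rewrite /f /= s_lin scalerDl -scalerA scalerDr scalerN opprD.
  by rewrite addrACA.
have f_rel t1 t2 : Uphi_rel t1 t2 -> aeval f t1 = aeval f t2.
  case=> [[u v]|[-> ->]] /=; last first.
    by rewrite /f /= (lin0 s_lin) oppr0 add0r scale1r.
  have -> : f (lie_br u v) = comm (f u) (f v).
    rewrite {2 3}/f !(linD (comm_linl _), linD (comm_linr _)) !comm_scal !comm_scall.
    rewrite !addr0 (linN (comm_linl _)) (linN (comm_linr _)) opprK.
    rewrite /f -[(lie_br u v).1]/(@lie_br K L v.1 u.1) -[(lie_br u v).2]/(phi u.1 v.1).
    by rewrite lie_anti (linN s_lin) opprK sbr subrK.
  by rewrite /comm addrC subrK.
pose psi : Uphi phiC -> A := plift f.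
have psi_hom : alg_hom psi by apply: plift_hom.
have psi_gen v : psi (Uphi_gen phiC v) = - s v.
  by rewrite /psi /Uphi_gen plift_gen // /f /= scale0r addr0.
have [pl p1 pM] := psi_hom.
have psi_co u : co (psi u) = tmap id psi (uco u).
  move: u; apply: palg_ext.
  - exact: hom_comp psi_hom co_hom.
  - exact: hom_comp (uco_hom phiC) (tmap_hom (hom_id H) psi_hom).
  move=> [v c]; rewrite Uphi_pgen.
  have [ul u1 _] := uco_hom phiC; have lt := tmap_lin (@lin_id _ H) pl.
  rewrite (linD pl) (linZ pl) p1 (linD lc) (linZ lc) c1.
  rewrite (linD ul) (linZ ul) u1 (linD lt) (linZ lt) !toneE tmapE // p1.
  congr (_ + _); rewrite psi_gen.
  have -> : Uphi_gen phiC (v, c).1 = - ugam phiC v by rewrite /ugam opprK.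
  rewrite (linN ul) uco_ugam (linN lt) (linN lc) co_s (linD lt) !tmapE // p1.
  by rewrite /ugam (linN pl) psi_gen opprK.
exists phi, phiC, psi; split=> //.
- exact: (Uphi_inj char0 A1 psi_hom psi_co).
- elim/palg_ind_left => [||[v c] u Zu].
  + by rewrite p1.
  + split; first by rewrite (lin0 pl); apply: sub0.
    by move=> k x y Zx Zy; rewrite pl; apply: Zsub.2.
  rewrite pM Uphi_pgen (linD pl) (linZ pl) p1 psi_gen amulDl amulZl amul1a.
  apply: (subD Zsub); last exact: subZ.
  by apply: ZM => //; apply: (subN Zsub).
move=> b Zb; have [n Gb] := G_exists co_hom co_counit coA Zxa Zb.
have := @G_generated K char0 g A co co_hom co_counit coA A1 Z Zsub ZM Zxa Zco
  L s vsval (utV hc) vl (utV_lin hc) co_s Zs (utV1 hc) (@utV_val _ _ _ hc) _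
  (fun b => exists u, b = psi u) _ _ _ n b Gb.
apply.
- by move=> x /hP xh; exists (vsproj h x); rewrite vsprojK.
- split; first by exists 0; rewrite (lin0 pl).
  by move=> k x y [u ->] [v ->]; exists (k *: u + v); rewrite pl.
- by exists aone; rewrite p1.
- move=> v x [u ->]; exists (- Uphi_gen phiC v ** u).
  by rewrite pM (linN pl) psi_gen opprK.
Qed.
End CoinvariantScalars.

(** * Finite-dimensional simple algebras *)

(** The form in which algebraic closedness enters Burnside's theorem. *)
Definition has_eigenvectors (K : fieldType) := forall n (M : 'M[K]_n.+1),
  exists (c : K) (v : 'cV[K]_n.+1), v <> 0 /\ M *m v = c *: v.

Lemma closed_eigenvectors (K : closedFieldType) : has_eigenvectors K.
Proof.
move=> n M; have [c] : exists c, root (char_poly M^T) c.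
  by apply/closed_rootP; rewrite size_char_poly.
rewrite -eigenvalue_root_char => /eigenvalueP [v vM v0].
exists c, v^T; split; first by apply/eqP; rewrite trmx_eq0.
by rewrite -[M]trmxK -trmx_mul vM linearZ.
Qed.

(** * Density and Burnside's theorem *)

Section Burnside.
Variables (K : fieldType) (B : pzAlgType K) (n : nat) (be : B -> 'M[K]_n).
Hypothesis eigK : has_eigenvectors K.
Hypothesis be_hom : alg_hom be.
Hypothesis irr : forall P : 'cV[K]_n -> Prop, subspace P ->
  (forall b c, P c -> P (be b *m c)) -> (exists2 c, P c & c <> 0) -> forall c, P c.
Implicit Types (v w u : 'cV[K]_n) (ws : seq 'cV[K]_n) (b : B).

Let beM b b' : be (b ** b') = be b *m be b'. Proof. by case: be_hom. Qed.
Let be_lin : linear be. Proof. by case: be_hom. Qed.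
Let be1 : be aone = 1%:M. Proof. by case: be_hom. Qed.

Fixpoint seqspan ws v : Prop :=
  if ws is w :: ws' then exists c : K, seqspan ws' (v - c *: w) else v = 0.

Lemma seqspan_lin ws (P : 'cV[K]_n -> Prop) v : subspace P ->
  (forall w, w \in ws -> P w) -> seqspan ws v -> P v.
Proof.
move=> sP; elim: ws v => [|w ws IH] v /=; first by move=> _ ->; apply: sub0.
move=> Pw [c /IH h]; rewrite -[v](subrK (c *: w)); apply: subD => //.
  by apply: h => x xw; apply: Pw; rewrite inE xw orbT.
by apply: subZ => //; apply: Pw; rewrite inE eqxx.
Qed.

Definition kills b ws := forall w, w \in ws -> be b *m w = 0.

(** Suppose every b killing [ws] and w also kills v. Then b w |-> b v, for b killing [ws], is a
    well-defined endomorphism T commuting with B, a scalar c by Schur's lemma. So all b killing [ws]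
    kill v - c w, against the induction hypothesis. *)
Lemma density ws v : ~ seqspan ws v -> exists b, kills b ws /\ be b *m v <> 0.
Proof.
elim: ws v => [|w ws IH] v /= nv.
  by exists aone; split=> //; rewrite be1 mul1mx.
have killS b : subspace (fun x : 'cV[K]_n => be b *m x = 0).
  by split=> [|k y z Ey Ez]; rewrite ?mulmx0 // mulmxDr -scalemxAr Ey Ez scaler0 addr0.
case: (pselect (seqspan ws w)) => [sw|/IH [b0 [k0 b0w]]].
  have [b [kb bv]] : exists b, kills b ws /\ be b *m v <> 0.
    by apply: IH => sv; apply: nv; exists 0; rewrite scale0r subr0.
  exists b; split=> // x; rewrite inE => /orP [/eqP ->|]; last exact: kb.
  exact: (seqspan_lin (P := fun x : 'cV[K]_n => be b *m x = 0) (killS b) kb sw).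
apply: contrapT => nb.
have J0 b : kills b ws -> be b *m w = 0 -> be b *m v = 0.
  move=> kb bw; apply: contrapT => bv; apply: nb; exists b; split=> // x.
  by rewrite inE => /orP [/eqP ->|]; [exact: bw | exact: kb].
pose P u := exists2 b, kills b ws & be b *m w = u.
have kD k b b' : kills b ws -> kills b' ws -> kills (k *: b + b') ws.
  move=> kb kb' x xw; rewrite be_lin mulmxDl -scalemxAl (kb _ xw) (kb' _ xw).
  by rewrite scaler0 addr0.
have kM b b' : kills b' ws -> kills (b ** b') ws.
  by move=> kb' x xw; rewrite beM -mulmxA (kb' _ xw) mulmx0.
have PT : forall u, P u.
  apply: irr.
  - split; first by exists 0; [move=> x xw|]; rewrite (lin0 be_lin) mul0mx.
    move=> k x y [b kb <-] [b' kb' <-]; exists (k *: b + b'); first exact: kD.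
    by rewrite be_lin mulmxDl -scalemxAl.
  - move=> b c [b' kb' <-]; exists (b ** b'); first exact: kM.
    by rewrite beM mulmxA.
  - by exists (be b0 *m w) => //; exists b0.
pose bi i := projT1 (cid2 (PT (delta_mx i 0))).
have bi_k i : kills (bi i) ws by rewrite /bi; case: (cid2 _).
have bi_w i : be (bi i) *m w = delta_mx i 0 by rewrite /bi; case: (cid2 _).
pose T : 'M[K]_n := \matrix_(k, i) (be (bi i) *m v) k 0.
have TE u : T *m u = \sum_i u i 0 *: (be (bi i) *m v).
  apply/colP => k; rewrite !mxE summxE; apply: eq_bigr => i _.
  by rewrite !mxE mulrC.
have udec u : u = \sum_i u i 0 *: (delta_mx i 0 : 'cV[K]_n).
  apply/colP => k; rewrite summxE (bigD1 k) //= !mxE !eqxx mulr1.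
  by rewrite big1 ?addr0 // => i ik; rewrite !mxE eq_sym (negPf ik) mulr0.
have Tb b : kills b ws -> T *m (be b *m w) = be b *m v.
  move=> kb; set u := be b *m w.
  (* By construction d kills [ws] and w, hence v; this says that T(b w) = b v whatever b represents
     the vector. *)
  pose d := b - \sum_i u i 0 *: bi i.
  have bd (x : 'cV[K]_n) : be d *m x = be b *m x - \sum_i u i 0 *: (be (bi i) *m x).
    rewrite /d (linB _ _ be_lin) mulmxBl (lin_sum _ _ _ be_lin) mulmx_suml.
    by congr (_ - _); apply: eq_bigr => i _; rewrite (linZ be_lin) scalemxAl.
  have kd : kills d ws.
    move=> x xw; rewrite bd (kb _ xw) big1 ?subr0 // => i _.
    by rewrite (bi_k i _ xw) scaler0.
  have dw : be d *m w = 0.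
    rewrite bd -/u {1}[u]udec; apply/eqP; rewrite subr_eq0; apply/eqP.
    by apply: eq_bigr => i _; rewrite bi_w.
  by have /eqP := J0 d kd dw; rewrite bd subr_eq0 => /eqP ->; rewrite TE.
have [c [u [u0 Tu]]] : exists (c : K) u, u <> 0 /\ T *m u = c *: u.
  move: (T) b0w => T' {}b0w; case: (n) T' (be b0 *m w) b0w => [|n'] T' x x0.
    by case: x0; apply/colP => -[].
  exact: eigK.
(* An eigenspace of T is a nonzero invariant subspace, so it is everything. *)
have Tc (x : 'cV[K]_n) : T *m x = c *: x.
  apply: (irr (P := fun x : 'cV[K]_n => T *m x = c *: x)); last by exists u.
    split; first by rewrite mulmx0 scaler0.
    move=> k y z Ey Ez; rewrite mulmxDr -scalemxAr Ey Ez scalerDr !scalerA.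
    by rewrite mulrC.
  move=> b y; have [b' kb' <-] := PT y => E.
  rewrite [be b *m _]mulmxA -beM (Tb _ (kM b _ kb')) beM -mulmxA -(Tb _ kb') E.
  by rewrite -scalemxAr mulmxA.
have [b [kb]] : exists b, kills b ws /\ be b *m (v - c *: w) <> 0.
  by apply: IH => h; apply: nv; exists c.
apply; rewrite mulmxBr -scalemxAr -(Tb _ kb) Tc subrr //.
Qed.

(** Density gives b killing all standard vectors except the i-th. An element moving the image of the
    latter to the k-th vector then completes b to a matrix unit. *)
Lemma burnside M : exists b, be b = M.
Proof.
have E i k : exists b, be b = delta_mx k i.
  pose ws := [seq (delta_mx j 0 : 'cV[K]_n) | j <- enum 'I_n & j != i].
  have nd : ~ seqspan ws (delta_mx i 0).
    move=> h; have : (delta_mx i 0 : 'cV[K]_n) i 0 = 0.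
      apply: (seqspan_lin (P := fun x => x i 0 = 0) _ _ h).
        split=> [|a y z Ey Ez]; first by rewrite mxE.
        by rewrite !mxE Ey Ez mulr0 addr0.
      move=> w /mapP [j]; rewrite mem_filter => /andP [ji _] ->.
      by rewrite mxE eq_sym (negPf ji).
    by rewrite !mxE !eqxx => /eqP; rewrite oner_eq0.
  have [b [kb bi]] := density nd.
  have Pk (x : 'cV[K]_n) : exists b', be b' *m (be b *m delta_mx i 0) = x.
    move: x; apply: irr.
    - split; first by exists 0; rewrite (lin0 be_lin) mul0mx.
      move=> a x y [c <-] [d <-]; exists (a *: c + d).
      by rewrite be_lin mulmxDl -scalemxAl.
    - by move=> c x [d <-]; exists (c ** d); rewrite beM -mulmxA.
    - by exists (be b *m delta_mx i 0) => //; exists aone; rewrite be1 mul1mx.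
  have [b' Eb'] := Pk (delta_mx k 0).
  exists (b' ** b); apply/matrixP => p q.
  have -> : be (b' ** b) p q = (be (b' ** b) *m (delta_mx q 0 : 'cV_n)) p 0.
    by rewrite -colE mxE.
  rewrite beM -mulmxA; case: (eqVneq q i) => [->|qi].
    by rewrite Eb' !mxE !eqxx.
  rewrite (kb (delta_mx q 0)) ?mulmx0; last first.
    by apply/mapP; exists q => //; rewrite mem_filter qi mem_enum.
  by rewrite !mxE (negPf qi) andbF.
pose bb i k := projT1 (cid (E i k)).
have bbE i k : be (bb i k) = delta_mx k i by rewrite /bb; case: (cid _).
exists (\sum_k \sum_i M k i *: bb i k).
rewrite (lin_sum _ _ _ be_lin) [RHS]matrix_sum_delta; apply: eq_bigr => k _.
rewrite (lin_sum _ _ _ be_lin); apply: eq_bigr => i _.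
by rewrite (linZ be_lin) bbE.
Qed.
End Burnside.

(** * Wedderburn's theorem *)

Section Wedderburn.
Variables (K : fieldType) (B : pzAlgType K).
Hypothesis eigK : has_eigenvectors K.
Hypothesis B1 : (aone : B) <> 0.
Hypothesis Bfin : exists n (v : 'I_n -> B), forall b, exists c : 'I_n -> K,
  b = \sum_i c i *: v i.
Hypothesis Bsimple : forall J : B -> Prop, subspace J ->
  (forall b x, J x -> J (b ** x)) -> (forall b x, J x -> J (x ** b)) ->
  (forall x, J x -> x = 0) \/ (forall x, J x).

Definition left_ideal (L : B -> Prop) :=
  subspace L /\ forall b x, L x -> L (b ** x).

Definition spanned_by n (L : B -> Prop) (v : 'I_n -> B) :=
  forall x, L x <-> exists c : 'I_n -> K, x = \sum_i c i *: v i.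

Let Q n := `[< exists (L : B -> Prop) (v : 'I_n -> B),
  [/\ left_ideal L, exists2 x, L x & x <> 0 & spanned_by L v] >].

(** B acts on a nonzero left ideal L with the fewest spanning vectors. Minimality makes the action
    irreducible, Burnside's theorem makes it surjective onto matrices, and simplicity makes it
    faithful. *)
Theorem wedderburn : exists (n : nat) (be : B -> 'M[K]_n),
  [/\ (0 < n)%N, alg_hom be & bijective be].
Proof.
have Q0 : exists n, Q n.
  have [n [v vP]] := Bfin; exists n; apply/asboolP; exists (fun=> True), v.
  by split=> //; exists aone.
case: (ex_minnP Q0) => n /asboolP [L [v [lL [x0 Lx0 x00] Lv]]] min.
have Lvi i : L (v i).
  apply/Lv; exists (fun j => (j == i)%:R); rewrite (bigD1 i) //= eqxx scale1r.
  by rewrite big1 ?addr0 // => j /negPf ->; rewrite scale0r.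
pose vv (c : 'cV[K]_n) : B := \sum_i c i 0 *: v i.
have vv_lin : linear vv.
  move=> k c d; rewrite /vv scaler_sumr -big_split; apply: eq_bigr => i _.
  by rewrite !mxE scalerDl scalerA.
have vvL c : L (vv c) by apply/Lv; exists (fun i => c i 0).
have vv_surj x : L x -> exists c, x = vv c.
  move=> /Lv [c ->]; exists (\col_i c i); apply: eq_bigr => i _; by rewrite mxE.
have dimcV : \dim {: 'cV[K]_n} = n by rewrite dimvf /dim /= muln1.
(* A nonzero left ideal inside L given by a coordinate space of smaller dimension would need fewer
   than n spanning vectors. *)
have minP (P : 'cV[K]_n -> Prop) : subspace P ->
    left_ideal (fun x => exists2 c, P c & x = vv c) ->
    (exists2 c, P c & vv c <> 0) -> forall c, P c.
  move=> sP lP [c0 Pc0 c00] c.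
  have [U UP] := subspace_vspace sP.
  have QU : Q (\dim U).
    apply/asboolP; exists (fun x => exists2 c, P c & x = vv c).
    exists (fun i => vv (vbasis U)`_i); split=> //.
      by exists (vv c0) => //; exists c0.
    move=> x; split=> [[d Pd ->]|[d ->]].
      exists (fun i => coord (vbasis U) i d).
      have /coord_vbasis {1}-> : d \in U by apply/UP.
      rewrite (lin_sum _ _ _ vv_lin); apply: eq_bigr => i _.
      by rewrite (linZ vv_lin).
    exists (\sum_i d i *: (vbasis U)`_i).
      apply/UP; apply: memv_suml => i _; apply: memvZ.
      by apply: vbasis_mem; apply: mem_nth; rewrite size_tuple.
    rewrite (lin_sum _ _ _ vv_lin); apply: eq_bigr => i _.
    by rewrite (linZ vv_lin).
  have /(_ c) : forall c, c \in U; last by move/UP.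
  have -> : U = fullv; last by move=> d; apply: memvf.
  by apply/eqP; rewrite eqEdim subvf dimcV min.
(* A linear relation among the v_i would let a complement of the kernel span L with fewer
   vectors. *)
have vv_inj0 c : vv c = 0 -> c = 0.
  move=> c0; apply: contrapT => nc.
  have kS : subspace (fun c => vv c = 0).
    split; first exact: lin0 vv_lin.
    by move=> k x y Ex Ey; rewrite vv_lin Ex Ey scaler0 addr0.
  have [U UP] := subspace_vspace kS.
  have U0 : (0 < \dim U)%N.
    rewrite lt0n dimv_eq0; apply/eqP => E; apply: nc.
    by apply/eqP; rewrite -memv0 -E; apply/UP.
  have QC : Q (\dim U^C).
    apply/asboolP; exists L, (fun i => vv (vbasis U^C)`_i); split=> //.
      by exists x0.
    move=> x; split=> [/vv_surj [d ->]|[d ->]].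
      have : d \in (U + U^C)%VS by rewrite addv_complf memvf.
      move=> /memv_addP [p /UP pU [q qU ->]].
      exists (fun i => coord (vbasis U^C) i q).
      rewrite (linD vv_lin) pU add0r {1}(coord_vbasis qU).
      rewrite (lin_sum _ _ _ vv_lin); apply: eq_bigr => i _.
      by rewrite (linZ vv_lin).
    by apply: (sub_sum lL.1) => i _; apply: subZ; [exact: lL.1|exact: vvL].
  have := min _ QC; rewrite dimv_compl dimcV leqNgt => /negP; apply.
  rewrite -[X in (_ < X)%N]subn0 ltn_sub2l // (leq_trans U0) // -[X in (_ <= X)%N]dimcV.
  exact: dimvS (subvf U).
have vv_inj : injective vv.
  move=> c d E; apply/eqP; rewrite -subr_eq0; apply/eqP/vv_inj0.
  by rewrite (linB _ _ vv_lin) E subrr.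
have bex b j : exists c, b ** v j = vv c by apply: vv_surj; apply: lL.2.
pose be b : 'M[K]_n := \matrix_(i, j) projT1 (cid (bex b j)) i 0.
have beE b c : vv (be b *m c) = b ** vv c.
  have -> : be b *m c = \sum_j c j 0 *: projT1 (cid (bex b j)).
    apply/colP => i; rewrite !mxE summxE; apply: eq_bigr => j _.
    by rewrite !mxE mulrC.
  rewrite (lin_sum _ _ _ vv_lin) (lin_sum _ _ _ (amul_linr b)).
  apply: eq_bigr => j _; rewrite (linZ vv_lin) amulZr; congr (_ *: _).
  by case: (cid _) => d /= ->.
have be_ext (M N : 'M[K]_n) : (forall c, vv (M *m c) = vv (N *m c)) -> M = N.
  move=> E; apply/matrixP => p q.
  have := congr1 (fun x : 'cV[K]_n => x p 0) (vv_inj _ _ (E (delta_mx q 0))).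
  by rewrite -!colE !mxE.
have be_lin : linear be.
  move=> k x y; apply: be_ext => c; rewrite mulmxDl -scalemxAl vv_lin !beE.
  by rewrite amul_linl.
have be_hom : alg_hom be.
  split=> //; first by apply: be_ext => c; rewrite beE amul1a mul1mx.
  by move=> x y; apply: be_ext => c; rewrite beE -mulmxA !beE amulA.
exists n, be; split=> //.
  case: n {min} v Lv Lvi vv vv_lin vvL vv_surj dimcV minP vv_inj0 vv_inj bex be
    beE be_ext be_lin be_hom => // v Lv *.
  by case: x00; have /Lv [c ->] := Lx0; rewrite big_ord0.
have inj : injective be.
  have kS : subspace (fun b => be b = 0).
    split; first exact: lin0 be_lin.
    by move=> k x y Ex Ey; rewrite be_lin Ex Ey scaler0 addr0.
  have [_ be1 beM] := be_hom.
  case: (Bsimple kS) => [b x Ex|b x Ex|k0|/(_ aone) b1].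
  - by rewrite beM Ex; exact: mulmx0.
  - by rewrite beM Ex; exact: mul0mx.
  - move=> x y E; apply/eqP; rewrite -subr_eq0; apply/eqP/k0.
    by rewrite (linB _ _ be_lin) E subrr.
  case: x00; have [c ->] := vv_surj _ Lx0.
  by rewrite -[vv c]amul1a -beE b1 mul0mx (lin0 vv_lin).
have surj : forall M, exists b, be b = M.
  apply: burnside => // P sP Pb [c Pc c0]; apply: minP => //.
    split; first split.
    - by exists 0; [exact: sub0|rewrite (lin0 vv_lin)].
    - move=> k x y [d Pd ->] [d' Pd' ->]; exists (k *: d + d'); first exact: sP.2.
      by rewrite vv_lin.
    - move=> b x [d Pd ->]; exists (be b *m d); first exact: Pb.
      by rewrite beE.
  by exists c => // /vv_inj0.
pose inv M := projT1 (cid (surj M)).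
have invK M : be (inv M) = M by rewrite /inv; case: (cid _).
by exists inv => // b; apply: inj; rewrite invK.
Qed.
End Wedderburn.

Lemma tmap_inj (K : fieldType) (H V W : lmodType K) (f : V -> W) :
  linear f -> injective f -> injective (tmap id f : tens H V -> tens H W).
Proof.
move=> lf fi t u E; apply: tens_sep2 => y ly; apply: fi.
by rewrite -!ev_tmap // E.
Qed.

(** * The current subalgebra of coinvariants *)

Section HHmapFacts.
Variables (K : fieldType) (g : lieAlg K).
Local Notation H := (UH g).
Variables (M N : hmodule H) (f : M -> N).
Hypothesis fh : hm_hom f.

Lemma HHmap_lin : linear (HHmap f).
Proof. exact: HHlift_lin (HHmap_bal fh). Qed.
Lemma HHmap_act c u : HHmap f (hhact c u) = hhact c (HHmap f u).
Proof.
move: u; apply: HHt_ext => [||t m].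
- exact: (lin_comp (hhact_linr c) HHmap_lin).
- exact: (lin_comp HHmap_lin (hhact_linr c)).
by rewrite hhactE !HHmapE // hhactE.
Qed.
Lemma HHmap_jmap t : HHmap f (jmap t) = jmap (tmap id f t).
Proof.
case: (fh) => lf _; move: t; apply: tens_ext => [||h m].
- exact: (lin_comp (@jmap_lin _ _ _) HHmap_lin).
- exact: (lin_comp (tmap_lin (@lin_id _ _) lf) (@jmap_lin _ _ _)).
by rewrite jmapE HHmapE // tmapE // jmapE.
Qed.
Lemma theta_HHmap u : theta (HHmap f u) = tmap id f (theta u).
Proof. by rewrite -{1}[u]jmapK HHmap_jmap thetaK. Qed.
End HHmapFacts.

Lemma CurAlg_actE (K : fieldType) (H : hopf K) (B : pzAlgType K) (h f : H) (b : B) :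
  hact h (f \ox b : CurAlg H B) = (h ** f) \ox b.
Proof. exact: free_actE. Qed.

Section CurrentSubalgebra.
Variables (K : fieldType) (g : lieAlg K).
Local Notation H := (UH g).
Variables (R : pseudo H) (e : R).

Lemma pseudoidentity_mul : pseudoidentity e ->
  [/\ pmul e e = (aone \ox aone) \oxH e,
      forall r, ev (@heps K H) (theta (pmul e r)) = r & pmul e e <> 0].
Proof.
move=> [[i [[ih im] ii i1]] ex].
have ee : pmul e e = (aone \ox aone) \oxH e.
  by rewrite -i1 im CurAlgE HHmapE // amul1a.
split=> // [r|].
  have := xprodE (@heps_lin K H) (ex r) => {2}->; congr ev.
  by apply/funext => h; rewrite UHeps_S.
rewrite ee -/(ione e) => /(congr1 (@theta K g R)).
rewrite theta_ione (lin0 (@theta_lin _ _ _)) => /(congr1 (ev (@heps K H))).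
rewrite evE; last exact: heps_lin.
rewrite heps1 scale1r (lin0 (ev_lin (@heps_lin K H))) => e0.
have : (aone \ox aone : CurAlg H K^o) = 0.
  by apply: ii; rewrite i1 e0; case: ih => li _; rewrite (lin0 li).
move=> /(congr1 (ev (@heps K H))); rewrite evE; last exact: heps_lin.
rewrite heps1 scale1r (lin0 (ev_lin (@heps_lin K H))) => /eqP.
by apply/negP; exact: oner_neq0.
Qed.

Hypothesis Ras : passoc R.
Hypothesis eE : pmul e e = (aone \ox aone) \oxH e.
Hypothesis e1 : forall r, ev (@heps K H) (theta (pmul e r)) = r.

Section Embedding.
Variables (B : pzAlgType K) (i : CurAlg H B -> R).
Hypotheses (ih : pseudo_hom i) (ii : injective i) (i1 : i (aone \ox aone) = e).

Definition ib (b : B) : R := i (aone \ox b).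
Let li : linear i. Proof. by case: ih => -[]. Qed.
Lemma ib_lin : linear ib.
Proof. exact: (lin_comp (tpure_linr _) li). Qed.
Lemma ibM b b' : pmul (ib b) (ib b') = ione (ib (b ** b')).
Proof. by case: ih => hh im; rewrite /ib im CurAlgE HHmapE. Qed.
Lemma ib1 : ib aone = e. Proof. exact: i1. Qed.
Lemma ib_rconst b : rconst e (ib b).
Proof. by rewrite /rconst -{1}ib1 ibM amula1. Qed.
Lemma ib_coinv b : pmul e (ib b) = ione (ib b).
Proof. by rewrite -{1}ib1 ibM amul1a. Qed.
Lemma i_act h b : i (h \ox b) = hact h (ib b).
Proof.
case: ih => -[_ iH] _; rewrite /ib -iH; congr i.
by rewrite CurAlg_actE amula1.
Qed.
Lemma i_theta u : theta (pmul (i u) e) = tmap id ib u.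
Proof.
move: u; apply: tens_ext => [||h b].
- exact: (lin_comp li (lin_comp (pmul_linl e) (@theta_lin _ _ _))).
- exact: (tmap_lin (@lin_id _ _) ib_lin).
rewrite i_act pmulHl (ib_rconst b) ioneE jmapE hhactE tmulE !amula1 theta_pure.
by rewrite tmapE //; exact: ib_lin.
Qed.
End Embedding.

Definition coinv (r : R) := rconst e r /\ pmul e r = ione r.
Lemma coinv_pmul a b : coinv a -> coinv b -> pmul a b = ione (dot a b).
Proof.
move=> [aA _] [_ bc]; rewrite (pmul_rconst Ras _ aA) /coact bc theta_ione tmapE //.
  by rewrite ioneE.
exact: dot_linr.
Qed.
Lemma coinv_alg : subalg_axioms (@dot K g R) e coinv.
Proof.
split.
- split; first split.
  + by rewrite /rconst (lin0 (pmul_linl _)) (lin0 (@ione_lin _ _ _)).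
  + by rewrite (lin0 (pmul_linr _)) (lin0 (@ione_lin _ _ _)).
  move=> k x y [Px Cx] [Py Cy]; split.
    by rewrite /rconst pmul_linl Px Py ione_lin.
  by rewrite pmul_linr Cx Cy ione_lin.
- exact: dot_linl.
- exact: dot_linr.
- by split.
- move=> x y xP yP; split; first by apply: rconst_dot => //; case: yP.
  have := coact_dot Ras eE xP.1 yP.1.
  rewrite /coact xP.2 yP.2 !theta_ione tmapE //; last exact: proj_lin.
  have bi0 d : bilin (fun (f' : H) d' => (aone ** f') \ox dot d d').
    split=> z; first exact: (lin_comp (amul_linr _) (tpure_linl _)).
    exact: (lin_comp (dot_linr d) (tpure_linr _)).
  have bi2 : bilin (fun (f : H) d =>
      tenslift (fun f' d' => (f ** f') \ox dot d d') (aone \ox y)).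
    split=> z; apply: tenslift_par => f' d'.
      exact: (lin_comp (amul_linl _) (tpure_linl _)).
    exact: (lin_comp (dot_linl _) (tpure_linr _)).
  rewrite tensliftE // tensliftE // amul1a (proj_id xP.1) => E.
  by rewrite -[LHS]jmapK E ioneE.
- by move=> x y z _ _ _; apply: dotA.
- by move=> x _; rewrite /dot prod1_theta e1.
- by move=> x [xA _]; apply: proj_id.
Qed.
Local Notation C := (subalg coinv_alg).
Definition coinv_val (c : C) : R := subalg_val c.
Lemma coinv_val_lin : linear coinv_val. Proof. exact: subalg_val_lin. Qed.

Definition coinv_cur (t : CurAlg H C) : R := actT (tmap id coinv_val t).
Lemma coinv_curE h c : coinv_cur (h \ox c) = hact h (coinv_val c).
Proof. by rewrite /coinv_cur tmapE ?actTE //; exact: coinv_val_lin. Qed.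
Lemma coinv_cur_lin : linear coinv_cur.
Proof. exact: (lin_comp (tmap_lin (@lin_id _ _) coinv_val_lin) (@actT_lin _ _ _)). Qed.
Lemma coinv_cur_hom : pseudo_hom coinv_cur.
Proof.
have lc := coinv_cur_lin.
have hh : hm_hom coinv_cur.
  split=> // h t; move: t; apply: tens_ext => [||f c].
  - exact: (lin_comp (@hact_linr K H (CurAlg H C) h) lc).
  - exact: (lin_comp lc (hact_linr h)).
  by rewrite CurAlg_actE !coinv_curE hactM.
split=> // t u; move: t; apply: tens_ext => [||h c].
- exact: (lin_comp lc (pmul_linl _)).
- exact: (lin_comp (pmul_linl (p := CurAlg H C) u) (HHmap_lin hh)).
move: u; apply: tens_ext => [||h' c'].
- exact: (lin_comp lc (pmul_linr _)).
- exact: (lin_comp (pmul_linr (p := CurAlg H C) _) (HHmap_lin hh)).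
rewrite !coinv_curE CurAlgE HHmapE // pmulH (coinv_pmul (subalg_valP c) (subalg_valP c')).
by rewrite /ione hhactE tmulE !amula1 coinv_curE hact1.
Qed.
Lemma coinv_cur1 : coinv_cur (aone \ox aone) = e.
Proof. by rewrite coinv_curE hact1. Qed.
Lemma coinv_cur_inj : injective coinv_cur.
Proof.
move=> t u E; have /(congr1 (fun r => theta (pmul r e))) := E.
rewrite !(i_theta coinv_cur_hom coinv_cur1).
apply: tmap_inj; first exact: ib_lin coinv_cur_hom.
move=> c d; rewrite /ib !coinv_curE !hact1; exact: subalg_val_inj.
Qed.

Local Open Scope classical_set_scope.
(** Every unital current subalgebra is contained in the one built on the coinvariants, so the
    maximal one equals it. For a coinvariant r = i(u), comparing r * e with [ione r] then shows that
    r comes from B. *)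
Lemma maximal_coinv (S : set R) (B : pzAlgType K) (i : CurAlg H B -> R) :
  maximal_unital_current e S -> pseudo_hom i -> i (aone \ox aone) = e ->
  S = range i -> forall r, coinv r -> exists b, r = ib i b.
Proof.
move=> [_ Smax] ih i1 Si r rc.
have ibC b : coinv (ib i b) by split; [exact: ib_rconst|exact: ib_coinv].
have SE : range coinv_cur = S.
  apply: Smax.
    exists C, coinv_cur; split=> //; [exact: coinv_cur_hom|exact: coinv_cur_inj|].
    exact: coinv_cur1.
  pose kk (b : B) : C := Subalg coinv_alg (ibC b).
  have lk : linear kk.
    by move=> k x y; apply: subalg_val_inj; rewrite subalg_val_lin; apply: ib_lin.
  have [[li _] _] := ih.
  rewrite Si => _ [u _ <-]; exists (tmap id kk u) => //.
  move: u; apply: tens_ext => [||h b].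
  - exact: (lin_comp (tmap_lin (@lin_id _ _) lk) coinv_cur_lin).
  - exact: li.
  by rewrite tmapE // coinv_curE i_act.
have : S r.
  rewrite -SE; exists (aone \ox Subalg coinv_alg rc) => //.
  by rewrite coinv_curE hact1.
rewrite Si => -[u _ Er]; exists (ev (@heps K H) u).
have := i_theta ih i1 u; rewrite Er rc.1 theta_ione.
move=> /(congr1 (ev (@heps K H))); rewrite ev_tmap; last 2 first.
- exact: heps_lin.
- exact: ib_lin.
by rewrite evE; [rewrite heps1 scale1r|exact: heps_lin].
Qed.

(** * Finiteness and simplicity of the coefficient algebra *)

Section FiniteSimple.
Variables (B : pzAlgType K) (i : CurAlg H B -> R).
Hypotheses (ih : pseudo_hom i) (ii : injective i) (i1 : i (aone \ox aone) = e).
Let li : linear i. Proof. by case: ih => -[]. Qed.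

(** The counit on the first factor maps Cur B onto B and turns H-coefficients into scalars, so
    generators over H become a spanning family over K. *)
Lemma finite_coef : finite_in (range i) -> exists n (v : 'I_n -> B),
  forall b, exists c : 'I_n -> K, b = \sum_k c k *: v k.
Proof.
move=> [s [sS sg]].
have ux (k : 'I_(size s)) : exists u, i u = s`_k.
  by have [u _ E] := sS _ (mem_nth 0 (ltn_ord k)); exists u.
pose u k := projT1 (cid (ux k)).
have uE k : i (u k) = s`_k by rewrite /u; case: (cid _).
have le := ev_lin (V := B) (@heps_lin K H).
exists (size s), (fun k => ev (@heps K H) (u k)) => b.
have [c Ec] := sg (i (aone \ox b)) (ex_intro2 _ _ _ I erefl).
exists (fun k => heps (c k)).
have : aone \ox b = \sum_k hact (c k) (u k).
  apply: ii; rewrite Ec (lin_sum _ _ _ li); apply: eq_bigr => k _.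
  by rewrite -uE; case: ih => -[_ ->].
move=> /(congr1 (ev (@heps K H))); rewrite evE; last exact: heps_lin.
rewrite heps1 scale1r => ->; rewrite (lin_sum _ _ _ le); apply: eq_bigr => k _.
move: (u k); apply: tens_ext => [||h b'].
- exact: (lin_comp (@hact_linr K H (CurAlg H B) _) le).
- exact: (lin_scale _ le).
rewrite CurAlg_actE !evE; try exact: (heps_lin (h := H)).
by rewrite hepsM scalerA.
Qed.

(** The subspace H (x) J; the impredicative form doubles as its induction principle. *)
Definition hspan (J : B -> Prop) (u : CurAlg H B) := forall Q : CurAlg H B -> Prop,
  subspace Q -> (forall h b, J b -> Q (h \ox b)) -> Q u.
Lemma hspan_sub J : subspace (hspan J).
Proof.
split=> [Q sQ _|k x y hx hy Q sQ QJ]; first exact: sub0.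
by apply: sQ.2; [apply: hx|apply: hy].
Qed.
Lemma hspan_pure J h b : J b -> hspan J (h \ox b).
Proof. by move=> Jb Q _; apply. Qed.

Lemma hspan_theta J (x : H -> K^o) c h f b : linear x -> J b ->
  hspan J (ev x (theta ((c \ox h) \oxH (f \ox b : CurAlg H B)))).
Proof.
move=> lx Jb; move: h c f.
have lt m : linear (fun t => ev x (theta (t \oxH (m : CurAlg H B)))).
  exact: (lin_comp (hpure_linl m) (lin_comp (@theta_lin _ _ _) (ev_lin lx))).
apply: U_ind_right => [c f||z h IH c f].
- by rewrite theta_pure evE //; apply: (subZ (hspan_sub _)); apply: hspan_pure.
- split=> [c f|k y z IHy IHz c f].
    by rewrite (lin0 (tpure_linr _)) (lin0 (lt _)); apply: (sub0 (hspan_sub _)).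
  by rewrite tpure_linr lt; apply: (hspan_sub _).2.
have -> : (c \ox (h ** Ugen z : H)) \oxH (f \ox b : CurAlg H B) =
    (c \ox h) \oxH ((Ugen z : H) ** f \ox b : CurAlg H B) -
    (c ** Ugen z \ox h) \oxH (f \ox b : CurAlg H B).
  have <- : hact (Ugen z : H) (f \ox b : CurAlg H B) = (Ugen z : H) ** f \ox b.
    exact: CurAlg_actE.
  rewrite -hpure_bal UHD_gen amulDr !tmulE !amula1 (linD (hpure_linl _)).
  by rewrite addrAC subrr add0r.
rewrite (linB _ _ (lin_comp (@theta_lin _ _ _) (ev_lin lx))).
by apply: (subB (hspan_sub _)).
Qed.

Lemma hspan_mul J (x : H -> K^o) u v : linear x -> subspace J ->
  (forall b b', J b' -> J (b ** b')) -> (forall b b', J b' -> J (b' ** b)) ->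
  hspan J u -> hspan J (ev x (theta (pmul u v))) /\ hspan J (ev x (theta (pmul v u))).
Proof.
move=> lx sJ Jl Jr hu.
apply: (hu (fun u => hspan J (ev x (theta (pmul u v))) /\
                     hspan J (ev x (theta (pmul v u))))).
  have ltx := lin_comp (@theta_lin _ _ (CurAlg H B)) (ev_lin lx).
  split.
    rewrite (lin0 (pmul_linl _)) (lin0 (pmul_linr _)) (lin0 ltx).
    by split; apply: (sub0 (hspan_sub _)).
  move=> k y z [Hy Hy'] [Hz Hz']; rewrite pmul_linl pmul_linr !ltx.
  by split; apply: (hspan_sub _).2.
have ltx := lin_comp (@theta_lin _ _ (CurAlg H B)) (ev_lin lx).
move=> h b Jb; elim/tens_ind: v => [h' b'||v v' [I1 I2] [I1' I2']].
- by rewrite !CurAlgE; split; apply: hspan_theta => //; [apply: Jr|apply: Jl].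
- rewrite (lin0 (pmul_linl _)) (lin0 (pmul_linr _)) (lin0 ltx).
  by split; apply: (sub0 (hspan_sub _)).
rewrite (linD (pmul_linl (p := CurAlg H B) _)) (linD (pmul_linr (p := CurAlg H B) _)).
by rewrite !(linD ltx); split; apply: (subD (hspan_sub _)).
Qed.

(** A two-sided ideal J of B gives the ideal H (x) J of Cur B. If this is zero so is J; if it is
    everything, the counit yields J = B. *)
Lemma simple_coef : simple_in (range i) -> forall J : B -> Prop, subspace J ->
  (forall b x, J x -> J (b ** x)) -> (forall b x, J x -> J (x ** b)) ->
  (forall x, J x -> x = 0) \/ (forall x, J x).
Proof.
move=> Ss J sJ Jl Jr.
have le := ev_lin (V := B) (@heps_lin K H).
pose I : set R := fun r => exists2 u, hspan J u & r = i u.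
have ev1 b : ev (@heps K H) (aone \ox b) = b :> B.
  by rewrite evE; [rewrite heps1 scale1r|exact: heps_lin].
have iI : ideal_in (range i) I.
  split.
  - split.
    + by exists 0; [apply: (sub0 (hspan_sub _))|rewrite (lin0 li)].
    + move=> _ _ [u hu ->] [v hv ->]; exists (u + v); last by rewrite (linD li).
      exact: (subD (hspan_sub _)).
    + move=> h _ [u hu ->]; exists (hact h u); last by case: ih => -[_ ->].
      apply: (hu (fun u => hspan J (hact h u))).
        split=> [|k y z Hy Hz].
          rewrite (lin0 (@hact_linr K H (CurAlg H B) h)); exact: (sub0 (hspan_sub _)).
        by rewrite (@hact_linr K H (CurAlg H B) h); apply: (hspan_sub _).2.
      by move=> f b Jb; rewrite CurAlg_actE; apply: hspan_pure.
  - by move=> _ [u _ ->]; exists u.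
  move=> x lx _ _ y [u hu ->] [v _ <-].
  have lxS : linear (fun h => x (hS h)) := lin_comp (@hS_lin K H) lx.
  have [H1 H2] := hspan_mul v lxS sJ Jl Jr hu.
  have [hh im] := ih.
  split=> /(xprodE lx) ->; rewrite im theta_HHmap // ev_tmap //.
    by exists (ev (fun h => x (hS h)) (theta (pmul u v))).
  by exists (ev (fun h => x (hS h)) (theta (pmul v u))).
case: (Ss I iI) => E; [left|right] => x.
  move=> Jx; have : I (i (aone \ox x)) by exists (aone \ox x) => //; apply: hspan_pure.
  rewrite E -(lin0 li) => /= /ii /(congr1 (ev (@heps K H))).
  by rewrite ev1 (lin0 le).
have : I (i (aone \ox x)) by rewrite E; exists (aone \ox x).
move=> [u hu /ii Eu]; rewrite -[x]ev1 Eu.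
apply: (hu (fun u => J (ev (@heps K H) u))).
  split=> [|k y z Hy Hz]; first by rewrite (lin0 le); apply: sub0.
  by rewrite le; apply: sJ.2.
move=> h b Jb; rewrite evE; last exact: heps_lin.
exact: subZ.
Qed.
End FiniteSimple.
End CurrentSubalgebra.

(** * Matrix coinvariants *)

Lemma delta_mulmxl (K : fieldType) n (P : 'M[K]_n) (a b p q : 'I_n) :
  (delta_mx a b *m P) p q = (p == a)%:R * P b q.
Proof.
rewrite mxE (bigD1 b) //= !mxE eqxx andbT big1 ?addr0 // => j jb.
by rewrite !mxE (negPf jb) andbF mul0r.
Qed.
Lemma delta_mulmxr (K : fieldType) n (P : 'M[K]_n) (a b p q : 'I_n) :
  (P *m delta_mx a b) p q = P p a * (q == b)%:R.
Proof.
rewrite mxE (bigD1 a) //= !mxE eqxx andTb big1 ?addr0 // => j ja.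
by rewrite !mxE (negPf ja) mulr0.
Qed.
Lemma mx_center (K : fieldType) n (P : 'M[K]_n) :
  (forall Q, Q *m P = P *m Q) -> exists c, P = c%:M.
Proof.
case: n P => [|n] P PQ; first by exists 0; apply/matrixP => -[].
exists (P ord0 ord0); apply/matrixP => i k.
have := congr1 (fun M : 'M_n.+1 => M ord0 k) (PQ (delta_mx ord0 i)).
rewrite delta_mulmxl delta_mulmxr eqxx mul1r !mxE => ->; rewrite eq_sym.
by case: (i == k); rewrite /= ?mulr1 ?mulr0.
Qed.

Section MatrixCoinvariants.
Variables (K : fieldType).
Hypothesis char0 : forall n, n.+1%:R != 0 :> K.
Variable g : lieAlg K.
Local Notation H := (UH g).
Variables (A : pzAlgType K) (co : A -> tens H A).
Hypothesis co_hom : alg_hom co.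
Hypothesis co_counit : forall a, ev (@heps K H) (co a) = a.
Hypothesis coA : forall a, tassoc (tmap id co (co a)) = tmap (@hD K H) id (co a).
Hypothesis A1 : (aone : A) <> 0.
Variables (n : nat) (al : 'M[K]_n -> A).
Hypotheses (al_hom : alg_hom al) (al_inj : injective al).
Hypothesis co_al : forall P, co (al P) = aone \ox al P.
Hypothesis al_coinv : forall a, co a = aone \ox a -> exists P, a = al P.

Let al_lin : linear al. Proof. by case: al_hom. Qed.
Let al1 : al 1%:M = aone. Proof. by case: al_hom. Qed.
Let alM P Q : al (P *m Q) = al P ** al Q. Proof. by case: al_hom => _ _; apply. Qed.

Definition centr (a : A) := forall P, al P ** a = a ** al P.

Lemma centr_sub : subspace centr.
Proof.
split=> [P|k a b Ca Cb P]; first by rewrite amul0l amul0r.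
by rewrite amul_linl amul_linr Ca Cb.
Qed.
Lemma centr_mul a b : centr a -> centr b -> centr (a ** b).
Proof. by move=> Ca Cb P; rewrite amulA Ca -amulA Cb amulA. Qed.
Lemma centr1 : centr aone. Proof. by move=> P; rewrite amul1a amula1. Qed.
Lemma ev_mul1l (y : H -> K^o) (c : A) t : linear y ->
  ev y ((aone \ox c : tens H A) ** t) = c ** ev y t.
Proof.
move=> ly; move: t; apply: tens_ext => [||h a].
- exact: (lin_comp (amul_linr _) (ev_lin ly)).
- exact: (lin_comp (ev_lin ly) (amul_linr _)).
by rewrite tmulE !evE // amul1a amulZr.
Qed.
Lemma ev_mul1r (y : H -> K^o) (c : A) t : linear y ->
  ev y (t ** (aone \ox c : tens H A)) = ev y t ** c.
Proof.
move=> ly; move: t; apply: tens_ext => [||h a].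
- exact: (lin_comp (amul_linl _) (ev_lin ly)).
- exact: (lin_comp (ev_lin ly) (amul_linl _)).
by rewrite tmulE !evE // amula1 amulZl.
Qed.
Lemma centr_xa (y : H -> K^o) a : linear y -> centr a -> centr (xa co y a).
Proof.
have [_ _ cM] := co_hom => ly Ca P.
by rewrite /xa -ev_mul1l // -ev_mul1r // -co_al -!cM Ca.
Qed.
(** A coinvariant is a matrix, and a matrix commuting with all matrices is scalar. *)
Lemma centr_coinv a : centr a -> co a = aone \ox a -> exists c : K, a = c *: aone.
Proof.
move=> Ca /al_coinv [P EP]; rewrite EP in Ca *.
have PQ Q : Q *m P = P *m Q by apply: al_inj; rewrite !alM; apply: Ca.
suff [c ->] : exists c, P = c%:M.
  by exists c; rewrite -al1 -(linZ al_lin) scalemx1.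
exact: mx_center PQ.
Qed.

(** The (i, j) coefficient of a in the standard factorization of an algebra containing M_n with the
    same unit as M_n (x) centralizer. *)
Definition mcoef (i j : 'I_n) (a : A) : A :=
  \sum_k al (delta_mx k i) ** a ** al (delta_mx j k).
Lemma mcoef_lin i j : linear (mcoef i j).
Proof.
move=> c x y; rewrite /mcoef scaler_sumr -big_split; apply: eq_bigr => k _ /=.
by rewrite amul_linr amul_linl.
Qed.
Lemma mcoef_centr i j a : centr (mcoef i j a).
Proof.
move=> P.
have {1}-> : P = \sum_p \sum_q P p q *: delta_mx p q by exact: matrix_sum_delta.
rewrite (lin_sum _ _ _ al_lin) (lin_sum _ _ _ (amul_linl _)).
rewrite [in RHS](matrix_sum_delta P) (lin_sum _ _ _ al_lin) (lin_sum _ _ _ (amul_linr _)).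
apply: eq_bigr => p _.
rewrite !(lin_sum _ _ _ al_lin) (lin_sum _ _ _ (amul_linl _)) (lin_sum _ _ _ (amul_linr _)).
apply: eq_bigr => q _; rewrite (linZ al_lin) amulZl amulZr; congr (_ *: _).
rewrite /mcoef (lin_sum _ _ _ (amul_linr _)) (lin_sum _ _ _ (amul_linl _)).
rewrite (bigD1 q) //= [RHS](bigD1 p) //= big1 => [|k kq]; last first.
  by rewrite !amulA -alM mul_delta_mx_0 1?eq_sym // (lin0 al_lin) !amul0l.
rewrite [in RHS]big1 => [|k kp]; last first.
  by rewrite -!amulA -alM mul_delta_mx_0 // (lin0 al_lin) !amul0r.
by rewrite !addr0 !amulA -alM -[in RHS]amulA -alM !mul_delta_mx.
Qed.
(** With 1 = sum_i e_ii inserted on both sides of a, the term e_ii a e_jj is e_ij times the (i, j)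
    coefficient. *)
Lemma mcoef_sum a : a = \sum_i \sum_j al (delta_mx i j) ** mcoef i j a.
Proof.
have E1 : aone = \sum_i al (delta_mx i i).
  rewrite -(lin_sum _ _ _ al_lin) -al1; congr al; apply/matrixP => p q.
  rewrite summxE (bigD1 p) //= !mxE eqxx /= eq_sym big1 ?addr0 // => j jp.
  by rewrite mxE eq_sym (negPf jp).
rewrite -{1}[a]amul1a -{1}[aone ** a]amula1 {1}E1 (lin_sum _ _ _ (amul_linl _)).
rewrite (lin_sum _ _ _ (amul_linl _)); apply: eq_bigr => i _.
rewrite {1}E1 (lin_sum _ _ _ (amul_linr _)); apply: eq_bigr => j _.
rewrite /mcoef (lin_sum _ _ _ (amul_linr _)) (bigD1 j) //= big1 ?addr0 => [|k kj].
  by rewrite !amulA -alM mul_delta_mx.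
by rewrite !amulA -alM mul_delta_mx_0 1?eq_sym // (lin0 al_lin) !amul0l.
Qed.

Section Factorization.
Variables (U : pzAlgType K) (psi : U -> A).
Hypotheses (psi_hom : alg_hom psi) (psi_inj : injective psi).
Hypothesis psi_centr : forall u, centr (psi u).
Hypothesis psi_surj : forall a, centr a -> exists u, a = psi u.
Let psi_lin : linear psi. Proof. by case: psi_hom. Qed.

Definition mprod (t : tens 'M[K]_n U) : A := tenslift (fun P u => al P ** psi u) t.
Lemma mprod_bilin : bilin (fun (P : 'M[K]_n) u => al P ** psi u).
Proof.
split=> z; first exact: (lin_comp al_lin (amul_linl _)).
exact: (lin_comp psi_lin (amul_linr _)).
Qed.
Lemma mprodE P u : mprod (P \ox u) = al P ** psi u.
Proof. exact: tensliftE mprod_bilin. Qed.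
Lemma mprod_lin : linear mprod. Proof. exact: tenslift_lin mprod_bilin. Qed.
Lemma mprodM t u : mprod (t ** u) = mprod t ** mprod u.
Proof.
have [_ _ pM] := psi_hom.
move: t; apply: tens_ext => [||P v].
- exact: (lin_comp (amul_linl u) mprod_lin).
- exact: (lin_comp mprod_lin (amul_linl _)).
move: u; apply: tens_ext => [||Q w].
- exact: (lin_comp (amul_linr _) mprod_lin).
- exact: (lin_comp mprod_lin (amul_linr _)).
rewrite tmulE !mprodE alM pM !amulA; congr (_ ** _).
by rewrite -!amulA; congr (_ ** _); exact: psi_centr.
Qed.
Lemma mprod_surj a : exists t, mprod t = a.
Proof.
have ex i j : exists u, mcoef i j a = psi u by apply: psi_surj; apply: mcoef_centr.
exists (\sum_i \sum_j ((delta_mx i j : 'M[K]_n) \ox projT1 (cid (ex i j)))).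
rewrite [RHS]mcoef_sum (lin_sum _ _ _ mprod_lin); apply: eq_bigr => i _.
rewrite (lin_sum _ _ _ mprod_lin); apply: eq_bigr => j _.
by rewrite mprodE; congr (_ ** _); case: (cid _).
Qed.
(** Since sum_k e_ki P e_jk is P_ij times the identity, the coefficients recover the entries; this
    gives injectivity of [mprod]. *)
Lemma mcoef_mprod i j t :
  mcoef i j (mprod t) = psi (ev (fun P : 'M[K]_n => P i j : K^o) t).
Proof.
have lc : linear (fun P : 'M[K]_n => P i j : K^o) by move=> k P Q; rewrite !mxE.
move: t; apply: tens_ext => [||P u].
- exact: (lin_comp mprod_lin (mcoef_lin i j)).
- exact: (lin_comp (ev_lin lc) psi_lin).
rewrite mprodE evE // (linZ psi_lin) /mcoef.
transitivity (\sum_k al (delta_mx k i *m P *m delta_mx j k) ** psi u).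
  by apply: eq_bigr => k _; rewrite !alM -!amulA; congr (_ ** (_ ** _)); rewrite psi_centr.
rewrite -(lin_sum _ _ _ (amul_linl (psi u))) -(lin_sum _ _ _ al_lin).
suff -> : \sum_(k < n) delta_mx k i *m P *m delta_mx j k = P i j *: (1%:M : 'M[K]_n).
  by rewrite (linZ al_lin) al1 amulZl amul1a.
apply/matrixP => p q; rewrite summxE (bigD1 p) //= big1 ?addr0 => [|k kp].
  by rewrite delta_mulmxr delta_mulmxl eqxx mul1r !mxE [q == p]eq_sym.
by rewrite delta_mulmxr delta_mulmxl eq_sym (negPf kp) !mul0r.
Qed.
Lemma mprod_inj : injective mprod.
Proof.
move=> t u E; apply: tens_sep2 => y ly.
have yE (v : tens 'M[K]_n U) : ev y v = \sum_i \sum_j (y (delta_mx i j) : K) *: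
    ev (fun P : 'M[K]_n => P i j : K^o) v.
  have lc i j : linear (fun P : 'M[K]_n => P i j : K^o) by move=> k P Q; rewrite !mxE.
  move: v; apply: tens_ext => [||P v].
  - exact: ev_lin.
  - move=> k a b; rewrite scaler_sumr -big_split; apply: eq_bigr => i _ /=.
    rewrite scaler_sumr -big_split; apply: eq_bigr => j _ /=.
    by rewrite (ev_lin (lc i j)) scalerDr !scalerA mulrC.
  rewrite evE // {1}[P]matrix_sum_delta (lin_sum _ _ _ ly) scaler_suml.
  apply: eq_bigr => i _; rewrite (lin_sum _ _ _ ly) scaler_suml.
  apply: eq_bigr => j _; rewrite evE // (linZ ly) scalerA; congr (_ *: _).
  by rewrite /GRing.scale /= mulrC.
rewrite !yE; apply: eq_bigr => i _; apply: eq_bigr => j _; congr (_ *: _).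
by apply: psi_inj; rewrite -!mcoef_mprod E.
Qed.
End Factorization.

Theorem matrix_coinvariants : exists (h : {vspace g}) (hc : lie_closed h)
    (phi : lie_sub hc -> lie_sub hc -> K^o) (phiC : cocycle2 phi)
    (bet : tens 'M[K]_n (Uphi phiC) -> A),
  [/\ linear bet, forall t u, bet (t ** u) = bet t ** bet u, bijective bet &
    forall t, co (bet t) = tenslift (fun b0 b1 =>
      (Umap (lie_sub_hom hc) (hS b1) : H) \ox bet b0) (EndUphi_co t)].
Proof.
have [h [hc [phi [phiC [psi [ph pco pinj pc ps]]]]]] :=
  coinvariants_scalar_Uphi char0 co_hom co_counit coA A1 centr_sub centr_mul
    centr1 centr_xa centr_coinv.
exists h, hc, phi, phiC, (mprod psi).
have [pl _ _] := ph; have lb := mprod_lin ph.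
split=> //; first exact: (mprodM ph pc).
  have surj := mprod_surj ph ps.
  exists (fun a => projT1 (cid (surj a))) => [t|a]; last by case: (cid _).
  by apply: (mprod_inj ph pinj pc); case: (cid _).
have lj := @jS_lin K g h hc.
have bi : bilin (fun (b0 : tens 'M[K]_n (Uphi phiC)) (b1 : UH (lie_sub hc)) =>
    (Umap (lie_sub_hom hc) (hS b1) : H) \ox mprod psi b0).
  split=> z; first exact: (lin_comp lb (tpure_linr _)).
  exact: (lin_comp lj (tpure_linl _)).
have [cl _ cM] := co_hom.
apply: tens_ext => [||P u].
- exact: (lin_comp lb cl).
- exact: (lin_comp (@EndUphi_co_lin _ _ _ _ _) (tenslift_lin bi)).
rewrite mprodE // cM co_al pco /uco /EndUphi_co tmapE //; last exact: Uphi_co_lin.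
move: (Uphi_co u); have lt := tmap_lin (@lin_id _ H) pl.
apply: tens_ext => [||v b1].
- exact: (lin_comp (tmap_lin (@lin_id _ _) lj)
   (lin_comp (@tswap_lin _ _ _) (lin_comp lt (amul_linr _)))).
- exact: (lin_comp (tpure_linr _) (lin_comp (@tassoc_lin _ _ _ _) (tenslift_lin bi))).
by rewrite tassocE tensliftE // tmapE // tswapE tmapE // tmulE amul1a mprodE.
Qed.
End MatrixCoinvariants.

(** * The isomorphism *)

Section Assembly.
Variables (K : fieldType) (g : lieAlg K).
Local Notation H := (UH g).
Variables (R : pseudo H) (e : R).
Hypothesis Ras : passoc R.
Hypothesis eE : pmul e e = (aone \ox aone) \oxH e.
Hypothesis e1 : forall r, ev (@heps K H) (theta (pmul e r)) = r.
Hypothesis lann : forall r : R, (forall s, pmul r s = 0) -> r = 0.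
Local Notation A := (RA Ras eE e1).
Variables (h : {vspace g}) (hc : lie_closed h).
Variables (phi : lie_sub hc -> lie_sub hc -> K^o) (phiC : cocycle2 phi) (n : nat).
Local Notation H' := (UH (lie_sub hc)).
Local Notation j := (Umap (lie_sub_hom hc)).
Local Notation E := (tens 'M[K]_n (Uphi phiC)).
Local Notation D := (CendPhi phiC n).
Variable bet : E -> A.
Hypotheses (bet_lin : linear bet) (betM : forall t u, bet (t ** u) = bet t ** bet u).
Hypothesis bet_bij : bijective bet.
Hypothesis bet_co : forall t, RAcoact (bet t) = tenslift (fun b0 b1 =>
      (j (hS b1) : H) \ox bet b0) (EndUphi_co t).

Let lj : linear (j : H' -> H). Proof. by case: (hopf_fun_hom j). Qed.
Let j1 : j (aone : H') = aone. Proof. by case: (hopf_fun_hom j). Qed.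
Let jM (x y : H') : j (x ** y) = (j x : H) ** j y.
Proof. by case: (hopf_fun_hom j). Qed.
Let vbet (t : E) : R := RAval (bet t).
Let vbet_lin : linear vbet.
Proof. exact: (lin_comp bet_lin (@RAval_lin _ _ _ _ _ _ _)). Qed.

Lemma Diff_actE (k f : H') (t : E) : hact k (f \ox t : D) = (k ** f) \ox t.
Proof. exact: free_actE. Qed.

Definition iso0 (w : D) : R := tenslift (fun (k : H') t => hact (j k) (vbet t)) w.
Let iso0_bi : bilin (fun (k : H') t => hact (j k) (vbet t)).
Proof.
split=> z; first exact: (lin_comp lj (hact_linl _)).
exact: (lin_comp vbet_lin (hact_linr _)).
Qed.
Lemma iso0_lin : linear iso0. Proof. exact: tenslift_lin. Qed.
Lemma iso0E k t : iso0 (k \ox t) = hact (j k) (vbet t).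
Proof. exact: tensliftE. Qed.
Lemma iso0_act k w : iso0 (hact k w) = hact (j k) (iso0 w).
Proof.
move: w; apply: tens_ext => [||f t].
- exact: (lin_comp (@hact_linr K H' D k) iso0_lin).
- exact: (lin_comp iso0_lin (hact_linr _)).
by rewrite Diff_actE !iso0E jM hactM.
Qed.

Definition iso (u : Cur j D) : R := curlift (fun f w => hact f (iso0 w)) u.
Let iso_bal : cbal j (fun f w => hact f (iso0 w)).
Proof.
split=> [w|f|f k w]; first exact: hact_linl.
  exact: (lin_comp iso0_lin (hact_linr _)).
by rewrite iso0_act hactM.
Qed.
Lemma iso_lin : linear iso. Proof. exact: curlift_lin. Qed.
Lemma isoE f w : iso (cpure j f w) = hact f (iso0 w).
Proof. exact: curliftE. Qed.
Lemma iso_hm : hm_hom (M := Cur j D) iso.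
Proof.
split; first exact: iso_lin.
move=> k u; move: u; apply: cur_ext => [||f w].
- exact: (lin_comp (@hact_linr K H (Cur j D) k) iso_lin).
- exact: (lin_comp iso_lin (hact_linr _)).
by rewrite -[hact k _]/(cur_act k _) cur_actE !isoE hactM.
Qed.

Let prodf (t t' : E) (b0 : E) (b1 : H') : HHt D :=
  (hS b1 \ox aone) \oxH (aone \ox (t ** b0) : D).
Lemma DiffE k k' t t' : pmul (k \ox t : D) (k' \ox t' : D) =
  hhact (k \ox k') (tenslift (prodf t t') (EndUphi_co t')).
Proof.
rewrite /= free_pmulE; first by [].
exact: (Diff_bilin (@EndUphi_co_lin _ _ _ phiC n)).
Qed.

(** On generators both sides have the coefficients S(b_1), on the left by the definition of Diff and
    on the right by [pmul_RA] and [bet_co]; [bet] carries the products t b_0 along. *)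
Lemma iso0_pmul w w' :
  HHmap (M := Cur j D) iso (cur_incl j (pmul w w')) = pmul (iso0 w) (iso0 w').
Proof.
have lHi := lin_comp (@cur_incl_lin K H' H j D) (HHmap_lin iso_hm).
move: w; apply: tens_ext => [||k t].
- exact: (lin_comp (pmul_linl (p := D) w') lHi).
- exact: (lin_comp iso0_lin (pmul_linl _)).
move: w'; apply: tens_ext => [||k' t'].
- exact: (lin_comp (pmul_linr (p := D) _) lHi).
- exact: (lin_comp iso0_lin (pmul_linr _)).
rewrite DiffE cur_incl_act (HHmap_act iso_hm) !iso0E pmulH tmapE //; congr hhact.
rewrite pmul_RA bet_co.
have lv := tmap_lin (@lin_id _ H) (@RAval_lin K g R e Ras eE e1).
have lS := @hS_lin K H'.
have bi1 : bilin (fun (b0 : E) (b1 : H') => (j (hS b1) : H) \ox bet b0).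
  split=> z; first exact: (lin_comp bet_lin (tpure_linr _)).
  exact: (lin_comp (lin_comp lS lj) (tpure_linl _)).
have bi2 : bilin (prodf t t').
  split=> z; last exact: (lin_comp lS (lin_comp (tpure_linl _) (hpure_linl (M := D) _))).
  exact: (lin_comp (amul_linr t) (lin_comp (tpure_linr _) (@hpure_linr K H' D _))).
move: (EndUphi_co t'); apply: tens_ext => [||b0 b1].
- exact: (lin_comp (tenslift_lin bi2) lHi).
- exact: (lin_comp (tenslift_lin bi1) (lin_comp (amul_linr _) (lin_comp lv (@jmap_lin _ _ _)))).
rewrite !tensliftE // cur_inclE (HHmapE _ _ iso_hm) isoE hact1 iso0E j1 hact1.
rewrite !tmulE amul1a -betM !tmapE //; try exact: RAval_lin.
by rewrite j1 jmapE.
Qed.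

Lemma iso_hom : pseudo_hom iso.
Proof.
split; first exact: iso_hm.
move=> u v; move: u; apply: cur_ext => [||f w].
- exact: (lin_comp iso_lin (pmul_linl _)).
- exact: (lin_comp (pmul_linl (p := Cur j D) v) (HHmap_lin iso_hm)).
move: v; apply: cur_ext => [||f' w'].
- exact: (lin_comp iso_lin (pmul_linr _)).
- exact: (lin_comp (pmul_linr (p := Cur j D) _) (HHmap_lin iso_hm)).
rewrite -[pmul (cpure j f w : Cur j D) _]/(cur_pmul _ _) cur_pmulE.
by rewrite (HHmap_act iso_hm) iso0_pmul !isoE pmulH.
Qed.

(** The inverse decomposes r in H (x) A and applies the inverse of [bet] to the second factor;
    elements of H' cross the balanced tensor product. The vanishing left annihilator ensures that
    the decomposition recovers r. *)
Lemma iso_bij : bijective iso.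
Proof.
have [inv betK invK] := bet_bij.
have linv : linear inv.
  by move=> k x y; apply: (can_inj betK); rewrite bet_lin !invK.
pose back0 (t : tens H A) : Cur j D :=
  tenslift (fun f a => cpure j f (aone \ox inv a : D)) t.
have bi : bilin (fun (f : H) a => cpure j f (aone \ox inv a : D)).
  split=> z; first exact: cpure_linl.
  exact: (lin_comp linv (lin_comp (tpure_linr _) (cpure_linr j (R := D) _))).
have lb : linear back0 by apply: tenslift_lin.
have ld := @decomp_lin K g R e Ras eE e1.
exists (fun r => back0 (decomp Ras eE e1 r)) => [u|r].
  move: u; apply: cur_ext => [||f w].
  - exact: (lin_comp iso_lin (lin_comp ld lb)).
  - exact: lin_id.
  rewrite isoE; move: w; apply: tens_ext => [||k t].
  - exact: (lin_comp iso0_lin (lin_comp (hact_linr _) (lin_comp ld lb))).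
  - exact: (cpure_linr j (R := D)).
  rewrite iso0E -hactM /vbet -recompE recompK /back0 tensliftE // betK.
  by rewrite cpure_bal Diff_actE amula1.
rewrite -[RHS](decompK Ras eE e1 lann); move: (decomp _ _ _ _).
apply: tens_ext => [||f a].
- exact: (lin_comp lb iso_lin).
- exact: recomp_lin.
by rewrite /back0 tensliftE // isoE iso0E j1 hact1 /vbet invK recompE.
Qed.

Lemma iso_inv (R' : pseudo H) (f : R' -> R) : pseudo_hom f -> bijective f ->
  pseudo_iso R R'.
Proof.
move=> [[lf fH] fM] [f' fK f'K]; exists f'.
have lf' : linear f' by move=> k x y; apply: (can_inj fK); rewrite lf !f'K.
have hf' : hm_hom f' by split=> // k x; apply: (can_inj fK); rewrite fH !f'K.
split; last by exists f.
split=> // a b.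
have FK (u : HHt R') : HHmap f' (HHmap f u) = u.
  move: u; apply: HHt_ext => [||t m].
  - exact: (lin_comp (HHmap_lin (conj lf fH)) (HHmap_lin hf')).
  - exact: lin_id.
  by rewrite !HHmapE // fK.
by rewrite -[LHS]FK -fM !f'K.
Qed.
End Assembly.

(** Eigenvectors enter through [wedderburn] only, and characteristic zero only through division by
    degrees of the Euler operator. *)
Theorem simple_unital_classification (K : fieldType) (g : lieAlg K)
    (R : pseudo (UH g)) (e : R) (S : set R) :
  (forall n, n.+1%:R != 0 :> K) -> has_eigenvectors K ->
  passoc R -> simple_pseudo R -> pseudoidentity e ->
  maximal_unital_current e S -> finite_in S -> simple_in S ->
  exists (h : {vspace g}) (hc : lie_closed h)
    (phi : lie_sub hc -> lie_sub hc -> K^o) (phiC : cocycle2 phi) (n : nat),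
    (0 < n)%N /\ pseudo_iso R (Cur (Umap (lie_sub_hom hc)) (CendPhi phiC n)).
Proof.
move=> char0 eigK Ras Rs pe mS fS sS.
have [eE e1 ee0] := pseudoidentity_mul pe.
have lann := simple_lann Ras Rs ee0.
have [[B [i [ih ii i1 Si]]] _] := mS.
rewrite Si in fS sS.
have Bfin := finite_coef ih ii fS.
have Bsim := simple_coef ih ii sS.
have e0 : e <> 0 by move=> e0; apply: ee0; rewrite e0 (lin0 (pmul_linl _)).
have B1 : (aone : B) <> 0.
  by move=> b1; apply: e0; rewrite -(ib1 i1) b1 (lin0 (ib_lin ih)).
have [n [be [n0 be_hom [ze beK zeK]]]] := wedderburn eigK B1 Bfin Bsim.
have [bel be1 beM] := be_hom.
pose A := RA Ras eE e1.
pose al (P : 'M[K]_n) : A := RAproj Ras eE e1 (ib i (ze P)).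
have zel : linear ze by move=> k x y; apply: (can_inj beK); rewrite bel !zeK.
have alE P : RAval (al P) = ib i (ze P).
  by rewrite /al RAprojK proj_id //; apply: ib_rconst ih i1 _.
have al_hom : alg_hom al.
  split.
  - exact: (lin_comp (lin_comp zel (ib_lin ih)) (@RAproj_lin _ _ _ _ _ _ _)).
  - apply: RAval_inj; rewrite alE RAval1.
    by have <- : aone = ze aone; [apply: (can_inj beK); rewrite be1 zeK|exact: ib1].
  move=> P Q; apply: RAval_inj; rewrite RAvalM !alE /dot (ibM ih) prod1_ione.
  by congr ib; apply: (can_inj beK); rewrite beM !zeK.
have al_inj : injective al.
  move=> P Q /(congr1 (@RAval _ _ _ _ _ _ _)); rewrite !alE => /ii.
  move=> /(congr1 (ev (@heps K (UH g)))); rewrite !evE; try exact: heps_lin.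
  by rewrite heps1 !scale1r => /(can_inj zeK).
have al_co P : RAcoact (al P) = aone \ox al P.
  apply: tmap_RAval_inj; rewrite RAcoact_val tmapE //; try exact: RAval_lin.
  by rewrite alE /coact (ib_coinv ih i1) theta_ione.
(* Here maximality enters: an element of A with trivial coaction already lies in the given current
   subalgebra. *)
have al_coinv (a : A) : RAcoact a = aone \ox a -> exists P, a = al P.
  move=> ac; have [b Eb] : exists b, RAval a = ib i b.
    apply: (maximal_coinv Ras eE e1 mS ih i1 Si); split; first exact: RAval_rconst.
    rewrite -[LHS]jmapK -/(coact e _) -RAcoact_val ac tmapE //; try exact: RAval_lin.
    by rewrite ioneE.
  by exists (be b); apply: RAval_inj; rewrite alE Eb beK.
have A1 : (aone : A) <> 0.
  move=> a1; apply: e0; rewrite -(RAval1 Ras eE e1) a1.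
  by rewrite (lin0 (@RAval_lin _ _ _ _ _ _ _)).
have [h [hc [phi [phiC [bet [bl bM bb bco]]]]]] :=
  matrix_coinvariants char0 (RAcoact_hom Ras eE e1) (@RAcoact_counit _ _ _ _ _ _ _)
   (@RAcoact_coassoc _ _ _ _ _ _ _) A1 al_hom al_inj al_co al_coinv.
exists h, hc, phi, phiC, n; split=> //.
exact: iso_inv (iso_hom bl bM bco) (iso_bij lann bl bb).
Qed.

Theorem theorem0p3 (RR : realType) (g : lieAlg RR[i]) (R : pseudo (UH g))
    (e : R) (S : set R) :
  passoc R -> simple_pseudo R -> pseudoidentity e ->
  maximal_unital_current e S -> finite_in S -> simple_in S ->
  [\/ exists n : nat, pseudo_iso R (CurAlg (UH g) 'M[RR[i]]_n),
      exists (H' : hopf RR[i]) (j : hopf_hom H' (UH g)) (n : nat),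
        [/\ injective j, (0 < n)%N & pseudo_iso R (Cur j (Cend H' n))]
    | exists (h : {vspace g}) (hc : lie_closed h)
        (phi : lie_sub hc -> lie_sub hc -> RR[i]^o) (phiC : cocycle2 phi)
        (n : nat),
        (0 < n)%N /\
        pseudo_iso R (Cur (Umap (lie_sub_hom hc)) (CendPhi phiC n))].
Proof.
(* Every R is of the third form, so no case distinction is made. *)
move=> Ras Rs pe mS fS sS; apply: Or33.
apply: (simple_unital_classification _ _ Ras Rs pe mS fS sS).
- by move=> n; rewrite Num.Theory.pnatr_eq0.
- exact: (@closed_eigenvectors RR[i]).
Qed.
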